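(* Let $r\in\{5,6\}$. There exists $n_0$ such that for all $n\ge n_0$, $\mathrm{ex}(n,\mathcal{T}_r)=\mathrm{ex}(n,\Sigma_r)$. Moreover, the extremal $r$-graphs (i.e. the $\mathcal{T}_r$-free $r$-graphs on $n\geq n_0$ vertices with $\mathrm{ex}(n,\mathcal{T}_r)$ edges) are blowups of the unique $(11,5,4)$ Steiner system if $r=5$, and blowups of the unique $(12,6,5)$ Steiner system if $r=6$.
   Context: An $r$-graph is a finite $r$-uniform hypergraph $\mathcal{G}$, identified with its edge set; $V(\mathcal{G})$ is its vertex set and $|\mathcal{G}|$ its number of edges. For a family $\mathfrak{F}$ of $r$-graphs, $\mathcal{G}$ is $\mathfrak{F}$-free if it contains no member of $\mathfrak{F}$ as a (not necessarily induced) subgraph; $\mathrm{ex}(n,\mathfrak{F})$ is the maximum of $|\mathcal{G}|$ over all $\mathfrak{F}$-free $r$-graphs $\mathcal{G}$ on $n$ vertices, and $\mathrm{ex}(n,\mathcal{F}):=\mathrm{ex}(n,\{\mathcal{F}\})$. $\Sigma_r$ is the family of all $r$-graphs with three edges $D_1,D_2,D_3$ such that $|D_1\cap D_2|=r-1$ and $D_1\triangle D_2\subseteq D_3$. The generalized triangle $\mathcal{T}_r\in\Sigma_r$ is the $r$-graph on $\{1,\dots,2r-1\}$ with the three edges $\{1,\dots,r-1,r\}$, $\{1,\dots,r-1,r+1\}$, $\{r,r+1,\dots,2r-1\}$. An $(m,r,r-1)$ Steiner system is an $r$-graph on $m$ vertices such that every $(r-1)$-subset of vertices is contained in exactly one edge.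 The $(11,5,4)$ and $(12,6,5)$ Steiner systems exist and are unique up to isomorphism. Cloning a vertex $v$ of $\mathcal{F}$ to a set $W\ni v$ (with $W\cap V(\mathcal{F})=\{v\}$) produces the $r$-graph on $V(\mathcal{F})\cup W$ whose edges are the edges of $\mathcal{F}$ not containing $v$ together with all sets $\{w\}\cup I$ with $w\in W$ and $\{v\}\cup I\in\mathcal{F}$, $v\notin I$. A blowup of $\mathcal{F}$ is an $r$-graph isomorphic to one obtained from $\mathcal{F}$ by repeatedly cloning and deleting vertices. *)

(* Defs.v *)
From mathcomp Require Import all_boot.
From mathcomp Require Import boolp.

Set Implicit Arguments.
Unset Strict Implicit.
Unset Printing Implicit Defensive.

Record hypergraph := Hypergraph {
  vertex : finType;
  edges : {set {set vertex}}
}.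

(* An r-graph is a hypergraph G such that uniform r G. *)
Definition uniform (r : nat) (G : hypergraph) : bool :=
  [forall e in edges G, #|e| == r].

(* G has a, not necessarily induced, subgraph isomorphic to F. *)
Definition contains (G F : hypergraph) : Prop :=
  exists2 f : vertex F -> vertex G,
    injective f & forall e : {set vertex F}, e \in edges F -> f @: e \in edges G.

Definition isomorphic (F G : hypergraph) : Prop :=
  exists2 f : vertex F -> vertex G,
    bijective f & forall e : {set vertex F}, (f @: e \in edges G) = (e \in edges F).

Definition family := hypergraph -> Prop.

Definition family1 (F : hypergraph) : family := fun H => H = F.

Definition free (Fs : family) (G : hypergraph) : Prop :=
  forall F, Fs F -> ~ contains G F.

(* The uniformity r, implicit in the usual notation ex(n, Fs), is an argument.
   Up to isomorphism the vertex set may be taken to be 'I_n. *)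
Definition ex (r n : nat) (Fs : family) : nat :=
  \max_(E : {set {set 'I_n}}
        | uniform r (Hypergraph E) && `[< free Fs (Hypergraph E) >]) #|E|.

Definition extremal (r n : nat) (Fs : family) (G : hypergraph) : Prop :=
  [/\ #|vertex G| = n, uniform r G, free Fs G & #|edges G| = ex r n Fs].

Definition Sigma (r : nat) : family := fun F =>
  [/\ uniform r F, #|edges F| = 3 &
      exists D1 D2 D3 : {set vertex F},
        [/\ edges F = [set D1; D2; D3],
            #|D1 :&: D2| = r.-1 &
            (D1 :\: D2) :|: (D2 :\: D1) \subset D3]].

(* The vertex labelled k in {1, ..., 2r-1} is the ordinal i with i.+1 = k.
   This is an r-graph when 2 <= r. *)
Definition generalized_triangle (r : nat) : hypergraph :=
  @Hypergraph 'I_(2 * r - 1)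
    [set [set i : 'I_(2 * r - 1) | i.+1 <= r];
         [set i : 'I_(2 * r - 1) | (i.+1 <= r.-1) || (i.+1 == r.+1)];
         [set i : 'I_(2 * r - 1) | r <= i.+1]].

(* (m, r, r-1) Steiner systems *)
Definition steiner (m r : nat) (S : hypergraph) : Prop :=
  [/\ #|vertex S| = m, uniform r S &
      forall A : {set vertex S}, #|A| = r.-1 ->
        #|[set e in edges S | A \subset e]| = 1].

Definition unique_steiner (m r : nat) (S : hypergraph) : Prop :=
  steiner m r S /\ forall S', steiner m r S' -> isomorphic S S'.

(* Cloning v to the set W = {v} + U, where U is the type of new vertices. *)
Definition clone_set (F : hypergraph) (v : vertex F) (U : finType) :
    {set vertex F + U} :=
  inl v |: [set inr u | u : U].

Definition clone (F : hypergraph) (v : vertex F) (U : finType) : hypergraph :=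
  @Hypergraph (vertex F + U)%type
    ([set inl @: e | e : {set vertex F} in edges F & v \notin e] :|:
     [set w |: (inl @: I)
        | w : (vertex F + U)%type in clone_set v U,
          I : {set vertex F} in
            [set I : {set vertex F} | (v \notin I) && (v |: I \in edges F)]]).

(* Deleting v also deletes the edges that contain v. *)
Definition delete (F : hypergraph) (v : vertex F) : hypergraph :=
  @Hypergraph {x : vertex F | x != v}
    [set e : {set {x : vertex F | x != v}} | val @: e \in edges F].

Inductive clone_delete (F : hypergraph) : hypergraph -> Prop :=
| clone_delete_refl : clone_delete F F
| clone_delete_clone G (v : vertex G) (U : finType) :
    clone_delete F G -> clone_delete F (clone v U)
| clone_delete_delete G (v : vertex G) :
    clone_delete F G -> clone_delete F (delete v).

Definition blowup (F G : hypergraph) : Prop :=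
  exists2 H, clone_delete F H & isomorphic H G.

(* Main.v *)
From Stdlib Require Import ZArith.
From mathcomp Require Import all_boot all_order all_algebra fingroup perm.
From mathcomp Require Import ring lra zify.
From mathcomp Require Import boolp.
Require Import Defs.
Set Implicit Arguments.
Unset Strict Implicit.
Unset Printing Implicit Defensive.
Import Order.TTheory GRing.Theory Num.Theory.

(** Let (r, m) be (5, 11) or (6, 12), and let S be a Steiner system with
    parameters (m, r, r-1).  The blow-up of S along a map phi from V to the points of S has as
    edges the r-sets that phi maps bijectively onto a block; when the parts (the fibres of phi)
    have nearly equal sizes it has about c n^r edges, with c = binom(m, r-1) / (r m^r)
    ([witt_density]).  Such a blow-up contains no member of Sigma_r ([pullback_Sfree]), hence
    no generalized triangle.  The proof shows that for large n a graph without T_r that has at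
    least as many edges as every blow-up is itself a blow-up ([exact_structure]); both extremal
    numbers are then attained by the same blow-ups.

    Density.  In a Sigma_r-free graph, symmetrisation ([zykov]) replaces a vertex by a
    clone of another vertex that lies in no common edge, without losing edges.  When no such step
    is left, vertices with different links lie in a common edge, the graph is a blow-up of
    the graph P of its twin classes, and two edges of P share at most r-2 vertices
    ([twin_pullback], [symmetrized_packing]).  If y gives the relative sizes of the classes,
    every vertex i of P has normalised degree at least c r - o(1), where the degree is the partial
    derivative at y of the edge polynomial of P.  Every (r-1)-set is in at most one edge of P,
    so the sum of these derivatives is the elementary symmetric polynomial e_(r-1)(y) minus the terms of
    uncovered (r-1)-sets.  Maclaurin's inequality, together with Johnson-type bounds on the number of
    uncovered sets for a few sizes, forces P to have exactly m vertices, to be a Steiner system,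
    and y to be nearly uniform ([near_extremal_weights]).  This is where (5, 11) and (6, 12)
    are special.

    Local structure.  Suppose that E is free of T_r and misses few edges of a balanced
    blow-up K.  Vertices of U whose link misses little of the link of their part have no
    common edge inside a part, and [exactness] gives that the part of E inside U is smaller than that of K by
    a constant proportion of the number of missing edges: a set I of size r-1 in a bad edge
    has about as many bad extensions as missing ones, while an exchange argument
    ([hybrid_count]) finds many missing edges whose faces lie in no bad edge.  A vertex
    of large degree can always be put in the right part ([vertex_class]), and a vertex of small degree
    costs edges wherever it is put ([local_gain]).  Together, [local_stability]: |E| plus a
    constant times the number of missing edges is at most the number of edges of some blow-up.

    Stability.  Take a dense Sigma_r-free graph that is not close to a blow-up, with maximal
    potential.  If it is symmetrized, the density argument applies.  Otherwise one
    symmetrisation step gives a graph close to a blow-up; by [local_stability] it is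
    much closer than required, and undoing the step changes only edges through one vertex
    ([stability]).  A T_r-free graph becomes Sigma_r-free after the deletion of the few edges that
    contain a pair of small codegree ([rich_edges_Sfree]), so it is close to a blow-up too, and
    [local_stability] applied to an extremal graph leaves no missing edge.

    Uniqueness of the Steiner systems is proved by a search that is checked by computation
    ([check_sound]), with S(5,6,12) reduced to S(4,5,11) by deriving at a point.  A blow-up of S with
    nonempty parts is obtained by cloning the points of S one after the other ([blowup_pullback]). *)

(** * Integer inequalities behind the excluded sizes *)

Section IntegerBounds.
Local Open Scope Z_scope.

(** Each bound below is certified by writing L times the difference of its two sides, on each
    piece of the range, as a polynomial with nonnegative coefficients in the distances to the end
    points of the piece. *)
Lemma bernstein (a b : Z) (L : positive) (t : Z) : Z.pos L * (b - a) = t -> 0 <= t -> a <= b.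
Proof. intros; nia. Qed.

Lemma bernstein_term (c x y i j : Z) : 0 <= c -> 0 <= x -> 0 <= y -> 0 <= c * (x ^ i * y ^ j).
Proof. intros; repeat apply Z.mul_nonneg_nonneg; trivial; apply Z.pow_nonneg; trivial. Qed.

(** With t = p / q the smallest weight on k = 7 points, this compares the bound on the degree sum
    (the Maclaurin bound for the other points, minus the contribution of 20 uncovered 4-sets) with
    999/1000 of the degree sum of S(4,5,11).  The lemmas for 8, 9, 10, 13 and 14 points have the
    same form. *)
Lemma weight_bound_7 (p q : Z) : 0 <= p -> 7 * p <= q ->
  1000 * 11^5 * (15 * (q - p)^4 + 120 * p * (q - p)^3 - 20 * 6^4 * p^4)
  <= 999 * 6^4 * 7 * 330 * q^4.
Proof.
intros h0 h1.
destruct (Z.le_gt_cases (14 * p) q) as [c0|c0].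
{ apply (@bernstein _ _ 1%positive (575001240 * (p^0 * (q - 14 * p)^4) + 22537009440 * (p^1 * (q - 14 * p)^3) + 313836708240 * (p^2 * (q - 14 * p)^2) + 1798564590240 * (p^3 * (q - 14 * p)^1) + 7611567990840 * (p^4 * (q - 14 * p)^0))); [lia|].
  repeat apply Z.add_nonneg_nonneg; apply bernstein_term; lia. }
apply (@bernstein _ _ 2401%positive (7611567990840 * ((14 * p - q)^0 * (q - 7 * p)^4) + 17856319831680 * ((14 * p - q)^1 * (q - 7 * p)^3) + 23277550253760 * ((14 * p - q)^2 * (q - 7 * p)^2) + 15702218737920 * ((14 * p - q)^3 * (q - 7 * p)^1) + 4049998302240 * ((14 * p - q)^4 * (q - 7 * p)^0))); [lia|].
  repeat apply Z.add_nonneg_nonneg; apply bernstein_term; lia.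
Qed.

Lemma weight_bound_8 (p q : Z) : 0 <= p -> 8 * p <= q ->
  1000 * 11^5 * (35 * (q - p)^4 + 245 * p * (q - p)^3 - 15 * 7^4 * p^4)
  <= 999 * 7^4 * 8 * 330 * q^4.
Proof.
intros h0 h1.
destruct (Z.le_gt_cases (16 * p) q) as [c0|c0].
{ apply (@bernstein _ _ 1%positive (695516360 * (p^0 * (q - 16 * p)^4) + 27602692040 * (p^1 * (q - 16 * p)^3) + 341167863960 * (p^2 * (q - 16 * p)^2) + 1018018857240 * (p^3 * (q - 16 * p)^1) + 2262667443960 * (p^4 * (q - 16 * p)^0))); [lia|].
  repeat apply Z.add_nonneg_nonneg; apply bernstein_term; lia. }
apply (@bernstein _ _ 512%positive (282833430495 * ((16 * p - q)^0 * (q - 8 * p)^4) + 113314864740 * ((16 * p - q)^1 * (q - 8 * p)^3) + 1372286922930 * ((16 * p - q)^2 * (q - 8 * p)^2) + 1769390683060 * ((16 * p - q)^3 * (q - 8 * p)^1) + 583689570695 * ((16 * p - q)^4 * (q - 8 * p)^0))); [lia|].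
  repeat apply Z.add_nonneg_nonneg; apply bernstein_term; lia.
Qed.

Lemma weight_bound_9 (p q : Z) : 0 <= p -> 9 * p <= q ->
  1000 * 11^5 * (70 * (q - p)^4 + 448 * p * (q - p)^3 - 36 * 8^4 * p^4)
  <= 999 * 8^4 * 9 * 330 * q^4.
Proof.
intros h0 h1.
destruct (Z.le_gt_cases (36 * p) q) as [c0|c0].
{ apply (@bernstein _ _ 1%positive (879384880 * (p^0 * (q - 36 * p)^4) + 99574854720 * (p^1 * (q - 36 * p)^3) + 4064798606880 * (p^2 * (q - 36 * p)^2) + 69461430125120 * (p^3 * (q - 36 * p)^1) + 425176810732080 * (p^4 * (q - 36 * p)^0))); [lia|].
  repeat apply Z.add_nonneg_nonneg; apply bernstein_term; lia. }
destruct (Z.le_gt_cases (18 * p) q) as [c1|c1].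
{ apply (@bernstein _ _ 729%positive (2952616741195 * ((36 * p - q)^0 * (q - 18 * p)^4) + 3127788199140 * ((36 * p - q)^1 * (q - 18 * p)^3) + 813461015730 * ((36 * p - q)^2 * (q - 18 * p)^2) + 21242782660 * ((36 * p - q)^3 * (q - 18 * p)^1) + 24024802395 * ((36 * p - q)^4 * (q - 18 * p)^0))); [lia|].
  repeat apply Z.add_nonneg_nonneg; apply bernstein_term; lia. }
apply (@bernstein _ _ 729%positive (384396838320 * ((18 * p - q)^0 * (q - 9 * p)^4) + 2136438768640 * ((18 * p - q)^1 * (q - 9 * p)^3) + 7678461204480 * ((18 * p - q)^2 * (q - 9 * p)^2) + 7548202844160 * ((18 * p - q)^3 * (q - 9 * p)^1) + 2262855147520 * ((18 * p - q)^4 * (q - 9 * p)^0))); [lia|].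
  repeat apply Z.add_nonneg_nonneg; apply bernstein_term; lia.
Qed.

Lemma weight_bound_10 (p q : Z) : 0 <= p -> 10 * p <= q ->
  1000 * 11^5 * (126 * (q - p)^4 + 756 * p * (q - p)^3 - 30 * 9^4 * p^4)
  <= 999 * 9^4 * 10 * 330 * q^4.
Proof.
intros h0 h1.
destruct (Z.le_gt_cases (20 * p) q) as [c0|c0].
{ apply (@bernstein _ _ 1%positive (1337222700 * (p^0 * (q - 20 * p)^4) + 66392964000 * (p^1 * (q - 20 * p)^3) + 1017752472000 * (p^2 * (q - 20 * p)^2) + 3545574516000 * (p^3 * (q - 20 * p)^1) + 12799711980000 * (p^4 * (q - 20 * p)^0))); [lia|].
  repeat apply Z.add_nonneg_nonneg; apply bernstein_term; lia. }
apply (@bernstein _ _ 1%positive (1279971198 * ((20 * p - q)^0 * (q - 10 * p)^4) + 1574310276 * ((20 * p - q)^1 * (q - 10 * p)^3) + 7220628360 * ((20 * p - q)^2 * (q - 10 * p)^2) + 8198914284 * ((20 * p - q)^3 * (q - 10 * p)^1) + 2609847702 * ((20 * p - q)^4 * (q - 10 * p)^0))); [lia|].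
  repeat apply Z.add_nonneg_nonneg; apply bernstein_term; lia.
Qed.

Lemma weight_bound_13 (p q : Z) : 0 <= p -> 13 * p <= q ->
  1000 * 12^6 * (792 * (q - p)^5 + 5940 * p * (q - p)^4 - 147 * 12^5 * p^5)
  <= 999 * 12^5 * 13 * 792 * q^5.
Proof.
intros h0 h1.
destruct (Z.le_gt_cases (26 * p) q) as [c0|c0].
{ apply (@bernstein _ _ 1%positive (194512969728 * (p^0 * (q - 26 * p)^5) + 19374437744640 * (p^1 * (q - 26 * p)^4) + 747331836641280 * (p^2 * (q - 26 * p)^3) + 13813991848673280 * (p^3 * (q - 26 * p)^2) + 120459410832752640 * (p^4 * (q - 26 * p)^1) + 495426078821449728 * (p^5 * (q - 26 * p)^0))); [lia|].
  repeat apply Z.add_nonneg_nonneg; apply bernstein_term; lia. }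
apply (@bernstein _ _ 371293%positive (495426078821449728 * ((26 * p - q)^0 * (q - 13 * p)^5) + 911158053281464320 * ((26 * p - q)^1 * (q - 13 * p)^4) + 1024936047337144320 * ((26 * p - q)^2 * (q - 13 * p)^3) + 920232565436252160 * ((26 * p - q)^3 * (q - 13 * p)^2) + 486512124304343040 * ((26 * p - q)^4 * (q - 13 * p)^1) + 103262327676002304 * ((26 * p - q)^5 * (q - 13 * p)^0))); [lia|].
  repeat apply Z.add_nonneg_nonneg; apply bernstein_term; lia.
Qed.

Lemma weight_bound_14 (p q : Z) : 0 <= p -> 14 * p <= q ->
  1000 * 12^6 * (1287 * (q - p)^5 + 9295 * p * (q - p)^4 - 40 * 13^5 * p^5)
  <= 999 * 13^5 * 14 * 792 * q^5.
Proof.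
intros h0 h1.
destruct (Z.le_gt_cases (28 * p) q) as [c0|c0].
{ apply (@bernstein _ _ 1%positive (269818479216 * (p^0 * (q - 28 * p)^5) + 29234672850240 * (p^1 * (q - 28 * p)^4) + 1231495753213440 * (p^2 * (q - 28 * p)^3) + 25028196026296320 * (p^3 * (q - 28 * p)^2) + 243003187821588480 * (p^4 * (q - 28 * p)^1) + 934509680532799488 * (p^5 * (q - 28 * p)^0))); [lia|].
  repeat apply Z.add_nonneg_nonneg; apply bernstein_term; lia. }
apply (@bernstein _ _ 16807%positive (29203427516649984 * ((28 * p - q)^0 * (q - 14 * p)^5) + 39703242911304960 * ((28 * p - q)^1 * (q - 14 * p)^4) + 20076397139784960 * ((28 * p - q)^2 * (q - 14 * p)^3) + 8443248279972480 * ((28 * p - q)^3 * (q - 14 * p)^2) + 4549363959273120 * ((28 * p - q)^4 * (q - 14 * p)^1) + 1147858244247312 * ((28 * p - q)^5 * (q - 14 * p)^0))); [lia|].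
  repeat apply Z.add_nonneg_nonneg; apply bernstein_term; lia.
Qed.

Lemma size_bound_12 (j : Z) : 0 <= j ->
  1000 * 11^5 * ((12 + j) * (11 + j) * (10 + j) * (9 + j)) <= 999 * 330 * 24 * (12 + j)^5.
Proof.
intros h; apply (@bernstein _ _ 1%positive (55492810560 * (j^0 * 1^0) + 83032976400 * (j^1 * 1^0) + 30588133400 * (j^2 * 1^0) + 4629253200 * (j^3 * 1^0) + 313673800 * (j^4 * 1^0) + 7912080 * (j^5 * 1^0))); [lia|].
repeat apply Z.add_nonneg_nonneg; apply bernstein_term; lia.
Qed.

Lemma size_bound_15 (j : Z) : 0 <= j ->
  1000 * 12^6 * ((15 + j) * (14 + j) * (13 + j) * (12 + j) * (11 + j)) <= 999 * 792 * 120 * (15 + j)^6.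
Proof.
intros h; apply (@bernstein _ _ 1%positive (5453240760000 * (j^0 * 1^0) + 13737054384000 * (j^1 * 1^0) + 7079027400000 * (j^2 * 1^0) + 1377401760000 * (j^3 * 1^0) + 126350280000 * (j^4 * 1^0) + 5559062400 * (j^5 * 1^0) + 94944960 * (j^6 * 1^0))); [lia|].
repeat apply Z.add_nonneg_nonneg; apply bernstein_term; lia.
Qed.

End IntegerBounds.

(** * Elementary symmetric polynomials of weights on a finite set *)

Local Open Scope ring_scope.

Section Flags.
Variables (C : finType) (R : nmodType).

(** Double count of the pairs i in T, with D the set T minus i. *)
Lemma sum_flags (A : {set C}) (j : nat) (F : {set C} -> C -> R) :
  \sum_(D : {set C} | (D \subset A) && (#|D| == j)) \sum_(i in A :\: D) F (i |: D) i =
  \sum_(T : {set C} | (T \subset A) && (#|T| == j.+1)) \sum_(i in T) F T i.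
Proof.
rewrite (exchange_big_dep (mem A)) /=; last by move=> D i _; rewrite inE => /andP[].
rewrite [RHS](exchange_big_dep (mem A)) /=; last first.
  by move=> T i /andP[/subsetP sTA _] /sTA.
apply: eq_bigr => i iA.
rewrite [RHS](reindex_onto (fun D => i |: D) (fun T => T :\ i)) /=; last first.
  by move=> T /andP[_ iT]; rewrite setD1K.
apply: eq_bigl => D; rewrite !inE iA andbT eqxx /= andbT subUset sub1set iA /=.
case: (boolP (i \in D)) => iD /=.
  rewrite andbF; apply/esym/negbTE; apply/negP => /andP[_ /eqP e].
  by have := iD; rewrite -e !inE eqxx.
by rewrite cardsU1 iD /= add1n eqSS setU1K // eqxx !andbT.
Qed.

End Flags.

Section Esym.
Variable (C : finType).
Implicit Types (A : {set C}) (y : C -> rat).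
Definition elemsym j y A : rat :=
  \sum_(T : {set C} | (T \subset A) && (#|T| == j)) \prod_(i in T) y i.

Arguments elemsym j%_N y A.
Lemma elemsym0 y A : elemsym 0 y A = 1.
Proof.
rewrite /elemsym (big_pred1 set0) ?big_set0 // => T.
by rewrite cards_eq0 /= andbC; case: eqP => //= ->; rewrite sub0set.
Qed.

Lemma elemsym_ge0 j y A : (forall i, 0 <= y i) -> 0 <= elemsym j y A.
Proof. by move=> y0; apply: sumr_ge0 => T _; apply: prodr_ge0. Qed.

Lemma prod_setU1 y i (D : {set C}) : i \notin D ->
  \prod_(x in i |: D) y x = y i * \prod_(x in D) y x.
Proof. by move=> iD; rewrite big_setU1. Qed.

Lemma elemsym_up j y A :
  \sum_(D : {set C} | (D \subset A) && (#|D| == j)) (\prod_(i in D) y i) * \sum_(i in A :\: D) y i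
  = j.+1%:R * elemsym j.+1 y A.
Proof.
have := sum_flags A j (fun T i => \prod_(x in T) y x) => e.
transitivity (\sum_(D : {set C} | (D \subset A) && (#|D| == j)) \sum_(i in A :\: D) \prod_(x in i |: D) y x).
  apply: eq_bigr => D _; rewrite mulr_sumr; apply: eq_bigr => i.
  by rewrite inE => /andP[iD _]; rewrite prod_setU1 // mulrC.
rewrite e /elemsym mulr_sumr; apply: eq_bigr => T /andP[_ /eqP cT].
by rewrite sumr_const cT mulr_natl.
Qed.

Lemma elemsym1 y A : elemsym 1 y A = \sum_(i in A) y i.
Proof.
have := elemsym_up 0 y A; rewrite mul1r => <-.
rewrite (big_pred1 set0) => [|T]; first by rewrite big_set0 mul1r setD0.
by rewrite cards_eq0 /= andbC; case: eqP => //= ->; rewrite sub0set.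
Qed.

(** The defect is half the sum of the squares of the differences. *)
Lemma sum_sq y A :
  (\sum_(i in A) y i) ^+ 2 <= #|A|%:R * \sum_(i in A) y i ^+ 2.
Proof.
have h : 0 <= \sum_(i in A) \sum_(j in A) (y i - y j) ^+ 2.
  by apply: sumr_ge0 => i _; apply: sumr_ge0 => j _; rewrite sqr_ge0.
suff e : \sum_(i in A) \sum_(j in A) (y i - y j) ^+ 2 =
   2%:R * (#|A|%:R * \sum_(i in A) y i ^+ 2) - 2%:R * (\sum_(i in A) y i) ^+ 2 by lra.
transitivity (\sum_(i in A) (#|A|%:R * y i ^+ 2 - 2%:R * y i * \sum_(j in A) y j + \sum_(j in A) y j ^+ 2)).
  apply: eq_bigr => i _.
  rewrite (eq_bigr (fun j => y i ^+ 2 - 2%:R * y i * y j + y j ^+ 2)); last by move=> j _; ring.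
  by rewrite !big_split /= sumrN sumr_const -mulr_sumr -[_ *+ #|A|]mulr_natl.
rewrite !big_split /= sumrN sumr_const -mulr_suml -!mulr_sumr -[X in _ + X]mulr_natl; ring.
Qed.

(** The normalised elementary symmetric polynomials e_j / binom(k, j) decrease relative to the
    powers of the mean.  In the expansion of e_1 e_j, the terms with a repeated variable are a
    sum, over sets D of size j-1, of squares of the variables outside D; the Cauchy-Schwarz
    inequality bounds it from below by the squared sum. *)
Lemma elemsym_chain j y A : (forall i, 0 <= y i) -> (j < #|A|)%N ->
  j.+1%:R * #|A|%:R * elemsym j.+1 y A <= (#|A| - j)%:R * elemsym 1 y A * elemsym j y A.
Proof.
move=> y0 jA; set k := #|A|.
case: j jA => [|j] jA; first by rewrite elemsym0 subn0; lra.
have split1 : elemsym 1 y A * elemsym j.+1 y A = j.+2%:R * elemsym j.+2 y A +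
   \sum_(T : {set C} | (T \subset A) && (#|T| == j.+1)) \sum_(i in T) y i * \prod_(x in T) y x.
  rewrite -elemsym_up -big_split /= {2}/elemsym mulr_sumr; apply: eq_bigr => T /andP[sT _].
  rewrite elemsym1 (big_setID T) /= (setIidPr sT) mulrDl addrC -mulr_suml; congr (_ + _).
  by rewrite mulrC.
have := sum_flags A j (fun T i => y i * \prod_(x in T) y x) => e1.
have := sum_flags A j (fun T i => (\prod_(x in T) y x) * \sum_(z in A :\: T) y z) => e2.
have e2' : \sum_(T : {set C} | (T \subset A) && (#|T| == j.+1))
   \sum_(i in T) (\prod_(x in T) y x * \sum_(z in A :\: T) y z) = j.+1%:R * (j.+2%:R * elemsym j.+2 y A).
  rewrite -elemsym_up mulr_sumr; apply: eq_bigr => T /andP[_ /eqP cT].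
  by rewrite sumr_const cT mulr_natl.
have le : \sum_(T : {set C} | (T \subset A) && (#|T| == j.+1))
   \sum_(i in T) (\prod_(x in T) y x * \sum_(z in A :\: T) y z) <= (k - j.+1)%:R *
   \sum_(T : {set C} | (T \subset A) && (#|T| == j.+1)) \sum_(i in T) y i * \prod_(x in T) y x.
  rewrite -e1 -e2 mulr_sumr; apply: ler_sum => D /andP[sD /eqP cD].
  have cAD : #|A :\: D| = (k - j)%N by rewrite cardsD (setIidPr sD) cD.
  have pD : 0 <= \prod_(x in D) y x by apply: prodr_ge0.
  rewrite (eq_bigr (fun i => (\prod_(x in D) y x) * (y i * \sum_(z in A :\: D) y z - y i ^+ 2))); last first.
    move=> i iAD; have := iAD; rewrite inE => /andP[iD iA]; rewrite prod_setU1 //.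
    have -> : A :\: (i |: D) = (A :\: D) :\ i by apply/setP => x; rewrite !inE negb_or andbA.
    rewrite (big_setD1 i iAD) /=. ring.
  rewrite -mulr_sumr [X in _ <= _ * X](eq_bigr (fun i => (\prod_(x in D) y x) * y i ^+ 2)); last first.
    by move=> i; rewrite inE => /andP[iD iA]; rewrite prod_setU1 //; ring.
  rewrite -mulr_sumr mulrCA; apply: ler_wpM2l => //.
  rewrite sumrB -mulr_suml -expr2.
  have := sum_sq y (A :\: D); rewrite cAD.
  have -> : (k - j)%:R = (k - j.+1)%:R + 1 :> rat by rewrite natr1; congr (_%:R); rewrite /k; lia.
  lra.
rewrite e2' in le.
rewrite -mulrA -mulrA split1 mulrDr.
set X := \sum_(T | _) _ in le *.
have -> : k%:R = (k - j.+1)%:R + j.+1%:R :> rat by rewrite -natrD; congr (_%:R); rewrite /k; lia.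
set a := (k - j.+1)%:R in le *; set E := elemsym j.+2 y A in le *.
lra.
Qed.

(** Interpolates between the trivial case j = 0 and Maclaurin's inequality i = 0; the case i = 2
    is what shows that nearly extremal weights are nearly uniform. *)
Lemma elemsym_le i j y A : (forall i, 0 <= y i) -> (i + j <= #|A|)%N ->
  elemsym (i + j) y A * ('C(#|A|, i)%:R * #|A|%:R ^+ j) <=
  'C(#|A|, i + j)%:R * (elemsym 1 y A) ^+ j * elemsym i y A.
Proof.
move=> y0; elim: j => [|j IH] h; first by rewrite addn0 !expr0 !mulr1 mulrC.
set k := #|A| in h IH *.
have := IH (ltac:(lia)) => {}IH.
have := @elemsym_chain (i + j) y A y0 (ltac:(lia)); rewrite -/k => ch.
rewrite addnS; set E := elemsym (i + j).+1 y A in ch *; set E' := elemsym (i + j) y A in ch IH.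
have s0 : 0 <= elemsym 1 y A by apply: elemsym_ge0.
have bn : (i + j).+1%:R * 'C(k, (i + j).+1)%:R = (k - (i + j))%:R * 'C(k, i + j)%:R :> rat.
  by rewrite -!natrM mul_bin_left.
have p : 0 < (i + j).+1%:R :> rat by rewrite ltr0n.
rewrite -(ler_pM2l p).
set a := (i + j).+1%:R in ch bn p *; set b := (k - (i + j))%:R in ch bn; set K := k%:R in ch IH *.
have -> : a * ('C(k, (i + j).+1)%:R * elemsym 1 y A ^+ j.+1 * elemsym i y A) =
   (b * elemsym 1 y A) * ('C(k, i + j)%:R * elemsym 1 y A ^+ j * elemsym i y A).
   by rewrite exprS !mulrA bn; ring.
apply: le_trans (_ : (b * elemsym 1 y A) * (E' * ('C(k, i)%:R * K ^+ j)) <= _).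
  2: apply: ler_wpM2l => //; apply: mulr_ge0 => //; exact: ler0n.
have -> : a * (E * ('C(k, i)%:R * K ^+ j.+1)) = (a * K * E) * ('C(k, i)%:R * K ^+ j) by rewrite exprS; ring.
rewrite [X in _ <= X]mulrA; apply: ler_wpM2r => //; apply: mulr_ge0; rewrite ?exprn_ge0 ?ler0n //.
Qed.

Lemma elemsym_gt j y A : (#|A| < j)%N -> elemsym j y A = 0.
Proof.
move=> h; rewrite /elemsym big_pred0 // => T; apply/negbTE/negP => /andP[/subset_leq_card h1 /eqP h2].
by move: h1; rewrite h2 leqNgt h.
Qed.

Lemma maclaurin j y A : (forall i, 0 <= y i) ->
  elemsym j y A * #|A|%:R ^+ j <= 'C(#|A|, j)%:R * (elemsym 1 y A) ^+ j.
Proof.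
move=> y0; case: (leqP j #|A|) => h.
  by have := @elemsym_le 0 j y A y0 h; rewrite add0n bin0 mul1r elemsym0 mulr1.
rewrite elemsym_gt // mul0r mulr_ge0 ?ler0n // exprn_ge0 //; exact: elemsym_ge0.
Qed.

Lemma elemsym_setD1 j y A i : i \in A ->
  elemsym j.+1 y A = elemsym j.+1 y (A :\ i) + y i * elemsym j y (A :\ i).
Proof.
move=> iA; rewrite /elemsym (bigID (fun T : {set C} => i \in T)) /= addrC; congr (_ + _).
  apply: eq_bigl => T; rewrite subsetD1. by case: (i \in T); rewrite ?andbF ?andbT.
rewrite (reindex_onto (fun D => i |: D) (fun T => T :\ i)) /=; last first.
  by move=> T /andP[_ iT]; rewrite setD1K.
rewrite mulr_sumr; apply: eq_big => [D|D].
  rewrite !inE eqxx /= andbT subUset sub1set iA /= subsetD1.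
  case: (boolP (i \in D)) => iD /=.
    rewrite andbF; apply/negbTE; apply/negP => /andP[_ /eqP e].
    by have := iD; rewrite -e !inE eqxx.
  by rewrite cardsU1 iD /= add1n eqSS setU1K // eqxx !andbT.
move=> /andP[/andP[_ _] /eqP e]; rewrite prod_setU1 //.
by apply/negP => h; have := h; rewrite -e !inE eqxx.
Qed.

Lemma elemsym2 y A : 2%:R * elemsym 2 y A = (elemsym 1 y A) ^+ 2 - \sum_(i in A) y i ^+ 2.
Proof.
have := elemsym_up 1 y A => <-.
have := sum_flags A 0 (fun T i => (\prod_(z in T) y z) * \sum_(z in A :\: T) y z) => e.
transitivity (\sum_(T : {set C} | (T \subset A) && (#|T| == 1)) \sum_(i in T) ((\prod_(z in T) y z) * \sum_(z in A :\: T) y z)).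
  by apply: eq_bigr => T /andP[_ /eqP c]; rewrite sumr_const c mulr1n.
rewrite -e (big_pred1 set0) => [|T]; last first.
  by rewrite cards_eq0 /= andbC; case: eqP => //= ->; rewrite sub0set.
rewrite setD0 elemsym1 expr2 mulr_suml -sumrB; apply: eq_bigr => i iA.
rewrite setU0 big_set1 (big_setD1 i iA) /=. ring.
Qed.

End Esym.

(** * Packings and the sets of size r-1 that they leave uncovered *)

Local Close Scope ring_scope.

Section Packings.
Variable C : finType.
Implicit Types (A D J e f : {set C}) (P : {set {set C}}).

Definition packing r P :=
  (forall e, e \in P -> #|e| = r) /\
  (forall e f, e \in P -> f \in P -> e != f -> #|e :&: f| + 2 <= r).

(** Double count of the pairs consisting of a member of P and one of its subsets of size j. *)
Lemma count_subsets j b r P A :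
  (forall e, e \in P -> #|e| = r) -> (forall e, e \in P -> e \subset A) ->
  (forall J : {set C}, J \subset A -> #|J| = j -> #|[set e in P | J \subset e]| <= b) ->
  #|P| * 'C(r, j) <= 'C(#|A|, j) * b.
Proof.
move=> ur sA h.
have <- : \sum_(J : {set C} | (J \subset A) && (#|J| == j)) #|[set e in P | J \subset e]| = #|P| * 'C(r, j).
  under eq_bigr do rewrite -sum1_card.
  rewrite (exchange_big_dep (mem P)) /=; last by move=> J e _; rewrite inE => /andP[].
  rewrite -sum_nat_const; apply: eq_bigr => e eP.
  rewrite -(ur e eP) -cards_draws -sum1_card.
  apply: eq_bigl => J; rewrite !inE eP /= andbC andbA; congr (_ && _).
  by case: (boolP (J \subset e)) => // sJ; rewrite (subset_trans sJ (sA e eP)).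
rewrite -cards_draws -sum_nat_const [X in _ <= X]big_mkcond [X in X <= _]big_mkcond /=.
apply: leq_sum => J _; rewrite inE; case: ifP => // /andP[sJ /eqP cJ]; exact: h.
Qed.

Definition residual P (J : {set C}) := [set e :\: J | e in [set e in P | J \subset e]].

Lemma card_residual P J : #|residual P J| = #|[set e in P | J \subset e]|.
Proof.
rewrite card_in_imset // => e f; rewrite !inE => /andP[_ sJe] /andP[_ sJf] ef.
by rewrite -(setID e J) -(setID f J) ef (setIidPr sJe) (setIidPr sJf).
Qed.

(** The members through a fixed set J form a packing of smaller rank: the inductive step of the
    Johnson bound. *)
Lemma residual_packing r P J : packing r P -> #|J| + 2 <= r -> packing (r - #|J|) (residual P J).
Proof.
move=> [ur pw] hJ; split.
  move=> e /imsetP[f]; rewrite inE => /andP[fP sJ] ->.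
  by rewrite cardsD (setIidPr sJ) ur.
move=> e f /imsetP[e' ]; rewrite inE => /andP[eP sJe] -> /imsetP[f']; rewrite inE => /andP[fP sJf] -> ne.
have nef : e' != f' by apply: contraNneq ne => ->.
have := pw _ _ eP fP nef.
have -> : (e' :\: J) :&: (f' :\: J) = (e' :&: f') :\: J by rewrite setDIl.
rewrite cardsD; have -> : e' :&: f' :&: J = J by apply/setIidPr; rewrite subsetI sJe.
have : #|J| <= #|e' :&: f'| by apply: subset_leq_card; rewrite subsetI sJe.
lia.
Qed.

Lemma residual_sub P J A : (forall e, e \in P -> e \subset A) ->
  forall e, e \in residual P J -> e \subset A :\: J.
Proof. by move=> sA e /imsetP[f]; rewrite inE => /andP[fP _] ->; rewrite setSD // sA. Qed.

Lemma matching_bound P A : packing 2 P -> (forall e, e \in P -> e \subset A) ->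
  #|P| * 2 <= #|A|.
Proof.
move=> pP sA.
have := @count_subsets 1 1 2 P A pP.1 sA; rewrite !bin1 muln1; apply.
move=> J _ cJ; apply/card_le1P => e; rewrite inE => /andP[eP sJe] f; rewrite !inE.
apply/andP/eqP => [[fP sJf]|->] //.
apply/eqP; apply: contraT => ne; have := pP.2 _ _ fP eP ne.
have : #|J| <= #|f :&: e| by apply: subset_leq_card; rewrite subsetI sJe sJf.
by rewrite cJ; lia.
Qed.

(** The members through a set of r-2 points induce a matching on the remaining points. *)
Lemma johnson2 r P A : packing r P -> (2 <= r) -> (forall e, e \in P -> e \subset A) ->
  #|P| * 'C(r, r - 2) <= 'C(#|A|, r - 2) * ((#|A| + 2 - r)./2).
Proof.
move=> pP r2 sA; apply: count_subsets => //; first exact: pP.1.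
move=> J sJ cJ; rewrite -card_residual.
have := @residual_packing r P J pP; rewrite cJ => pr.
have {}pr : packing 2 (residual P J) by have := pr (ltac:(lia)); have -> : r - (r - 2) = 2 by lia.
have := matching_bound pr (residual_sub sA).
rewrite cardsD (setIidPr sJ) cJ => h; rewrite geq_half_double -muln2; apply: leq_trans h _; lia.
Qed.

(** Complementation preserves the distances between members, and trades r for a smaller rank when
    r is more than half the number of points. *)
Lemma complement_packing r P : packing r P -> (r + 2 <= #|C| + 2)%N ->
  packing (#|C| - r) [set ~: e | e in P].
Proof.
move=> [ur pw] h; split.
  by move=> e /imsetP[f fP ->]; rewrite -(ur f fP) -(cardsC f); lia.
move=> e f /imsetP[e' eP ->] /imsetP[f' fP ->] ne.
have nef : e' != f' by apply: contraNneq ne => ->.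
have := pw _ _ eP fP nef; rewrite -setCU.
have := cardsC (e' :|: f'); have := cardsUI e' f'; rewrite (ur e') // (ur f') //.
have := max_card (e' :|: f'). lia.
Qed.

Lemma card_complement P : #|[set ~: e | e in P]| = #|P|.
Proof. by rewrite card_imset //; exact: setC_inj. Qed.

End Packings.

Local Open Scope ring_scope.
Section Uncovered.
Variable C : finType.
Implicit Types (y : C -> rat) (P : {set {set C}}).

Definition uncovered r P : {set {set C}} :=
  [set D : {set C} | (#|D| == r.-1) && [forall i, (i \notin D) ==> (i |: D \notin P)]].

(** The value at y of the partial derivative in direction i of the polynomial sum_(e in P) prod_(j
    in e) y j; it is the normalised degree of a vertex of part i in a blow-up of P whose parts
    have relative sizes y. *)
Definition partial_at y P i : rat := \sum_(e in P | i \in e) \prod_(j in e :\ i) y j.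

(** A term of the left-hand side is a set of size r-1 contained in a member of P, and it is
    contained in only one. *)
Lemma sum_partial_at r y P : (0 < r)%N -> packing r P ->
  \sum_i partial_at y P i = elemsym r.-1 y setT - \sum_(D in uncovered r P) \prod_(j in D) y j.
Proof.
move=> r0 [ur pw].
have e1 : \sum_i partial_at y P i = \sum_(T : {set C} | (T \subset setT) && (#|T| == r.-1.+1)) \sum_(i in T)
    (if T \in P then \prod_(j in T :\ i) y j else 0).
  rewrite /partial_at (exchange_big_dep (mem P)) /=; last by move=> i e _ /andP[].
  rewrite [RHS](bigID (mem P)) /= [X in _ = _ + X]big1 ?addr0; last first.
    by move=> T /andP[_ /negbTE ->]; rewrite big1.
  rewrite prednK //; apply: eq_big => e; first by rewrite subsetT /=; case: (boolP (e \in P)) => [/ur ->|]; rewrite ?eqxx ?andbF.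
  by move=> eP; rewrite eP; apply: eq_bigl => i.
rewrite e1 -(sum_flags setT r.-1 (fun T i => if T \in P then \prod_(j in T :\ i) y j else 0)).
rewrite /elemsym [X in _ = X - _](bigID (fun D => D \in uncovered r P)) /= addrC.
have -> : \sum_(D : {set C} | (D \subset setT) && (#|D| == r.-1) && (D \in uncovered r P)) \prod_(i in D) y i =
   \sum_(D in uncovered r P) \prod_(j in D) y j.
  by apply: eq_bigl => D; rewrite subsetT inE /=; case: (#|D| == _).
rewrite addrK [LHS](bigID (fun D => D \in uncovered r P)) /=.
rewrite big1 ?add0r; last first.
  move=> D /andP[_]; rewrite inE => /andP[_ /forallP h]; apply: big1 => i; rewrite !inE andbT => iD.
  by have := h i; rewrite iD /= => /negbTE ->.
apply: eq_bigr => D /andP[/andP[_ cD]]; rewrite inE cD /= negb_forall => /existsP[i].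
rewrite negb_imply negbK => /andP[iD iP].
rewrite (bigD1 i) /=; last by rewrite !inE iD.
rewrite iP setU1K // [X in _ + X]big1 ?addr0 // => j /andP[]; rewrite !inE andbT => jD ji.
case: ifP => // jP; have ne : j |: D != i |: D.
  apply/negP => /eqP e; have := setU11 j D; rewrite e !inE (negbTE jD) orbF => /eqP h.
  by rewrite h eqxx in ji.
have := pw _ _ jP iP ne; have : (#|D| <= #|(j |: D) :&: (i |: D)|)%N by apply: subset_leq_card; rewrite subsetI !subsetUr.
by rewrite (eqP cD); lia.
Qed.

Lemma card_uncovered r P : (0 < r)%N -> packing r P ->
  (#|uncovered r P| + r * #|P|)%N = 'C(#|C|, r.-1).
Proof.
move=> r0 pP; have := @sum_partial_at r (fun=> 1) P r0 pP.
have -> : \sum_i partial_at (fun=> 1) P i = (r * #|P|)%:R.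
  rewrite /partial_at (exchange_big_dep (mem P)) /=; last by move=> i e _ /andP[].
  rewrite (eq_bigr (fun=> r%:R)); first by rewrite sumr_const -mulrnA.
  move=> e eP; rewrite (eq_bigr (fun=> 1)); last by move=> i _; rewrite big1.
  rewrite -(pP.1 e eP) sumr_const; congr (_%:R); by apply: eq_card => i; rewrite unfold_in eP.
rewrite (eq_bigr (fun=> 1)); last by move=> D _; rewrite big1.
rewrite sumr_const /elemsym (eq_bigr (fun=> 1)); last by move=> D _; rewrite big1.
rewrite sumr_const.
have -> : #|[pred D : {set C} | (D \subset [set: C]) && (#|D| == r.-1)]| = 'C(#|C|, r.-1).
  rewrite -cardsT -cards_draws; apply: eq_card => D; by rewrite !inE.
move/eqP; rewrite eq_sym subr_eq -natrD eqr_nat => /eqP ->; lia.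
Qed.

End Uncovered.

(** * Degrees in a weighted packing *)

Lemma rat_nat_frac (t : rat) : 0 <= t -> exists p q : nat, (0 < q)%N /\ t = p%:R / q%:R.
Proof.
move=> t0; exists `|numq t|%N, `|denq t|%N; rewrite absz_gt0 denq_neq0; split => //.
rewrite -{1}(divq_num_den t); congr (_ / _); rewrite natr_absz ger0_norm //.
by rewrite numq_ge0.
Qed.

Section Weights.
Variables (C : finType) (y : C -> rat) (P : {set {set C}}) (s : nat).
Hypothesis (y0 : forall i, 0 <= y i) (y1 : \sum_i y i = 1) (pP : packing s.+2 P).
Variable (t0 : rat).
Hypothesis degs : forall i, t0 <= partial_at y P i.

Lemma card_gt0_weights : (0 < #|C|)%N.
Proof.
rewrite lt0n; apply: contra_eq_neq y1 => /card0_eq c0.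
by rewrite big_pred0 // eq_sym oner_neq0.
Qed.

Lemma elemsym1T : elemsym 1 y setT = 1.
Proof. by rewrite elemsym1 -[RHS]y1; apply: eq_bigl => i; rewrite inE. Qed.

Lemma sum_degs : #|C|%:R * t0 <= elemsym s.+1 y setT - \sum_(D in uncovered s.+2 P) \prod_(j in D) y j.
Proof.
rewrite -(@sum_partial_at _ s.+2) // mulr_natl -sumr_const; apply: ler_sum => i _; exact: degs.
Qed.

Lemma sum_degs_le : #|C|%:R * t0 <= elemsym s.+1 y setT.
Proof.
have := sum_degs; have : 0 <= \sum_(D in uncovered s.+2 P) \prod_(j in D) y j.
  by apply: sumr_ge0 => D _; apply: prodr_ge0.
lra.
Qed.

Lemma degs_maclaurin : #|C|%:R ^+ s.+2 * t0 <= 'C(#|C|, s.+1)%:R.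
Proof.
have := @maclaurin _ s.+1 y setT y0; rewrite elemsym1T expr1n mulr1 cardsT.
apply: le_trans; rewrite exprSr -mulrA mulrC; apply: ler_wpM2r; last exact: sum_degs_le.
by rewrite exprn_ge0 // ler0n.
Qed.

(** A sharper bound than Maclaurin's inequality on all points.  Let t be the smallest weight:
    applied to the other k points only, the inequality gains when t is small, and when t is large
    the U uncovered sets contribute at least U t^(s+1).  The premise is the resulting polynomial
    inequality, cleared of denominators by writing t = p / (p + d). *)
Lemma degs_min_weight a1 a2 k U m : #|C| = k.+1 -> (0 < k)%N -> (U <= #|uncovered s.+2 P|)%N ->
  (forall p d : nat, k * p <= d ->
     a1 * m ^ s.+2 * ('C(k, s.+1) * d ^ s.+1 + k * 'C(k, s) * p * d ^ s) <=
     a2 * k ^ s.+1 * k.+1 * 'C(m, s.+1) * (p + d) ^ s.+1 + a1 * m ^ s.+2 * (U * k ^ s.+1 * p ^ s.+1))%N ->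
  a1%:R * m%:R ^+ s.+2 * t0 <= a2%:R * 'C(m, s.+1)%:R.
Proof.
move=> ck k0 hU H.
have /card_gt0P [i1 _] := card_gt0_weights.
pose i0 := [arg min_(i < i1) y i]%O.
have ymin i : y i0 <= y i by rewrite /i0; case: arg_minP => // j _ h; exact: h.
set t := y i0 in ymin.
have t0' : 0 <= t by exact: y0.
have kt : k.+1%:R * t <= 1.
  by rewrite -ck mulr_natl -y1 -sumr_const; apply: ler_sum.
have [p [q [q0 et]]] := rat_nat_frac t0'.
have q0' : 0 < q%:R :> rat by rewrite ltr0n.
have pq : (k.+1 * p <= q)%N.
  by move: kt; rewrite et mulrA ler_pdivrMr // mul1r -natrM ler_nat.
pose d := (q - p)%N.
have eqd : q = (p + d)%N by rewrite /d subnKC // (leq_trans _ pq) // mulSn leq_addr.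
have kd : (k * p <= d)%N by move: pq; rewrite eqd mulSn leq_add2l.
have e1t : 1 - t = d%:R / q%:R.
  have h : p%:R + d%:R != 0 :> rat by rewrite -natrD -eqd gt_eqF.
  by rewrite et eqd natrD; field.
have := H p d kd; rewrite -(ler_nat rat) !(natrD, natrM, natrX) -natrD -eqd => {}H.
set L := a1%:R in H *; set M := m%:R ^+ s.+2 in H *; set T := a2%:R in H *.
set A := [set~ i0].
have cA : #|A| = k by have := cardsC1 i0; rewrite ck.
have eA : [set~ i0] = setT :\ i0 by rewrite setTD.
have s1A : elemsym 1 y A = 1 - t.
  rewrite elemsym1 /A -y1 [in RHS](bigD1 i0) //= -/t addrAC subrr add0r.
  by apply: eq_bigl => i; rewrite !inE.
have b1 := @maclaurin _ s.+1 y A y0; rewrite s1A cA in b1.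
have b2 := @maclaurin _ s y A y0; rewrite s1A cA in b2.
have b3 : U%:R * t ^+ s.+1 <= \sum_(D in uncovered s.+2 P) \prod_(j in D) y j.
  apply: (@le_trans _ _ (\sum_(D in uncovered s.+2 P) t ^+ s.+1)).
    by rewrite sumr_const -[X in _ <= X]mulr_natl ler_wpM2r ?exprn_ge0 // ler_nat.
  apply: ler_sum => D; rewrite inE => /andP[/eqP cD _].
  rewrite -[s.+1]/(s.+2.-1) -cD -prodr_const; apply: ler_prod => j _; by rewrite t0' ymin.
have main := sum_degs; rewrite ck (@elemsym_setD1 _ s y setT i0) ?inE // -eA -/A -/t in main.
set K := k%:R in b1 b2 H *.
have K0 : 0 < K by rewrite ltr0n.
set X := elemsym s.+1 y A in b1 main; set Y := elemsym s y A in b2 main.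
set Z := \sum_(D in _) _ in b3 main.
have main2 : K ^+ s.+1 * (k.+1%:R * t0) <= 'C(k, s.+1)%:R * (1 - t) ^+ s.+1 + K * 'C(k, s)%:R * t * (1 - t) ^+ s - U%:R * K ^+ s.+1 * t ^+ s.+1.
  apply: (@le_trans _ _ (K ^+ s.+1 * (X + t * Y - Z))).
    by apply: ler_wpM2l => //; rewrite exprn_ge0 // ltW.
  have : K ^+ s.+1 * (U%:R * t ^+ s.+1) <= K ^+ s.+1 * Z by apply: ler_wpM2l => //; rewrite exprn_ge0 // ltW.
  have : K * t * (Y * K ^+ s) <= K * t * ('C(k, s)%:R * (1 - t) ^+ s) by apply: ler_wpM2l => //; rewrite mulr_ge0 // ltW.
  have -> : K * t * (Y * K ^+ s) = K ^+ s.+1 * (t * Y) by rewrite exprS; ring.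
  rewrite mulrBr mulrDr [K ^+ s.+1 * X]mulrC.
  set a := 'C(k, s.+1)%:R; set b := 'C(k, s)%:R.
  have -> : K * t * (b * (1 - t) ^+ s) = K * b * t * (1 - t) ^+ s by ring.
  have -> : K ^+ s.+1 * (U%:R * t ^+ s.+1) = U%:R * K ^+ s.+1 * t ^+ s.+1 by ring.
  lra.
have LM0 : 0 <= L * M by rewrite mulr_ge0 ?exprn_ge0 ?ler0n.
have qs0 : 0 < q%:R ^+ s.+1 :> rat by rewrite exprn_gt0.
have main3 : (L * M) * ('C(k, s.+1)%:R * (1 - t) ^+ s.+1 + K * 'C(k, s)%:R * t * (1 - t) ^+ s - U%:R * K ^+ s.+1 * t ^+ s.+1) <= T * K ^+ s.+1 * k.+1%:R * 'C(m, s.+1)%:R.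
  rewrite -(ler_pM2r qs0).
  have -> : (L * M) * ('C(k, s.+1)%:R * (1 - t) ^+ s.+1 + K * 'C(k, s)%:R * t * (1 - t) ^+ s - U%:R * K ^+ s.+1 * t ^+ s.+1) * q%:R ^+ s.+1 = L * M * ('C(k, s.+1)%:R * d%:R ^+ s.+1 + K * 'C(k, s)%:R * p%:R * d%:R ^+ s) - L * M * (U%:R * K ^+ s.+1 * p%:R ^+ s.+1).
    have e1 : p%:R = t * q%:R by rewrite et divfK // gt_eqF.
    have e2 : d%:R = (1 - t) * q%:R by rewrite e1t divfK // gt_eqF.
    by rewrite e1 e2 !exprMn !exprS; ring.
  set lhs := L * M * _ in H *; lra.
have pos : 0 < K ^+ s.+1 * k.+1%:R by rewrite mulr_gt0 ?exprn_gt0 ?ltr0n.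
rewrite -(ler_pM2l pos).
have : L * M * (K ^+ s.+1 * (k.+1%:R * t0)) <= T * K ^+ s.+1 * k.+1%:R * 'C(m, s.+1)%:R.
  by apply: le_trans main3; apply: ler_wpM2l.
set a := 'C(m, s.+1)%:R; set b := k.+1%:R; set c := K ^+ s.+1.
have -> : L * M * (c * (b * t0)) = c * b * (L * M * t0) by ring.
by have -> : T * c * b * a = c * b * (T * a) by ring.
Qed.

End Weights.

(** * The integer inequalities over the natural numbers *)

Local Close Scope ring_scope.

(** On many points Maclaurin's inequality alone suffices, as binom(k, 4) / k^5 decreases. *)
Lemma large_size_5 k : 12 <= k -> 1000 * 11 ^ 5 * 'C(k, 4) <= 999 * k ^ 5 * 'C(11, 4).
Proof.
move=> h; have -> : 'C(11, 4) = 330 by [].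
have := bin_ffact k 4; have -> : 4`! = 24 by [].
have -> : k ^_ 4 = k * (k - 1) * (k - 2) * (k - 3) by rewrite !ffactnS ffactn0 muln1 !mulnA -!subn1 -!subnDA.
move=> e; have := @size_bound_12 (Z.of_nat (k - 12)) ltac:(lia).
have -> : Z.add 12 (Z.of_nat (k - 12)) = Z.of_nat k by lia.
have -> : Z.add 11 (Z.of_nat (k - 12)) = Z.of_nat (k - 1) by lia.
have -> : Z.add 10 (Z.of_nat (k - 12)) = Z.of_nat (k - 2) by lia.
have -> : Z.add 9 (Z.of_nat (k - 12)) = Z.of_nat (k - 3) by lia.
have {e} : Z.mul (Z.of_nat 'C(k, 4)) 24 = Z.mul (Z.mul (Z.mul (Z.of_nat k) (Z.of_nat (k - 1))) (Z.of_nat (k - 2))) (Z.of_nat (k - 3)).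
  by rewrite -!Nat2Z.inj_mul multE -e; lia.
move=> <-; lia.
Qed.

Lemma large_size_6 k : 15 <= k -> 1000 * 12 ^ 6 * 'C(k, 5) <= 999 * k ^ 6 * 'C(12, 5).
Proof.
move=> h; have -> : 'C(12, 5) = 792 by [].
have := bin_ffact k 5; have -> : 5`! = 120 by [].
have -> : k ^_ 5 = k * (k - 1) * (k - 2) * (k - 3) * (k - 4) by rewrite !ffactnS ffactn0 muln1 !mulnA -!subn1 -!subnDA.
move=> e; have := @size_bound_15 (Z.of_nat (k - 15)) ltac:(lia).
have -> : Z.add 15 (Z.of_nat (k - 15)) = Z.of_nat k by lia.
have -> : Z.add 14 (Z.of_nat (k - 15)) = Z.of_nat (k - 1) by lia.
have -> : Z.add 13 (Z.of_nat (k - 15)) = Z.of_nat (k - 2) by lia.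
have -> : Z.add 12 (Z.of_nat (k - 15)) = Z.of_nat (k - 3) by lia.
have -> : Z.add 11 (Z.of_nat (k - 15)) = Z.of_nat (k - 4) by lia.
have {e} : Z.mul (Z.of_nat 'C(k, 5)) 120 = Z.mul (Z.mul (Z.mul (Z.mul (Z.of_nat k) (Z.of_nat (k - 1))) (Z.of_nat (k - 2))) (Z.of_nat (k - 3))) (Z.of_nat (k - 4)).
  by rewrite -!Nat2Z.inj_mul multE -e; lia.
move=> <-; lia.
Qed.

Lemma nat_weight_bound_7 (p d : nat) : 6 * p <= d -> 1000 * 11 ^ 5 * ('C(6, 4) * d ^ 4 + 6 * 'C(6, 3) * p * d ^ 3) <=
  999 * 6 ^ 4 * 7 * 'C(11, 4) * (p + d) ^ 4 + 1000 * 11 ^ 5 * (20 * 6 ^ 4 * p ^ 4).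
Proof.
move=> h; have -> : 'C(6, 4) = 15 by []. have -> : 'C(6, 3) = 20 by []. have -> : 'C(11, 4) = 330 by [].
have := @weight_bound_7 (Z.of_nat p) (Z.of_nat (p + d)).
have -> : Z.sub (Z.of_nat (p + d)) (Z.of_nat p) = Z.of_nat d by lia.
by move=> /(_ ltac:(lia) ltac:(lia)); lia.
Qed.

Lemma nat_weight_bound_8 (p d : nat) : 7 * p <= d -> 1000 * 11 ^ 5 * ('C(7, 4) * d ^ 4 + 7 * 'C(7, 3) * p * d ^ 3) <=
  999 * 7 ^ 4 * 8 * 'C(11, 4) * (p + d) ^ 4 + 1000 * 11 ^ 5 * (15 * 7 ^ 4 * p ^ 4).
Proof.
move=> h; have -> : 'C(7, 4) = 35 by []. have -> : 'C(7, 3) = 35 by []. have -> : 'C(11, 4) = 330 by [].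
have := @weight_bound_8 (Z.of_nat p) (Z.of_nat (p + d)).
have -> : Z.sub (Z.of_nat (p + d)) (Z.of_nat p) = Z.of_nat d by lia.
by move=> /(_ ltac:(lia) ltac:(lia)); lia.
Qed.

Lemma nat_weight_bound_9 (p d : nat) : 8 * p <= d -> 1000 * 11 ^ 5 * ('C(8, 4) * d ^ 4 + 8 * 'C(8, 3) * p * d ^ 3) <=
  999 * 8 ^ 4 * 9 * 'C(11, 4) * (p + d) ^ 4 + 1000 * 11 ^ 5 * (36 * 8 ^ 4 * p ^ 4).
Proof.
move=> h; have -> : 'C(8, 4) = 70 by []. have -> : 'C(8, 3) = 56 by []. have -> : 'C(11, 4) = 330 by [].
have := @weight_bound_9 (Z.of_nat p) (Z.of_nat (p + d)).
have -> : Z.sub (Z.of_nat (p + d)) (Z.of_nat p) = Z.of_nat d by lia.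
by move=> /(_ ltac:(lia) ltac:(lia)); lia.
Qed.

Lemma nat_weight_bound_10 (p d : nat) : 9 * p <= d -> 1000 * 11 ^ 5 * ('C(9, 4) * d ^ 4 + 9 * 'C(9, 3) * p * d ^ 3) <=
  999 * 9 ^ 4 * 10 * 'C(11, 4) * (p + d) ^ 4 + 1000 * 11 ^ 5 * (30 * 9 ^ 4 * p ^ 4).
Proof.
move=> h; have -> : 'C(9, 4) = 126 by []. have -> : 'C(9, 3) = 84 by []. have -> : 'C(11, 4) = 330 by [].
have := @weight_bound_10 (Z.of_nat p) (Z.of_nat (p + d)).
have -> : Z.sub (Z.of_nat (p + d)) (Z.of_nat p) = Z.of_nat d by lia.
by move=> /(_ ltac:(lia) ltac:(lia)); lia.
Qed.

Lemma nat_weight_bound_13 (p d : nat) : 12 * p <= d -> 1000 * 12 ^ 6 * ('C(12, 5) * d ^ 5 + 12 * 'C(12, 4) * p * d ^ 4) <=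
  999 * 12 ^ 5 * 13 * 'C(12, 5) * (p + d) ^ 5 + 1000 * 12 ^ 6 * (147 * 12 ^ 5 * p ^ 5).
Proof.
move=> h; have -> : 'C(12, 5) = 792 by []. have -> : 'C(12, 4) = 495 by [].
have := @weight_bound_13 (Z.of_nat p) (Z.of_nat (p + d)).
have -> : Z.sub (Z.of_nat (p + d)) (Z.of_nat p) = Z.of_nat d by lia.
by move=> /(_ ltac:(lia) ltac:(lia)); lia.
Qed.

Lemma nat_weight_bound_14 (p d : nat) : 13 * p <= d -> 1000 * 12 ^ 6 * ('C(13, 5) * d ^ 5 + 13 * 'C(13, 4) * p * d ^ 4) <=
  999 * 13 ^ 5 * 14 * 'C(12, 5) * (p + d) ^ 5 + 1000 * 12 ^ 6 * (40 * 13 ^ 5 * p ^ 5).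
Proof.
move=> h; have -> : 'C(13, 5) = 1287 by []. have -> : 'C(13, 4) = 715 by []. have -> : 'C(12, 5) = 792 by [].
have := @weight_bound_14 (Z.of_nat p) (Z.of_nat (p + d)).
have -> : Z.sub (Z.of_nat (p + d)) (Z.of_nat p) = Z.of_nat d by lia.
by move=> /(_ ltac:(lia) ltac:(lia)); lia.
Qed.

(** * Packings on a wrong number of points have a vertex of small degree *)

Definition witt_pair (r m : nat) := (r = 5 /\ m = 11) \/ (r = 6 /\ m = 12).

Section Exceptional.
Variables (C : finType) (P : {set {set C}}).

(** Complements of 5-sets of 7 points form a packing of pairs, that is, a matching. *)
Lemma uncovered7 : #|C| = 7 -> packing 5 P -> 20 <= #|uncovered 5 P|.
Proof.
move=> cC pP; have := @card_uncovered C 5 P isT pP; rewrite cC -[5.-1]/4; have -> : 'C(7, 4) = 35 by [].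
have := @johnson2 C 2 [set ~: e | e in P] setT; rewrite card_complement cardsT cC.
have -> : 'C(2, 2 - 2) = 1 by []. have -> : 'C(7, 2 - 2) = 1 by []. have -> : (7 + 2 - 2)./2 = 3 by [].
have := complement_packing pP; rewrite cC => /(_ isT) q /(_ q isT (fun e _ => subsetT e)).
lia.
Qed.

Lemma uncovered8 : #|C| = 8 -> packing 5 P -> 15 <= #|uncovered 5 P|.
Proof.
move=> cC pP; have := @card_uncovered C 5 P isT pP; rewrite cC -[5.-1]/4; have -> : 'C(8, 4) = 70 by [].
have := @johnson2 C 5 P setT pP isT (fun e _ => subsetT e); rewrite cardsT cC.
have -> : 'C(5, 5 - 2) = 10 by []. have -> : 'C(8, 5 - 2) = 56 by []. have -> : (8 + 2 - 5)./2 = 2 by [].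
lia.
Qed.

Lemma uncovered9 : #|C| = 9 -> packing 5 P -> 36 <= #|uncovered 5 P|.
Proof.
move=> cC pP; have := @card_uncovered C 5 P isT pP; rewrite cC -[5.-1]/4; have -> : 'C(9, 4) = 126 by [].
have := @johnson2 C 4 [set ~: e | e in P] setT; rewrite card_complement cardsT cC.
have -> : 'C(4, 4 - 2) = 6 by []. have -> : 'C(9, 4 - 2) = 36 by []. have -> : (9 + 2 - 4)./2 = 3 by [].
have := complement_packing pP; rewrite cC => /(_ isT) q /(_ q isT (fun e _ => subsetT e)).
lia.
Qed.

Lemma uncovered10 : #|C| = 10 -> packing 5 P -> 30 <= #|uncovered 5 P|.
Proof.
move=> cC pP; have := @card_uncovered C 5 P isT pP; rewrite cC -[5.-1]/4; have -> : 'C(10, 4) = 210 by [].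
have := @johnson2 C 5 P setT pP isT (fun e _ => subsetT e); rewrite cardsT cC.
have -> : 'C(5, 5 - 2) = 10 by []. have -> : 'C(10, 5 - 2) = 120 by []. have -> : (10 + 2 - 5)./2 = 3 by [].
lia.
Qed.

Lemma uncovered13 : #|C| = 13 -> packing 6 P -> 147 <= #|uncovered 6 P|.
Proof.
move=> cC pP; have := @card_uncovered C 6 P isT pP; rewrite cC -[6.-1]/5; have -> : 'C(13, 5) = 1287 by [].
have := @johnson2 C 6 P setT pP isT (fun e _ => subsetT e); rewrite cardsT cC.
have -> : 'C(6, 6 - 2) = 15 by []. have -> : 'C(13, 6 - 2) = 715 by []. have -> : (13 + 2 - 6)./2 = 4 by [].
lia.
Qed.

(** Through three given points there are at most 18 blocks: by the matching bound each further
    point is in at most 5 of them, and 18 is the integer part of 11 * 5 / 3. *)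
Lemma uncovered14 : #|C| = 14 -> packing 6 P -> 40 <= #|uncovered 6 P|.
Proof.
move=> cC pP; have := @card_uncovered C 6 P isT pP; rewrite cC -[6.-1]/5; have -> : 'C(14, 5) = 2002 by [].
have := @count_subsets C 3 18 6 P setT pP.1 (fun e _ => subsetT e); rewrite cardsT cC.
have -> : 'C(6, 3) = 20 by []. have -> : 'C(14, 3) = 364 by [].
move=> h; have {}h : #|P| * 20 <= 364 * 18.
  apply: h => J _ cJ; rewrite -card_residual.
  have := @residual_packing C 6 P J pP; rewrite cJ => /(_ isT) q.
  have := @johnson2 C _ (residual P J) (setT :\: J) q isT (residual_sub (fun e _ => subsetT e)).
  rewrite cardsD (setIidPr (subsetT J)) cardsT cC cJ.
  have -> : 'C(6 - 3, 6 - 3 - 2) = 3 by []. have -> : 'C(14 - 3, 6 - 3 - 2) = 11 by [].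
  have -> : (14 - 3 + 2 - (6 - 3))./2 = 5 by [].
  by move=> h; rewrite -ltnS -(@ltn_pmul2r 3) //; apply: leq_ltn_trans h _.
lia.
Qed.

End Exceptional.

Local Open Scope ring_scope.

(** Normalised vertex degree of the balanced blow-up of an (m, r, r-1) Steiner system. *)
Definition witt_degree (r m : nat) : rat := 'C(m, r.-1)%:R / m%:R ^+ r.

Section Excluded.
Variables (C : finType) (y : C -> rat) (P : {set {set C}}) (r m : nat).
Hypothesis (y0 : forall i, 0 <= y i) (y1 : \sum_i y i = 1) (pP : packing r P).
Variable (t0 : rat).
Hypothesis degs : forall i, t0 <= partial_at y P i.

Lemma small_degs_of_size a1 a2 s : (0 < #|C|)%N -> r = s.+2 ->
  (a1 * m ^ s.+2 * 'C(#|C|, s.+1) <= a2 * #|C| ^ s.+2 * 'C(m, s.+1))%N ->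
  a1%:R * m%:R ^+ s.+2 * t0 <= a2%:R * 'C(m, s.+1)%:R.
Proof.
move=> k0 er h; subst r.
have := degs_maclaurin y0 y1 pP degs.
move: h; rewrite -(ler_nat rat) !(natrM, natrX).
set k := #|C|%:R; set A := a1%:R; set B := a2%:R; set M := m%:R ^+ s.+2; set X := 'C(m, _)%:R; set Z := 'C(#|C|, _)%:R.
move=> h1 h2; have k0' : 0 < k ^+ s.+2 by rewrite exprn_gt0 // ltr0n.
rewrite -(ler_pM2l k0').
have -> : k ^+ s.+2 * (A * M * t0) = A * M * (k ^+ s.+2 * t0) by ring.
apply: le_trans (_ : A * M * Z <= _); last by apply: le_trans h1 _; rewrite le_eqVlt; apply/orP; left; apply/eqP; ring.
by apply: ler_wpM2l => //; rewrite mulr_ge0 ?exprn_ge0 ?ler0n.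
Qed.

End Excluded.

(** The degree sum of a packing on any other number of points stays below that of the Steiner
    system by a constant factor.  Maclaurin's inequality shows this except for 7, 8, 9, 10 points
    when r = 5 and for 13, 14 points when r = 6, where the uncovered sets are counted. *)
Lemma small_degs (C : finType) (y : C -> rat) (P : {set {set C}}) (r m : nat) (t0 : rat) : witt_pair r m ->
  (forall i, 0 <= y i) -> \sum_i y i = 1 -> packing r P -> (forall i, t0 <= partial_at y P i) ->
  #|C| != m -> exists a1 a2 : nat, [/\ a1 = 1000%N, a2 = 999%N & a1%:R * m%:R ^+ r * t0 <= a2%:R * 'C(m, r.-1)%:R].
Proof.
move=> wp y0 y1 pP degs ne; have C0 := card_gt0_weights y1.
suff h (a1 a2 : nat) : a1 = 1000%N -> a2 = 999%N -> a1%:R * m%:R ^+ r * t0 <= a2%:R * 'C(m, r.-1)%:R.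
  by exists 1000%N, 999%N; split; [reflexivity|reflexivity|exact: h].
case: wp => -[er em]; subst r m => e1 e2.
- have [h|h] := leqP 12 #|C|.
    apply: (@small_degs_of_size _ y P 5 11 y0 y1 pP t0 degs a1 a2 3 C0 (erefl _)); rewrite e1 e2; exact: large_size_5.
  have : (#|C| \in iota 1 11) by rewrite mem_iota C0 ltnS.
  rewrite !inE (negbTE ne) orbF.
  have S : (1000 * 11 ^ 5 * 'C(#|C|, 4) <= 999 * #|C| ^ 5 * 'C(11, 4))%N -> a1%:R * 11%:R ^+ 5 * t0 <= a2%:R * 'C(11, 4)%:R.
    move=> q; apply: (@small_degs_of_size _ y P 5 11 y0 y1 pP t0 degs a1 a2 3 C0 (erefl _)); rewrite e1 e2; exact: q.
  have W k U : #|C| = k.+1 -> (0 < k)%N -> (U <= #|uncovered 5 P|)%N ->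
    (forall p d : nat, k * p <= d ->  1000 * 11 ^ 5 * ('C(k, 4) * d ^ 4 + k * 'C(k, 3) * p * d ^ 3) <=
      999 * k ^ 4 * k.+1 * 'C(11, 4) * (p + d) ^ 4 + 1000 * 11 ^ 5 * (U * k ^ 4 * p ^ 4))%N ->
     a1%:R * 11%:R ^+ 5 * t0 <= a2%:R * 'C(11, 4)%:R.
    move=> ck k0 hU H; apply: (@degs_min_weight C y P 3 y0 y1 pP t0 degs a1 a2 k U 11 ck k0 hU).
    by rewrite e1 e2; exact: H.
  have b4 : 'C(11, 4) = 330%N by [].
  case/orP => [/eqP ck|]; first (apply: S; rewrite ck b4; have -> : 'C(1, 4) = 0%N by []; lia).
  case/orP => [/eqP ck|]; first (apply: S; rewrite ck b4; have -> : 'C(2, 4) = 0%N by []; lia).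
  case/orP => [/eqP ck|]; first (apply: S; rewrite ck b4; have -> : 'C(3, 4) = 0%N by []; lia).
  case/orP => [/eqP ck|]; first (apply: S; rewrite ck b4; have -> : 'C(4, 4) = 1%N by []; lia).
  case/orP => [/eqP ck|]; first (apply: S; rewrite ck b4; have -> : 'C(5, 4) = 5%N by []; lia).
  case/orP => [/eqP ck|]; first (apply: S; rewrite ck b4; have -> : 'C(6, 4) = 15%N by []; lia).
  case/or4P => /eqP ck.
  + exact: (W 6 20 ck isT (uncovered7 ck pP) nat_weight_bound_7).
  + exact: (W 7 15 ck isT (uncovered8 ck pP) nat_weight_bound_8).
  + exact: (W 8 36 ck isT (uncovered9 ck pP) nat_weight_bound_9).
  + exact: (W 9 30 ck isT (uncovered10 ck pP) nat_weight_bound_10).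
- have [h|h] := leqP 15 #|C|.
    apply: (@small_degs_of_size _ y P 6 12 y0 y1 pP t0 degs a1 a2 4 C0 (erefl _)); rewrite e1 e2; exact: large_size_6.
  have : (#|C| \in iota 1 14) by rewrite mem_iota C0 ltnS.
  rewrite !inE (negbTE ne) /=.
  have S : (1000 * 12 ^ 6 * 'C(#|C|, 5) <= 999 * #|C| ^ 6 * 'C(12, 5))%N -> a1%:R * 12%:R ^+ 6 * t0 <= a2%:R * 'C(12, 5)%:R.
    move=> q; apply: (@small_degs_of_size _ y P 6 12 y0 y1 pP t0 degs a1 a2 4 C0 (erefl _)); rewrite e1 e2; exact: q.
  have W k U : #|C| = k.+1 -> (0 < k)%N -> (U <= #|uncovered 6 P|)%N ->
    (forall p d : nat, k * p <= d ->  1000 * 12 ^ 6 * ('C(k, 5) * d ^ 5 + k * 'C(k, 4) * p * d ^ 4) <=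
      999 * k ^ 5 * k.+1 * 'C(12, 5) * (p + d) ^ 5 + 1000 * 12 ^ 6 * (U * k ^ 5 * p ^ 5))%N ->
     a1%:R * 12%:R ^+ 6 * t0 <= a2%:R * 'C(12, 5)%:R.
    move=> ck k0 hU H; apply: (@degs_min_weight C y P 4 y0 y1 pP t0 degs a1 a2 k U 12 ck k0 hU).
    by rewrite e1 e2; exact: H.
  have b5 : 'C(12, 5) = 792%N by [].
  case/orP => [/eqP ck|]; first (apply: S; rewrite ck b5; have -> : 'C(1, 5) = 0%N by []; lia).
  case/orP => [/eqP ck|]; first (apply: S; rewrite ck b5; have -> : 'C(2, 5) = 0%N by []; lia).
  case/orP => [/eqP ck|]; first (apply: S; rewrite ck b5; have -> : 'C(3, 5) = 0%N by []; lia).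
  case/orP => [/eqP ck|]; first (apply: S; rewrite ck b5; have -> : 'C(4, 5) = 0%N by []; lia).
  case/orP => [/eqP ck|]; first (apply: S; rewrite ck b5; have -> : 'C(5, 5) = 1%N by []; lia).
  case/orP => [/eqP ck|]; first (apply: S; rewrite ck b5; have -> : 'C(6, 5) = 6%N by []; lia).
  case/orP => [/eqP ck|]; first (apply: S; rewrite ck b5; have -> : 'C(7, 5) = 21%N by []; lia).
  case/orP => [/eqP ck|]; first (apply: S; rewrite ck b5; have -> : 'C(8, 5) = 56%N by []; lia).
  case/orP => [/eqP ck|]; first (apply: S; rewrite ck b5; have -> : 'C(9, 5) = 126%N by []; lia).
  case/orP => [/eqP ck|]; first (apply: S; rewrite ck b5; have -> : 'C(10, 5) = 252%N by []; lia).
  case/orP => [/eqP ck|]; first (apply: S; rewrite ck b5; have -> : 'C(11, 5) = 462%N by []; lia).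
  case/orP => /eqP ck.
  + exact: (W 12 147 ck isT (uncovered13 ck pP) nat_weight_bound_13).
  + exact: (W 13 40 ck isT (uncovered14 ck pP) nat_weight_bound_14).
Qed.

(** * Weighted packings of nearly extremal degree are Steiner systems *)

Lemma witt_pairP r m : witt_pair r m -> exists s, r = s.+3 /\ (s.+3 < m)%N.
Proof. by case=> -[-> ->]; [exists 2%N | exists 3%N]. Qed.

Lemma witt_degree_gt0 r m : witt_pair r m -> 0 < witt_degree r m.
Proof.
move=> /witt_pairP[s [-> h]]; have m0 : (0 < m)%N by apply: leq_trans h.
apply: divr_gt0; last by rewrite exprn_gt0 // ltr0n.
rewrite ltr0n bin_gt0 -[s.+3.-1]/s.+2; lia.
Qed.

Lemma exists_min4 (a b c d : rat) : 0 < a -> 0 < b -> 0 < c -> 0 < d ->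
  exists e : rat, [/\ 0 < e, e <= a, e <= b & e <= c /\ e <= d].
Proof.
move=> a0 b0 c0 d0; exists (Num.min (Num.min a b) (Num.min c d)).
by rewrite !lt_min a0 b0 c0 d0 !ge_min !lexx ?orbT.
Qed.

Lemma sqr_dev_le (C : finType) (y : C -> rat) (a : rat) :
  #|C|%:R * a = 1 -> \sum_i y i = 1 -> forall i, (y i - a) ^+ 2 <= \sum_i y i ^+ 2 - a.
Proof.
move=> ka y1 i.
have -> : \sum_i y i ^+ 2 - a = \sum_i (y i - a) ^+ 2.
  under [RHS]eq_bigr do rewrite sqrrB.
  rewrite !big_split /= sumr_const sumrN.
  have -> : \sum_i y i * a *+ 2 = a * 2.
    rewrite (eq_bigr (fun i => y i * (a * 2))) -?mulr_suml ?y1 ?mul1r // => j _; ring.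
  have -> : a ^+ 2 *+ #|C| = a by rewrite expr2 -mulr_natl mulrA ka mul1r.
  ring.
rewrite (bigD1 i) //= lerDl; apply: sumr_ge0 => j _; exact: sqr_ge0.
Qed.

(** On m points, near equality in Maclaurin's inequality makes e_2(y) nearly maximal, hence y
    nearly uniform.  Each uncovered set then costs about m^(1-r) in the degree sum, so there is
    none. *)
Theorem near_extremal_weights r m : witt_pair r m -> forall eps : rat, 0 < eps ->
  exists2 eta : rat, 0 < eta & forall (C : finType) (y : C -> rat) (P : {set {set C}}),
    (forall i, 0 <= y i) -> \sum_i y i = 1 -> packing r P ->
    (forall i, witt_degree r m - eta <= partial_at y P i) ->
    [/\ #|C| = m, uncovered r P = set0 & forall i, `|y i - m%:R^-1| <= eps].
Proof.
move=> wp eps eps0; pose w := witt_degree r m.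
have w0 : 0 < w by exact: witt_degree_gt0.
have [s [er rm]] := witt_pairP wp.
have m0 : 0 < m%:R :> rat by rewrite ltr0n (leq_trans _ rm).
have s2m : (s.+2 <= m)%N by exact: ltnW (ltnW rm).
pose a : rat := m%:R^-1.
have a0 : 0 < a by rewrite invr_gt0.
have [e [e0 e1 e2 [_ _]]] : exists e : rat, [/\ 0 < e, e <= eps, e <= a / 2 & e <= 1 /\ e <= 1].
  by apply: exists_min4 => //; lra.
have pw0 : 0 < (a / 2) ^+ s.+2 by rewrite exprn_gt0 //; lra.
(* K stands for 1000 and K - 1 for 999: only their difference matters. *)
have [K [K0 eK]] : exists K : rat, 0 < K /\ forall b1 b2 : nat, b1 = 1000%N -> b2 = 999%N -> b1%:R = K /\ b2%:R = K - 1.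
  have [n en] : exists n : nat, n = 999%N by exists 999%N.
  exists n.+1%:R; split => [|b1 b2 -> e2']; first by rewrite ltr0n.
  by rewrite e2' -en; split; [congr (_%:R); rewrite en | rewrite -natr1 addrK].
have wK0 : 0 < w / (2 * K) by apply: divr_gt0 => //; apply: mulr_gt0.
have [eta [eta0 h1 h2 [h3 _]]] : exists eta : rat, [/\ 0 < eta, eta <= w / (2 * K), eta <= w * e ^+ 2 &
    eta <= (a / 2) ^+ s.+2 * a / 2 /\ eta <= 1].
  apply: exists_min4 => //.
    by rewrite mulr_gt0 // exprn_gt0.
  by apply: divr_gt0 => //; apply: mulr_gt0.
exists eta => // C y P y0 y1 pP degs.
have cC : #|C| = m.
  apply/eqP; apply: contraT => ne; exfalso.
  have [b1 [b2 [eb1 eb2]]] := small_degs wp y0 y1 pP degs ne.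
  have [-> ->] := eK _ _ eb1 eb2.
  have M0 : 0 < m%:R ^+ r :> rat by rewrite exprn_gt0.
  have wE : 'C(m, r.-1)%:R = m%:R ^+ r * w by rewrite /w /witt_degree mulrC divfK // gt_eqF.
  rewrite -/w wE -mulrA [(K - 1) * _]mulrCA [K * _]mulrCA ler_pM2l //.
  have : K * eta <= w / 2 by move: h1; rewrite ler_pdivlMr ?mulr_gt0 // => h1; lra.
  lra.
have ka : #|C|%:R * a = 1 by rewrite cC /a divff // gt_eqF.
subst r.
have sd := sum_degs pP degs.
have E1 := elemsym1T y1.
pose E := elemsym s.+2 y [set: C].
have Emax : E <= m%:R * w.
  have := @maclaurin _ s.+2 y setT y0; rewrite E1 expr1n mulr1 cardsT cC -/E.
  have -> : 'C(m, s.+2)%:R = m%:R * w * m%:R ^+ s.+2.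
    rewrite /w /witt_degree -[s.+3.-1]/s.+2 [m%:R ^+ s.+3]exprS; set X := 'C(_, _)%:R; set Y := m%:R ^+ s.+2.
    have Y0 : Y != 0 by rewrite gt_eqF // exprn_gt0.
    have M0 : (m%:R : rat) != 0 by rewrite gt_eqF.
    by field; rewrite Y0 M0.
  by rewrite ler_pM2r // exprn_gt0.
set Z := \sum_(D in _) _ in sd; have Z0 : 0 <= Z by apply: sumr_ge0 => D _; apply: prodr_ge0.
rewrite cC -/E -/w in sd.
have dev i : (y i - a) ^+ 2 <= e ^+ 2.
  apply: le_trans (sqr_dev_le ka y1 i) _.
  have := elemsym2 y setT; rewrite E1 expr1n.
  have -> : \sum_(i in [set: C]) y i ^+ 2 = \sum_i y i ^+ 2 by apply: eq_bigl => j; rewrite inE.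
  set Q := \sum_i y i ^+ 2; set e2y := elemsym 2 y setT => q2.
  have := @elemsym_le _ 2 s y setT y0; rewrite -[(2 + s)%N]/s.+2 E1 cardsT cC expr1n mulr1 -/E -/e2y => /(_ s2m).
  have -> : 'C(m, s.+2)%:R = m%:R ^+ s * (m%:R ^+ 3 * w).
    rewrite /w /witt_degree -[s.+3.-1]/s.+2 mulrA -exprD addn3 mulrC divfK // gt_eqF // exprn_gt0 //.
  have -> : 'C(m, 2)%:R = m%:R * (m%:R - 1) / 2 :> rat.
    have := mul_bin_diag m 1; rewrite bin1 => /(congr1 (fun n => n%:R : rat)).
    rewrite !natrM => h; have m1 : (m.-1)%:R = m%:R - 1 :> rat.
      by rewrite -subn1 natrB // (leq_trans _ rm).
    by rewrite -m1; lra.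
  have M0 : 0 < m%:R ^+ s :> rat by rewrite exprn_gt0.
  rewrite [E * _]mulrA [E * _ * _]mulrC -[X in _ <= X]mulrA ler_pM2l // => q3.
  have q4 : (m%:R * w - m%:R * eta) * (m%:R * (m%:R - 1) / 2) <= m%:R ^+ 3 * w * e2y.
    apply: le_trans q3; apply: ler_wpM2r; last by lra.
    by rewrite divr_ge0 // mulr_ge0 ?ler0n // subr_ge0 ler1n (leq_trans _ s2m).
  have q5 : (w - eta) * (1 - a) <= w * (1 - Q).
    have ma : m%:R * a = 1 by rewrite /a divff // gt_eqF.
    have m2 : 0 < m%:R ^+ 3 / 2 :> rat by rewrite divr_gt0 // exprn_gt0.
    rewrite -(ler_pM2l m2).
    have -> : m%:R ^+ 3 / 2 * (w * (1 - Q)) = m%:R ^+ 3 * w * e2y by rewrite -q2; field.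
    apply: le_trans q4; rewrite le_eqVlt; apply/orP; left; apply/eqP.
    have -> : m%:R - 1 = m%:R * (1 - a) by rewrite mulrBr mulr1 ma.
    by field.
  have : w * (Q - a) <= w * e ^+ 2.
    have : eta * (1 - a) <= eta by rewrite ger_pMr //; lra.
    have -> : w * (Q - a) = w * (1 - a) - w * (1 - Q) by ring.
    have : (w - eta) * (1 - a) = w * (1 - a) - eta * (1 - a) by ring.
    lra.
  by rewrite ler_pM2l.
have dev' i : `|y i - a| <= e.
  by rewrite -(@ler_pXn2r _ 2) ?nnegrE ?normr_ge0 ?(ltW e0) // real_normK ?num_real // dev.
split => //; last by move=> i; apply: le_trans (dev' i) e1.
apply/setP => D; rewrite in_set0; apply/negP => Du.
have : (a / 2) ^+ s.+2 <= Z.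
  rewrite /Z (bigD1 D) //=; apply: ler_wpDr; first by apply: sumr_ge0 => D' _; apply: prodr_ge0.
  have cD : #|D| = s.+2 by move: Du; rewrite inE => /andP[/eqP].
  rewrite -cD -prodr_const; apply: ler_prod => j _.
  have := dev' j; rewrite ler_distl => /andP[q _]; apply/andP; split; lra.
have : Z <= m%:R * eta by lra.
have : m%:R * eta <= (a / 2) ^+ s.+2 / 2.
  have -> : (a / 2) ^+ s.+2 / 2 = m%:R * ((a / 2) ^+ s.+2 * a / 2).
    have ma : m%:R * a = 1 by rewrite /a divff // gt_eqF.
    by set x := (a / 2) ^+ _; have -> : m%:R * (x * a / 2) = (m%:R * a) * (x / 2); [field | rewrite ma mul1r].
  by rewrite ler_pM2l.
lra.
Qed.

(** * Hypergraphs, links and symmetrisation *)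

Local Close Scope ring_scope.

Section Hypergraphs.
Variable V : finType.
Implicit Types (E : {set {set V}}) (I D e J : {set V}) (u v a b x y : V).

Definition unif r E := forall e, e \in E -> #|e| = r.

(** Absence of the members of Sigma_r, with the first two edges written as the set I of size r-1
    that they share plus one vertex each. *)
Definition Sfree E := forall I a b D, a |: I \in E -> b |: I \in E -> D \in E ->
  a \notin I -> b \notin I -> a != b -> a \in D -> b \in D -> False.

(** In a generalized triangle the third edge moreover avoids the common part of the other two. *)
Definition Tfree E := forall I a b D, a |: I \in E -> b |: I \in E -> D \in E ->
  a \notin I -> b \notin I -> a != b -> a \in D -> b \in D -> [disjoint I & D] -> False.

Lemma Sfree_Tfree E : Sfree E -> Tfree E.
Proof. by move=> h I a b D h1 h2 h3 h4 h5 h6 h7 h8 _; exact: (h I a b D). Qed.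

Definition link E v := [set I : {set V} | (v \notin I) && (v |: I \in E)].

Definition codeg E u v := #|[set e in E | (u \in e) && (v \in e)]|.

Lemma card_link E v : #|link E v| = #|[set e in E | v \in e]|.
Proof.
rewrite -(@card_in_imset _ _ (fun I => v |: I)) => [|I J]; last first.
  rewrite !inE => /andP[vI _] /andP[vJ _] e; by rewrite -(setU1K vI) e setU1K.
apply: eq_card => e; rewrite inE; apply/imsetP/andP => [[I]|[eE ve]].
  by rewrite inE => /andP[_ h] ->; rewrite h setU11.
exists (e :\ v); last by rewrite setD1K.
by rewrite inE setD11 setD1K.
Qed.

Lemma link_unif r E v I : unif r E -> I \in link E v -> #|I| = r.-1.
Proof. by move=> ur; rewrite inE => /andP[vI /ur]; rewrite cardsU1 vI add1n => <-. Qed.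

Lemma sum_link r E : unif r E -> \sum_v #|link E v| = r * #|E|.
Proof.
move=> ur; under eq_bigr do rewrite card_link -sum1_card.
rewrite (exchange_big_dep (mem E)) /=; last by move=> v e _; rewrite inE => /andP[].
rewrite mulnC -sum_nat_const; apply: eq_bigr => e eE; rewrite sum1_card -(ur e eE).
by apply: eq_card => v; rewrite -[LHS]/(e \in [set e0 in E | v \in e0]) inE eE.
Qed.

End Hypergraphs.

(** A map that sends edges to edges is injective on edges, by uniformity, so it maps a member of
    Sigma_r to a member of Sigma_r. *)
Lemma hom_Sfree (V W : finType) (f : V -> W) r (E' : {set {set V}}) (E : {set {set W}}) :
  unif r E' -> unif r E -> (forall e, e \in E' -> f @: e \in E) -> Sfree E -> Sfree E'.
Proof.
move=> ur' ur fE sE I a b D aI bI DE na nb ab aD bD.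
have inj e : e \in E' -> {in e &, injective f}.
  by move=> eE; apply/imset_injP; rewrite (ur' _ eE) (ur _ (fE _ eE)) eqxx.
have imU z : f @: (z |: I) = f z |: f @: I by rewrite imsetU1.
have nin z : z \notin I -> z |: I \in E' -> f z \notin f @: I.
  move=> zI zE; apply/imsetP => -[w wI ez].
  have := inj _ zE z w; rewrite !inE eqxx wI orbT => /(_ isT isT ez) e; by rewrite e wI in zI.
apply: (sE (f @: I) (f a) (f b) (f @: D)); rewrite -?imU ?fE ?nin ?imset_f //.
by apply/eqP => h; rewrite (inj _ DE a b) ?eqxx in ab.
Qed.

Section Zykov.
Variable V : finType.
Implicit Types (E : {set {set V}}) (I D e J : {set V}) (u v a b x y : V).

(** Symmetrisation: v is replaced by a clone of u. *)
Definition zykov u v E : {set {set V}} :=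
  [set e in E | v \notin e] :|: [set e : {set V} | [&& v \in e, u \notin e & u |: (e :\ v) \in E]].

Lemma zykov_unif r u v E : unif r E -> unif r (zykov u v E).
Proof.
move=> ur e; rewrite !inE => /orP[/andP[/ur //]|/and3P[ve ue /ur]].
by rewrite cardsU1 !inE (negbTE ue) andbF => <-; rewrite (cardsD1 v e) ve.
Qed.

Lemma zykov_Sfree r u v E : unif r E -> Sfree E -> Sfree (zykov u v E).
Proof.
move=> ur; apply: (@hom_Sfree _ _ (fun x => if x == v then u else x) r) => //.
  exact: zykov_unif.
move=> e; rewrite !inE => /orP[/andP[eE ve]|/and3P[ve ue h]].
  rewrite (eq_in_imset (g := id)) ?imset_id // => x xe.
  by case: eqP => // exv; rewrite -exv xe in ve.
rewrite -(setD1K ve) imsetU1 eqxx (eq_in_imset (g := id)) ?imset_id // => x.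
by rewrite !inE => /andP[/negbTE ->].
Qed.

Lemma card_zykov u v E : u != v ->
  #|zykov u v E| + #|link E v| + codeg E u v = #|E| + #|link E u|.
Proof.
move=> uv; rewrite cardsU; have -> : [set e in E | v \notin e] :&: [set e : {set V} | [&& v \in e, u \notin e & u |: (e :\ v) \in E]] = set0.
  by apply/setP => e; rewrite !inE; case: (v \in e); rewrite ?andbF.
rewrite cards0 subn0.
have -> : #|[set e : {set V} | [&& v \in e, u \notin e & u |: (e :\ v) \in E]]| = #|[set e in E | (u \in e) && (v \notin e)]|.
  rewrite -(@card_in_imset _ _ (fun e => u |: (e :\ v))); last first.
    move=> e f; rewrite !inE => /and3P[ve ue _] /and3P[vf uf _] ef.
    have k (g : {set V}) : u \notin g -> v \in g -> v |: ((u |: (g :\ v)) :\ u) = g.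
      by move=> ug vg; rewrite setU1K ?setD1K // !inE (negbTE ug) andbF.
    by rewrite -(k e) // ef k.
  apply: eq_card => f; rewrite inE; apply/imsetP/and3P => [[e]|[fE uf vf]].
    rewrite inE => /and3P[ve ue h] ->; rewrite h setU11; split => //.
    by rewrite !inE eqxx eq_sym (negbTE uv).
  exists (v |: (f :\ u)).
    rewrite inE setU11 !inE eqxx (negbTE uv) /= setU1K ?setD1K // !inE.
    by rewrite (negbTE vf) andbF.
  by rewrite setU1K ?setD1K // !inE (negbTE vf) andbF.
rewrite !card_link /codeg.
have e1 := cardsID [set e : {set V} | v \in e] E.
have e2 := cardsID [set e : {set V} | v \in e] [set e in E | u \in e].
have f1 : E :&: [set e : {set V} | v \in e] = [set e in E | v \in e] by apply/setP => e; rewrite !inE.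
have f2 : E :\: [set e : {set V} | v \in e] = [set e in E | v \notin e] by apply/setP => e; rewrite !inE andbC.
have f3 : [set e in E | u \in e] :&: [set e : {set V} | v \in e] = [set e in E | (u \in e) && (v \in e)].
  by apply/setP => e; rewrite !inE andbA.
have f4 : [set e in E | u \in e] :\: [set e : {set V} | v \in e] = [set e in E | (u \in e) && (v \notin e)].
  by apply/setP => e; rewrite !inE andbC andbA.
rewrite f1 f2 in e1; rewrite f3 f4 in e2.
have arith (p q x y z t : nat) : p + q = z -> x + y = t -> q + y + p + x = z + t by lia.
exact: arith e1 e2.
Qed.

Definition twins E : {set V * V} := [set p | link E p.1 == link E p.2].
Definition twin_class E v := [set w | link E w == link E v].

Lemma zykov_twin_self u v E : u != v -> link (zykov u v E) u = link (zykov u v E) v.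
Proof.
move=> uv; apply/setP => I; rewrite !inE !eqxx /= (negbTE uv) eq_sym (negbTE uv) /= ?andbF ?andFb ?orbF.
case: (boolP (v \in I)) => vI /=; rewrite ?andbF //=.
by rewrite setU1K // andbT; case: (u \in I).
Qed.

Lemma zykov_twins u v E x y : u != v -> x != v -> y != v -> link E x = link E y ->
  link (zykov u v E) x = link (zykov u v E) y.
Proof.
have key z I : u != v -> z != v -> (I \in link (zykov u v E) z) =
    if v \in I then (u \notin I) && (u |: (I :\ v) \in link E z) else I \in link E z.
  move=> uv /negbTE zv; have vz : (v == z) = false by rewrite eq_sym.
  rewrite !inE vz /=; case: (boolP (v \in I)) => vI /=; last by rewrite andbT orbF.
  rewrite andbF /=.
  have -> : (z |: I) :\ v = z |: (I :\ v).
    by apply/setP => w; rewrite !inE andb_orr; case: eqP => //= ->; rewrite eq_sym zv.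
  rewrite setUCA [u == z]eq_sym zv /= !negb_or.
  by case: (z \notin I); case: (u \notin I); rewrite ?andbF ?andbT //=; case: (z != u).
move=> uv xv yv e; apply/setP => I; by rewrite !key // e.
Qed.

End Zykov.

(** * The potential that symmetrisation increases, and blow-ups *)

Section Potential.
Variable V : finType.
Implicit Types (E : {set {set V}}) (I D e J : {set V}) (u v a b x y : V).

Lemma card_twins E v :
  #|twins E| + 1 = \sum_(x | x != v) #|twin_class E x :\ v| + 2 * #|twin_class E v|.
Proof.
have -> : #|twins E| = \sum_x #|twin_class E x|.
  rewrite -sum1_card (eq_bigl (fun p => link E p.1 == link E p.2)); last by move=> p; rewrite inE.
  rewrite -(pair_big_dep xpredT (fun x y => link E x == link E y) (fun _ _ => 1)) /=.
  by apply: eq_bigr => x _; rewrite -sum1_card; apply: eq_bigl => y; rewrite inE eq_sym.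
rewrite (bigD1 v) //=.
have -> : \sum_(x | x != v) #|twin_class E x| = \sum_(x | x != v) #|twin_class E x :\ v| + \sum_(x | x != v) (v \in twin_class E x).
  by rewrite -big_split /=; apply: eq_bigr => x _; rewrite addnC (cardsD1 v).
have -> : \sum_(x | x != v) (v \in twin_class E x) = #|twin_class E v :\ v|.
  rewrite -sum1_card -big_mkcondr /=; apply: eq_bigl => x; by rewrite !inE eq_sym [link E x == _]eq_sym.
rewrite (cardsD1 v (twin_class E v)) [v \in _]inE eqxx /=; lia.
Qed.

(** The number of edges, with the number of pairs of twins as tie-break. *)
Definition potential E := #|E| * (#|V| * #|V|).+1 + #|twins E|.

Lemma card_twins_lt E : #|twins E| < (#|V| * #|V|).+1.
Proof. by rewrite ltnS -card_prod max_card. Qed.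

Lemma potential_card E E' : potential E <= potential E' -> #|E| <= #|E'|.
Proof.
rewrite /potential => h; rewrite leqNgt; apply/negP => lt.
have := card_twins_lt E'; set N := (_ * _).+1 in h * => tw.
have : #|E'|.+1 * N <= #|E| * N by rewrite leq_mul2r lt orbT.
by rewrite mulSn; lia.
Qed.

(** If no edge is gained, v leaves its own twin class for the class of u, which is at least as
    large, so the number of twin pairs grows. *)
Lemma zykov_potential E u v : codeg E u v = 0 -> link E u != link E v ->
  #|link E v| <= #|link E u| ->
  (#|link E v| = #|link E u| -> #|twin_class E v| <= #|twin_class E u|) ->
  #|E| <= #|zykov u v E| /\ potential E < potential (zykov u v E).
Proof.
move=> c0 nt le tie; have uv : u != v by apply: contraNneq nt => ->.
have := card_zykov E uv; rewrite c0 addn0 => cz.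
have leE : #|E| <= #|zykov u v E| by lia.
split => //; rewrite /potential.
have [lt|ge] := ltnP #|E| #|zykov u v E|.
  have := card_twins_lt E; set N := (_ * _).+1 => tw.
  have : #|E|.+1 * N <= #|zykov u v E| * N by rewrite leq_mul2r lt orbT.
  by rewrite mulSn; lia.
have eE : #|zykov u v E| = #|E| by apply/eqP; rewrite eqn_leq leE ge.
rewrite eE ltn_add2l.
have {}tie : #|twin_class E v| <= #|twin_class E u| by apply: tie; lia.
have e1 := card_twins E v; have e2 := card_twins (zykov u v E) v.
have h1 : \sum_(x | x != v) #|twin_class E x :\ v| <= \sum_(x | x != v) #|twin_class (zykov u v E) x :\ v|.
  apply: leq_sum => x xv; apply: subset_leq_card; apply/subsetP => y; rewrite !inE => /andP[yv /eqP e].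
  by rewrite yv /=; apply/eqP; apply: zykov_twins.
have h2 : #|twin_class E u| < #|twin_class (zykov u v E) v|.
  rewrite (cardsD1 v (twin_class (zykov u v E) v)) inE eqxx add1n ltnS.
  apply: subset_leq_card; apply/subsetP => y; rewrite !inE => /eqP e.
  have yv : y != v by apply: contraNneq nt => <-; rewrite e.
  rewrite yv /= -zykov_twin_self //; apply/eqP; exact: zykov_twins.
rewrite -(ltn_add2r 1) e1 e2; lia.
Qed.

(** No symmetrisation step applies: vertices with different links lie in a common edge. *)
Definition symmetrized E := forall u v, link E u != link E v -> exists2 D, D \in E & (u \in D) && (v \in D).

Lemma codeg_sym E u v : codeg E u v = codeg E v u.
Proof. by apply: eq_card => e; rewrite !inE; congr (_ && _); rewrite andbC. Qed.

Lemma codeg0 E u v : (forall D, D \in E -> (u \in D) && (v \in D) -> False) -> codeg E u v = 0.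
Proof.
move=> h; apply/eqP; rewrite cards_eq0; apply/eqP/setP => D; rewrite !inE.
by apply/negP => /andP[DE uvD]; exact: (h D).
Qed.

Lemma not_symmetrized E : ~ symmetrized E ->
  exists u v, [/\ u != v, #|E| <= #|zykov u v E| & potential E < potential (zykov u v E)].
Proof.
move=> ns; have [u [v [nt nD]]] : exists u v, link E u != link E v /\ ~ exists2 D, D \in E & (u \in D) && (v \in D).
  apply/not_existsP => h; apply: ns => u v nt; apply: contrapT => nD; apply: (h u); by exists v.
have c0 : codeg E u v = 0 by apply: codeg0 => D DE uvD; apply: nD; exists D.
have uv : u != v by apply: contraNneq nt => ->.
have nt' : link E v != link E u by rewrite eq_sym.
have c0' : codeg E v u = 0 by rewrite codeg_sym.
have vu : v != u by rewrite eq_sym.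
have use x y : x != y -> #|E| <= #|zykov x y E| /\ potential E < potential (zykov x y E) ->
    exists u v, [/\ u != v, #|E| <= #|zykov u v E| & potential E < potential (zykov u v E)].
  by move=> xy [h1 h2]; exists x, y; split.
have [lt|gt|eq] := ltngtP #|link E v| #|link E u|.
- by apply: (use u v) => //; apply: zykov_potential => //; [exact: ltnW | move=> e; rewrite e ltnn in lt].
- by apply: (use v u) => //; apply: zykov_potential => //; [exact: ltnW | move=> e; rewrite e ltnn in gt].
have [le|lt] := leqP #|twin_class E v| #|twin_class E u|.
- by apply: (use u v) => //; apply: zykov_potential => //; rewrite eq.
- by apply: (use v u) => //; apply: zykov_potential => //; [rewrite eq | move=> _; exact: ltnW].
Qed.

Lemma exists_max_potential (X : {set {set V}} -> Prop) E0 : X E0 ->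
  exists2 E, X E & forall E', X E' -> potential E' <= potential E.
Proof.
move=> XE0; have p0 : `[< X E0 >] by apply/asboolP.
have [E /asboolP XE max] := @arg_maxnP _ E0 (fun E => `[< X E >]) potential p0.
by exists E => // E' /asboolP; exact: max.
Qed.

End Potential.

Section Pullback.
Variables (V C : finType).
Implicit Types (phi : V -> C) (P : {set {set C}}) (T : {set C}) (U I e : {set V}).

(** The blow-up of P along phi; by uniformity of P, phi is injective on the edges. *)
Definition pullback r phi P : {set {set V}} := [set e : {set V} | (#|e| == r) && (phi @: e \in P)].

Lemma pullback_unif r phi P : unif r (pullback r phi P).
Proof. by move=> e; rewrite inE => /andP[/eqP]. Qed.

Definition part phi i : {set V} := phi @^-1: [set i].

Lemma in_part phi i x : (x \in part phi i) = (phi x == i).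
Proof. by rewrite !inE. Qed.

Definition transversals phi U T : {set {set V}} :=
  [set e : {set V} | [&& e \subset U, #|e| == #|T| & phi @: e == T]].

(** Induction on T: a transversal is a choice of one vertex in each part of T. *)
Lemma card_transversals phi U T : #|transversals phi U T| = \prod_(i in T) #|U :&: part phi i|.
Proof.
move: {2}(#|T|) (leqnn #|T|) => n; elim: n T => [|n IH] T.
  rewrite leqn0 cards_eq0 => /eqP ->; rewrite big_set0 -[RHS](cards1 (set0 : {set V})).
  apply: eq_card => e; rewrite !inE cards0 cards_eq0; case: eqP => [->|]; rewrite ?andbF //.
  by rewrite sub0set imset0 eqxx.
move=> hT; have [->|[i iT]] := set_0Vmem T; first by apply: IH; rewrite cards0.
have cT : #|T| = #|T :\ i|.+1 by rewrite (cardsD1 i) iT.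
rewrite (big_setD1 i iT) /= -IH; last by rewrite -ltnS -cT.
rewrite -cardsX -(@card_in_imset _ _ (fun p : V * {set V} => p.1 |: p.2)); last first.
  move=> [x e] [x' e']; rewrite !inE /= => /andP[/andP[xU /eqP px] /and3P[eU _ /eqP fe]].
  move=> /andP[/andP[xU' /eqP px'] /and3P[eU' _ /eqP fe']] eq.
  have nin z (f : {set V}) : phi z = i -> phi @: f = T :\ i -> z \notin f.
    move=> pz pf; apply/negP => zf; have := imset_f phi zf; by rewrite pf pz setD11.
  have xx : x = x'.
    have : x \in x' |: e' by rewrite -eq setU11.
    by rewrite !inE => /orP[/eqP //|h]; rewrite (negbTE (nin x e' px fe')) in h.
  rewrite -xx in eq *; congr (_, _).
  by rewrite -(setU1K (nin x e px fe)) eq setU1K // nin.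
apply: eq_card => e; rewrite inE; apply/and3P/imsetP => [[eU /eqP ce /eqP fe]|[[x f]]].
  have /imsetP[x xe ex] : i \in phi @: e by rewrite fe.
  have inj : {in e &, injective phi} by apply/imset_injP; rewrite ce fe.
  exists (x, e :\ x); last by rewrite /= setD1K.
  rewrite !inE /= (subsetP eU) // -ex eqxx /= (subset_trans (subsetDl _ _)) //=.
  have ce' : #|e| = #|e :\ x|.+1 by rewrite (cardsD1 x) xe.
  rewrite -eqSS -ce' -cT ce eqxx /=; apply/eqP/setP => j; rewrite !inE -fe.
  apply/imsetP/andP => [[y]|[ji /imsetP[y ye ey]]].
    rewrite !inE => /andP[yx ye] ->; split; last exact: imset_f.
    by rewrite ex; apply: contra yx => /eqP /inj ->.
  exists y => //; rewrite !inE ye andbT; apply: contraNneq ji => yx.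
  by rewrite ey yx ex.
rewrite !inE /= => /andP[/andP[xU /eqP px] /and3P[fU /eqP cf /eqP pf]] ->.
have nx : x \notin f by apply/negP => xf; have : phi x \in phi @: f; [exact: imset_f | rewrite pf px setD11].
by rewrite subUset sub1set xU fU cardsU1 nx cf cT imsetU1 px pf setD1K.
Qed.

Lemma pullback_link r phi P v I : (forall T, T \in P -> #|T| = r) ->
  (I \in link (pullback r phi P) v) = [&& #|I| == r.-1, phi v \notin phi @: I, phi v |: phi @: I \in P & 0 < r].
Proof.
move=> ur; rewrite !inE imsetU1; apply/and3P/and4P => [[vI cI h]|[cI nv h r0]].
  have e1 := ur _ h; rewrite cardsU1 vI add1n in cI; rewrite -(eqP cI) in e1 *.
  rewrite /= eqxx; split => //.
  apply/negP => hv; have hle := leq_imset_card phi I.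
  by move: e1; rewrite cardsU1 hv add0n => e1; move: hle; rewrite e1 ltnn.
have vI : v \notin I by apply: contra nv => /(imset_f phi).
by rewrite vI h cardsU1 vI add1n (eqP cI) prednK // eqxx.
Qed.

Lemma card_pullback_link r phi P v U : (forall T, T \in P -> #|T| = r) -> 0 < r ->
  #|[set I in link (pullback r phi P) v | I \subset U]| =
  \sum_(T in P | phi v \in T) \prod_(j in T :\ phi v) #|U :&: part phi j|.
Proof.
move=> ur r0; under eq_bigr do rewrite -card_transversals -sum1_card.
rewrite -sum1_card.
rewrite (exchange_big_dep (fun I => (I \in link (pullback r phi P) v) && (I \subset U))) /=; last first.
  move=> T I /andP[TP vT]; rewrite inE => /and3P[IU /eqP cI /eqP fI].
  rewrite IU andbT pullback_link // fI setD11 setD1K // TP r0 cI andbT /=.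
  by rewrite -(ur T TP) (cardsD1 (phi v) T) vT add1n eqxx.
rewrite (eq_bigl (fun I => (I \in link (pullback r phi P) v) && (I \subset U))); last by move=> I; rewrite inE.
apply: eq_bigr => I /andP[]; rewrite pullback_link // => /and4P[/eqP cI nv h _] IU.
rewrite (big_pred1 (phi v |: phi @: I)) // => T; rewrite inE IU /=.
apply/andP/eqP => [[/andP[TP vT] /andP[_ /eqP ->]]|->]; first by rewrite setD1K.
by rewrite h setU11 setU1K // eqxx cI -(ur _ h) cardsU1 nv add1n eqxx.
Qed.

End Pullback.

(** * Symmetrized graphs are blow-ups of packings; densities *)

Section Counting.
Variable V : finType.
Implicit Types (F E : {set {set V}}) (D e I : {set V}).

Lemma bin_le_exp n k : 'C(n, k) <= n ^ k.
Proof.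
have h : n ^_ k <= n ^ k by elim: k => // k IH; rewrite ffactnSr expnSr leq_mul // leq_subr.
by apply: leq_trans h; rewrite -bin_ffact leq_pmulr // fact_gt0.
Qed.

Lemma card_ksets_le F k : (forall e, e \in F -> #|e| = k) -> #|F| <= #|V| ^ k.
Proof.
move=> h; apply: leq_trans (bin_le_exp _ _); rewrite -card_draws.
by apply: subset_leq_card; apply/subsetP => e /h ce; rewrite inE ce.
Qed.

Lemma card_containing F k D : (forall e, e \in F -> #|e| = k) -> (forall e, e \in F -> D \subset e) ->
  #|F| <= #|V| ^ (k - #|D|).
Proof.
move=> hk hD; rewrite -(@card_in_imset _ _ (fun e => e :\: D)) => [|e f eF fF ef]; last first.
  by rewrite -(setID e D) -(setID f D) ef (setIidPr (hD e eF)) (setIidPr (hD f fF)).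
apply: card_ksets_le => e /imsetP[f fF ->].
by rewrite cardsD (setIidPr (hD f fF)) hk.
Qed.

Lemma card_meeting F k D : (forall e, e \in F -> #|e| = k) ->
  (forall e, e \in F -> ~~ [disjoint e & D]) -> #|F| <= #|D| * #|V| ^ k.-1.
Proof.
move=> hk hD; rewrite -sum_nat_const.
apply: (@leq_trans (\sum_(x in D) #|[set e in F | x \in e]|)).
  rewrite -sum1_card (eq_bigr (fun x => \sum_(e in F | x \in e) 1)); last first.
    by move=> x _; rewrite -sum1_card; apply: eq_bigl => e; rewrite inE.
  rewrite (exchange_big_dep (mem F)) /=; last by move=> x e _ /andP[].
  apply: leq_sum => e eF; have := hD e eF; rewrite -setI_eq0 => /set0Pn[x]; rewrite inE => /andP[xe xD].
  by rewrite (bigD1 x) //= xD xe eF.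
apply: leq_sum => x xD; rewrite -subn1 -(cards1 x); apply: card_containing => e; rewrite inE => /andP[eF xe].
  exact: hk.
by rewrite sub1set.
Qed.

Lemma codeg_le r E u v : unif r E -> u != v -> codeg E u v <= #|V| ^ (r - 2).
Proof.
move=> ur uv; have -> : 2 = #|[set u; v]| by rewrite cards2 uv.
apply: card_containing => e; rewrite inE => /andP[eE]; first by move=> _; exact: ur.
by rewrite subUset !sub1set.
Qed.

End Counting.

Section Symmetrized.
Variables (V : finType) (r : nat) (E : {set {set V}}).
Hypotheses (ur : unif r E).

(** The vertices of the quotient by the relation of being twins are represented by the links
    themselves. *)
Definition link_type := [set (link E) @: e | e : {set V} in E].

Lemma link_inj e : e \in E -> {in e &, injective (link E)}.
Proof.
move=> eE x y xe ye exy; apply/eqP; apply: contraT => xy.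
have : e :\ x \in link E x by rewrite inE setD11 setD1K.
by rewrite exy inE !inE ye andbT eq_sym xy.
Qed.

Lemma link_type_card T : T \in link_type -> #|T| = r.
Proof. by move=> /imsetP[e eE ->]; rewrite card_in_imset ?ur //; exact: link_inj. Qed.

(** Twins are interchangeable, so E only depends on the twin classes. *)
Lemma twin_pullback : E = pullback r (link E) link_type.
Proof.
apply/setP => e; rewrite inE; apply/idP/andP => [eE|[/eqP ce /imsetP[e0 e0E ee]]].
  by rewrite ur // eqxx; split => //; apply: imset_f.
(* The edge e0 with the same classes as e is moved to e by replacing one vertex at a time by a
   twin. *)
move: {2}(#|e0 :\: e|) (leqnn #|e0 :\: e|) => n; elim: n e0 e0E ee => [|n IH] e0 e0E ee.
  rewrite leqn0 cards_eq0 setD_eq0 => sub.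
  have -> : e = e0 by apply/eqP; rewrite eq_sym eqEcard sub (ur e0E) ce /=.
  by [].
move=> hn; have [h0|[x]] := set_0Vmem (e0 :\: e).
  by apply: IH e0E ee _; rewrite h0 cards0.
rewrite inE => /andP[xe xe0].
have : link E x \in link E @: e by rewrite ee; apply: imset_f.
case/imsetP => x' x'e exx'.
have x'e0 : x' \notin e0.
  apply/negP => x'e0; have := link_inj e0E xe0 x'e0 exx' => q; by rewrite q x'e in xe.
have e1E : x' |: (e0 :\ x) \in E.
  have : e0 :\ x \in link E x by rewrite inE setD11 setD1K.
  by rewrite exx' inE => /andP[].
apply: (IH _ e1E).
  by rewrite imsetU1 -exx' -imsetU1 setD1K.
rewrite -ltnS; apply: leq_trans hn.
apply: proper_card; apply/properP; split.
  apply/subsetP => z; rewrite !inE => /andP[ze /orP[/eqP zx'|/andP[_ ->]]]; last by rewrite ze.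
  by rewrite zx' x'e in ze.
by exists x; rewrite !inE ?xe ?xe0 // eqxx /= orbF; apply: contra xe => /eqP ->.
Qed.

(** Two classes that complete the same set of size r-1 would have representatives in a common
    edge, and this edge together with the two completed edges is a member of Sigma_r. *)
Lemma symmetrized_packing : 2 <= r -> Sfree E -> symmetrized E -> packing r link_type.
Proof.
move=> r2 sf sy; split; first exact: link_type_card.
move=> T1 T2 T1P T2P ne; rewrite leqNgt; apply/negP => lt.
have c1 := link_type_card T1P; have c2 := link_type_card T2P.
pose A := T1 :&: T2.
have cA : #|A| = r.-1.
  have le : #|A| <= r by rewrite -c1 subset_leq_card // subsetIl.
  have neA : #|A| != r.
    apply: contra ne => /eqP cA; have s1 : A = T1 by apply/eqP; rewrite eqEcard subsetIl c1 cA /=.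
    by rewrite eqEcard c1 c2 leqnn andbT -s1 subsetIr.
  by rewrite -/A in lt; lia.
have ex (T : {set {set {set V}}}) : A \subset T -> #|T| = r -> exists2 a, a \notin A & T = a |: A.
  move=> AT cT; have : #|T :\: A| = 1 by rewrite cardsD (setIidPr AT) cT cA; lia.
  move/eqP/cards1P => [a ea]; exists a; first by have := set11 a; rewrite -ea inE => /andP[].
  by rewrite -ea setUC -{1}(setIidPr AT) setID.
have [al alA e1] := ex T1 (subsetIl _ _) c1.
have [be beA e2] := ex T2 (subsetIr _ _) c2.
clearbody A.
have /imsetP[d1 d1E dT1] := T1P; have /imsetP[d2 d2E dT2] := T2P.
have /imsetP[a ad1 ea] : al \in link E @: d1 by rewrite -dT1 e1 setU11.
have /imsetP[b bd2 eb] : be \in link E @: d2 by rewrite -dT2 e2 setU11.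
pose I := d1 :\ a.
have lI : link E @: I = A.
  apply/setP => t; apply/imsetP/idP => [[x]|tA].
    rewrite !inE => /andP[xa xd1] ->; have : link E x \in T1 by rewrite dT1 imset_f.
    rewrite e1 in_setU1 => /orP[/eqP h|hA]; last exact: hA.
    rewrite ea in h.
    by rewrite (link_inj d1E xd1 ad1 h) eqxx in xa.
  have : t \in link E @: d1 by rewrite -dT1 e1 in_setU1 tA orbT.
  case/imsetP => x xd1 tx; exists x => //; rewrite !inE xd1 andbT; apply: contraNneq alA => xa.
  by rewrite ea -xa -tx.
have aI : a \notin I by rewrite !inE eqxx.
have bI : b \notin I.
  by apply: contra beA => bI; rewrite eb -lI imset_f.
have aIE : a |: I \in E by rewrite setD1K.
have bIE : b |: I \in E.
  rewrite twin_pullback inE imsetU1 lI -eb -e2 T2P andbT cardsU1 bI -(ur aIE) cardsU1 aI //.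
have nab : link E a != link E b.
  by apply: contra ne => /eqP h; rewrite e1 e2 ea eb h.
have [D DE /andP[aD bD]] := sy a b nab.
by apply: (sf I a b D) => //; apply: contraNneq nab => ->.
Qed.

End Symmetrized.

Local Open Scope ring_scope.

(** Counts are normalised by powers of the number of vertices, so that all estimates take place in
    the rationals with o(1) errors of the form dens n 1 a. *)
Definition dens (n k a : nat) : rat := a%:R / n%:R ^+ k.

Arguments dens (n k a)%_N.

Lemma dens_ge0 n k a : 0 <= dens n k a.
Proof. by rewrite /dens divr_ge0 ?exprn_ge0 ?ler0n. Qed.

Lemma dens_le n k a b : (a <= b)%N -> dens n k a <= dens n k b.
Proof. by move=> h; rewrite /dens ler_wpM2r ?invr_ge0 ?exprn_ge0 ?ler0n // ler_nat. Qed.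

Lemma densD n k a b : dens n k (a + b) = dens n k a + dens n k b.
Proof. by rewrite /dens natrD mulrDl. Qed.

Lemma dens_sum n k (I : finType) (Q : pred I) (F : I -> nat) :
  dens n k (\sum_(i | Q i) F i) = \sum_(i | Q i) dens n k (F i).
Proof. by rewrite /dens natr_sum mulr_suml. Qed.

Lemma densX n j k a b : (0 < n)%N -> dens n (j + k) (a * b) = dens n j a * dens n k b.
Proof. by move=> n0; rewrite /dens natrM exprD invfM mulrACA. Qed.

Lemma dens_pow n k : (0 < n)%N -> dens n k (n ^ k) = 1.
Proof. by move=> n0; rewrite /dens natrX divff // expf_neq0 // pnatr_eq0 -lt0n. Qed.

Lemma densXpow n j k a : (0 < n)%N -> dens n (j + k) (a * n ^ k) = dens n j a.
Proof. by move=> n0; rewrite densX // dens_pow // mulr1. Qed.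

Lemma dens_small (a : nat) (e : rat) : 0 < e -> exists n0 : nat, (0 < n0)%N /\ forall n, (n0 <= n)%N -> dens n 1 a <= e.
Proof.
move=> e0; exists (Num.truncn (a%:R / e)).+1; split=> // n hn.
have n0 : 0 < n%:R :> rat by rewrite ltr0n; apply: leq_trans hn.
rewrite /dens expr1 ler_pdivrMr // mulrC -ler_pdivrMr //; apply: ltW.
by apply: lt_le_trans (truncnS_gt _) _; rewrite ler_nat.
Qed.

(** * The asymptotic density of graphs free of Sigma *)

Lemma dens_prod n (C : finType) (A : {set C}) (f : C -> nat) :
  \prod_(j in A) dens n 1 (f j) = dens n #|A| (\prod_(j in A) f j).
Proof. by rewrite /dens big_split /= natr_prod prodfV prodr_const expr1. Qed.

(** Larger degrees would force exactly m points, and there Maclaurin's inequality gives this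
    bound. *)
Lemma partial_at_le_witt_degree r m (wp : witt_pair r m) (C : finType) (y : C -> rat) (P : {set {set C}}) t :
  (forall i, 0 <= y i) -> \sum_i y i = 1 -> packing r P -> (forall i, t <= partial_at y P i) ->
  t <= witt_degree r m.
Proof.
move=> y0 y1 pP degs; rewrite leNgt; apply/negP => lt.
have [eta eta0 H] := near_extremal_weights wp (ltr01 : 0 < 1 :> rat).
have [|cC _ _] := H C y P y0 y1 pP.
  by move=> i; apply: le_trans (degs i); lra.
have [s [er rm]] := witt_pairP wp; subst r.
have := degs_maclaurin y0 y1 pP degs; rewrite cC => h.
have m0 : 0 < m%:R ^+ s.+3 :> rat by rewrite exprn_gt0 // ltr0n; lia.
by move: lt; rewrite /witt_degree ltr_pdivrMr // mulrC => lt; have := lt_le_trans lt h; rewrite ltxx.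
Qed.

Section PartWeights.
Variables (V C : finType) (phi : V -> C) (U : {set V}).
Hypothesis U0 : (0 < #|U|)%N.

Definition part_weight i := dens #|U| 1 #|U :&: part phi i|.

Lemma part_weight_ge0 i : 0 <= part_weight i.
Proof. exact: dens_ge0. Qed.

Lemma sum_card_part : (\sum_i #|U :&: part phi i|)%N = #|U|.
Proof.
rewrite -[RHS]sum1_card (partition_big phi xpredT) //=; apply: eq_bigr => i _.
by rewrite -sum1_card; apply: eq_bigl => x; rewrite !inE.
Qed.

Lemma sum_part_weight : \sum_i part_weight i = 1.
Proof.
rewrite /part_weight -dens_sum sum_card_part -{2}[#|U|]expn1 dens_pow //.
Qed.

(** The degrees in a blow-up are the partial derivatives at the relative sizes of its parts. *)
Lemma partial_at_part_weight r P v : (0 < r)%N -> packing r P ->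
  partial_at part_weight P (phi v) = dens #|U| r.-1 #|[set I in link (pullback r phi P) v | I \subset U]|.
Proof.
move=> r0 pP; rewrite (card_pullback_link phi v U pP.1 r0) dens_sum /partial_at.
apply: eq_bigr => T /andP[TP vT]; rewrite dens_prod; congr (dens _ _ _).
by rewrite -(pP.1 T TP) (cardsD1 (phi v) T) vT.
Qed.

End PartWeights.

(** Discards the classes without vertex in U: a lower bound on the degrees will only be known at
    the vertices of U, but is required at every class. *)
Lemma relabel (V C : finType) (phi : V -> C) (U : {set V}) r (P : {set {set C}}) : (0 < #|U|)%N -> packing r P ->
  exists k (psi : V -> 'I_k) (S : {set {set 'I_k}}), [/\ packing r S,
    (forall i, exists2 v, v \in U & psi v = i) &
    forall e : {set V}, e \subset U -> (e \in pullback r psi S) = (e \in pullback r phi P)].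
Proof.
move=> /card_gt0P[u0 u0U] pP; pose A := phi @: U.
have a0A : phi u0 \in A by apply: imset_f.
pose psi v := enum_rank_in a0A (phi v).
pose S := [set T : {set 'I_#|A|} | [set enum_val i | i in T] \in P].
have key v : v \in U -> enum_val (psi v) = phi v by move=> vU; rewrite /psi enum_rankK_in // imset_f.
have cI (T : {set 'I_#|A|}) : #|[set enum_val i | i in T]| = #|T| by rewrite card_imset //; exact: enum_val_inj.
exists #|A|, psi, S; split.
- split=> [T|T1 T2]; first by rewrite inE => /pP.1; rewrite cI.
  rewrite !inE => h1 h2 ne; rewrite -cI imsetI; last by move=> i j _ _; exact: enum_val_inj.
  by apply: pP.2 => //; apply: contra ne => /eqP /imset_inj -> //; exact: enum_val_inj.
- move=> i; have /imsetP[v vU ev] := enum_valP i; exists v => //.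
  by apply: enum_val_inj; rewrite key // ev.
move=> e eU; rewrite !inE; congr (_ && _).
rewrite -imset_comp; congr (_ \in P); apply: eq_in_imset => v ve /=.
by rewrite key // (subsetP eU).
Qed.

Lemma pullback_near_extremal r m : witt_pair r m -> forall eps : rat, 0 < eps ->
  exists2 eta : rat, 0 < eta & forall (V C : finType) (phi : V -> C) (U : {set V}) (P : {set {set C}}),
    (0 < #|U|)%N -> packing r P -> (forall i, exists2 v, v \in U & phi v = i) ->
    (forall v, v \in U -> witt_degree r m - eta <= dens #|U| r.-1 #|[set I in link (pullback r phi P) v | I \subset U]|) ->
    [/\ #|C| = m, uncovered r P = set0 & forall i, `|part_weight phi U i - m%:R^-1| <= eps].
Proof.
move=> wp eps eps0; have [eta eta0 H] := near_extremal_weights wp eps0.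
have r0 : (0 < r)%N by have [s [-> _]] := witt_pairP wp.
exists eta => // V C phi U P U0 pP surj degs.
apply: H => //; first exact: part_weight_ge0; first exact: sum_part_weight.
move=> i; have [v vU <-] := surj i; rewrite (partial_at_part_weight phi U v r0 pP); exact: degs.
Qed.

(** The edge density of balanced blow-ups. *)
Definition witt_density r m : rat := witt_degree r m / r%:R.

Section Restriction.
Variables (V : finType) (W : {set V}).
Let T : finType := {x : V | x \notin W}.
Variables (r : nat) (E : {set {set V}}).

Definition restrict : {set {set T}} := [set e : {set T} | val @: e \in E].

Lemma card_restrict_type : #|T| = (#|V| - #|W|)%N.
Proof. by rewrite card_sig -(cardsC W) addKn; apply: eq_card => x; rewrite !inE. Qed.

Lemma restrict_unif : unif r E -> unif r restrict.
Proof. by move=> ur e; rewrite inE => /ur; rewrite card_imset //; exact: val_inj. Qed.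

Lemma restrict_Sfree : unif r E -> Sfree E -> Sfree restrict.
Proof.
move=> ur; apply: (@hom_Sfree _ _ val r) => //; first exact: restrict_unif.
by move=> e; rewrite inE.
Qed.

Lemma card_restrict : #|restrict| = #|[set e in E | [disjoint e & W]]|.
Proof.
rewrite -(@card_imset _ _ (fun e : {set T} => val @: e)); last by apply: imset_inj; exact: val_inj.
apply: eq_card => e; rewrite inE; apply/imsetP/andP => [[f]|[eE dW]].
  rewrite inE => fE ->; split => //; rewrite disjoint_subset; apply/subsetP => x /imsetP[z _ ->].
  by rewrite inE; exact: valP z.
have key : e = val @: [set x : T | val x \in e].
  apply/setP => x; apply/idP/imsetP => [xe|[z]]; last by rewrite inE => ze ->.
  have xW : x \notin W by rewrite (disjointFr dW xe).
  by exists (Sub x xW); rewrite ?inE.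
by exists [set x : T | val x \in e]; rewrite ?inE -?key.
Qed.

End Restriction.

Lemma witt_density_unfold r m : witt_pair r m -> r%:R * witt_density r m = witt_degree r m.
Proof.
move=> /witt_pairP[s [-> _]]; rewrite /witt_density mulrC divfK // pnatr_eq0 //.
Qed.

(** A graph of maximal potential is symmetrized.  It is also nearly regular: cloning u over v
    changes the number of edges by the difference of their degrees, up to the n^(r-2) edges
    through both.  So all vertices of the weighted packing have degree nearly r |E| / n. *)
Theorem Sfree_upper r m : witt_pair r m -> forall delta : rat, 0 < delta ->
  exists n0 : nat, forall (V : finType) (E : {set {set V}}), (n0 <= #|V|)%N ->
    unif r E -> Sfree E -> dens #|V| r #|E| <= witt_density r m + delta.
Proof.
move=> wp delta delta0; have [s [er _]] := witt_pairP wp.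
have [n0 [n00 hn0]] := dens_small 1 delta0.
exists n0 => V E0 hn ur0 sf0; have n0' : (0 < #|V|)%N by apply: leq_trans hn.
have [E [ur sf] max] := @exists_max_potential V (fun E => unif r E /\ Sfree E) E0 (conj ur0 sf0).
have {}sf0 : (#|E0| <= #|E|)%N by apply: potential_card; apply: max.
apply: le_trans (dens_le _ _ sf0) _.
have sy : symmetrized E.
  apply: contrapT => /not_symmetrized[u [v [uv _ lt]]].
  have := max (zykov u v E) (conj (zykov_unif ur) (zykov_Sfree ur sf)); lia.
have reg u v : (#|link E u| <= #|link E v| + #|V| ^ (r - 2))%N.
  have [->|uv] := eqVneq u v; first exact: leq_addr.
  have := card_zykov E uv; have := codeg_le ur uv.
  have := potential_card (max (zykov u v E) (conj (zykov_unif ur) (zykov_Sfree ur sf))).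
  lia.
subst r.
have pP := symmetrized_packing ur isT sf sy.
pose t := s.+3%:R * dens #|V| s.+3 #|E| - delta.
have degs v : t <= dens #|V| s.+2 #|link E v|.
  have h : (s.+3 * #|E| <= (#|link E v| + #|V| ^ s.+1 * 1) * #|V| ^ 1)%N.
    rewrite -(sum_link ur) expn1 muln1 mulnC -sum_nat_const; apply: leq_sum => u _; exact: reg.
  have := dens_le #|V| (s.+2 + 1) h; rewrite densXpow // addn1 densD.
  rewrite [X in dens _ s.+2 X + _]/=.
  have -> : dens #|V| s.+2 (#|V| ^ s.+1 * 1) = dens #|V| 1 1.
    by rewrite mulnC -[s.+2]/(1 + s.+1)%N densXpow.
  have := hn0 _ hn => d1 h2.
  rewrite /t; have -> : s.+3%:R * dens #|V| s.+3 #|E| = dens #|V| s.+3 (s.+3 * #|E|) by rewrite /dens natrM mulrA.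
  lra.
have : t <= witt_degree s.+3 m.
  have V0 : (0 < #|[set: V]|)%N by rewrite cardsT.
  have [k [psi [S [pS surj pE]]]] := relabel (link E) V0 pP.
  have eE e : (e \in pullback s.+3 psi S) = (e \in E) by rewrite pE ?subsetT // -twin_pullback.
  apply: (partial_at_le_witt_degree wp (part_weight_ge0 psi setT) (sum_part_weight psi V0) pS) => i.
  have [v _ <-] := surj i; rewrite (partial_at_part_weight psi [set: V] v (isT : (0 < s.+3)%N) pS) cardsT -[s.+3.-1]/s.+2.
  apply: le_trans (degs v) _; apply: dens_le; apply: subset_leq_card; apply/subsetP => I.
  rewrite in_set subsetT andbT => /setIdP[h1 h2]; apply/setIdP; by rewrite eE.
have := witt_density_unfold wp; rewrite /t.
set c := witt_density _ _; set w := witt_degree _ _; set d := dens _ _ _ => <- h.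
have : s.+3%:R * d <= s.+3%:R * (c + delta).
  rewrite mulrDr; have : delta <= s.+3%:R * delta by apply: ler_peMl; [exact: ltW | rewrite ler1n].
  lra.
by rewrite ler_pM2l // ltr0n.
Qed.

(** * Blow-ups are free of Sigma; dense graphs have few vertices of low degree *)

(** The first two edges of a member of Sigma_r meet in r-1 points, more than a packing allows. *)
Lemma packing_Sfree (C : finType) r (S : {set {set C}}) : (2 <= r)%N -> packing r S -> Sfree S.
Proof.
move=> r2 [ur pw] I a b D aS bS _ aI bI ab _ _.
have ne : a |: I != b |: I.
  apply/negP => /eqP e; have := setU11 a I; rewrite e in_setU1 (negbTE ab) /=; exact/negP.
have := pw _ _ aS bS ne; have : (#|I| <= #|(a |: I) :&: (b |: I)|)%N.
  by apply: subset_leq_card; rewrite subsetI !subsetUr.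
by have := ur _ aS; rewrite cardsU1 aI; lia.
Qed.

Lemma pullback_Sfree (V C : finType) r (phi : V -> C) (S : {set {set C}}) :
  (2 <= r)%N -> packing r S -> Sfree (pullback r phi S).
Proof.
move=> r2 pS; apply: (@hom_Sfree _ _ phi r _ S) => //; first exact: pullback_unif.
- by move=> T /pS.1.
- by move=> e; rewrite inE => /andP[].
exact: packing_Sfree pS.
Qed.

Lemma subset_of_card (T : finType) (L : {set T}) t : (t <= #|L|)%N -> exists2 W : {set T}, W \subset L & #|W| = t.
Proof.
move=> h; exists [set x in take t (enum L)].
  by apply/subsetP => x; rewrite inE => /mem_take; rewrite mem_enum.
rewrite cardsE; have /card_uniqP -> : uniq (take t (enum L)) by apply: take_uniq; exact: enum_uniq.
by rewrite size_take -cardE; case: ltnP => // h2; apply/eqP; rewrite eqn_leq h h2.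
Qed.

Lemma expr_1B_le (x : rat) k : 0 <= x -> x <= 1 -> (1 - x) ^+ k <= 1 - k%:R * x + k%:R ^+ 2 * x ^+ 2.
Proof.
move=> x0 x1; elim: k => [|k IH]; first by rewrite expr0; lra.
rewrite exprS; apply: le_trans (_ : (1 - x) * (1 - k%:R * x + k%:R ^+ 2 * x ^+ 2) <= _).
  by apply: ler_wpM2l => //; lra.
rewrite -natr1; have k0 : 0 <= k%:R :> rat by rewrite ler0n.
set K := k%:R in k0 *; have h1 : 0 <= K ^+ 2 * x ^+ 3 by rewrite mulr_ge0 ?exprn_ge0.
have h2 : 0 <= K * x ^+ 2 by rewrite mulr_ge0 ?exprn_ge0.
have h3 : 0 <= x ^+ 2 by rewrite exprn_ge0.
rewrite -subr_ge0.
suff -> : 1 - (K + 1) * x + (K + 1) ^+ 2 * x ^+ 2 - (1 - x) * (1 - K * x + K ^+ 2 * x ^+ 2) = K ^+ 2 * x ^+ 3 + K * x ^+ 2 + x ^+ 2 by lra.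
ring.
Qed.

Lemma edges_meeting_le (V : finType) (E : {set {set V}}) (W : {set V}) :
  (#|E| <= #|[set e in E | [disjoint e & W]]| + \sum_(v in W) #|link E v|)%N.
Proof.
rewrite -(cardsID [set e : {set V} | [disjoint e & W]] E); apply: leq_add.
  by apply: subset_leq_card; apply/subsetP => e; rewrite !inE.
under eq_bigr do rewrite card_link -sum1_card.
rewrite -sum1_card (exchange_big_dep (mem E)) /=; last by move=> v e _; rewrite inE => /andP[].
rewrite [X in (X <= _)%N](eq_bigl (fun e => (e \in E) && ~~ [disjoint e & W])); last by move=> e; rewrite !inE andbC.
rewrite big_mkcondr /=; apply: leq_sum => e eE; case: ifP => //.
rewrite -setI_eq0 => /set0Pn[x]; rewrite inE => /andP[xe xW].
by rewrite (bigD1 x) //= inE xW xe eE.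
Qed.

Definition low_degree r m eta (V : finType) (E : {set {set V}}) :=
  [set v | dens #|V| r.-1 #|link E v| < witt_degree r m - eta].

Lemma exists_nat_gt (x : rat) : exists q : nat, x < q%:R.
Proof. by exists (Num.truncn x).+1; exact: truncnS_gt. Qed.

(** Deleting a small proportion of vertices of low degree would raise the density of the rest
    above the maximum given by the density theorem. *)
Lemma few_low_degree r m : witt_pair r m -> forall tau eta : rat, 0 < tau -> 0 < eta ->
  exists2 delta : rat, 0 < delta & exists n0 : nat, forall (V : finType) (E : {set {set V}}),
    (n0 <= #|V|)%N -> unif r E -> Sfree E -> witt_density r m - delta <= dens #|V| r #|E| ->
    dens #|V| 1 #|low_degree r m eta E| <= tau.
Proof.
move=> wp tau eta tau0 eta0.
have [s [er _]] := witt_pairP wp.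
pose c := witt_density r m; pose w := witt_degree r m.
have w0 : 0 < w by exact: witt_degree_gt0.
have wc : r%:R * c = w by exact: witt_density_unfold.
have rr0 : 0 < r%:R :> rat by rewrite er ltr0n.
have c0 : 0 < c by rewrite -(pmulr_rgt0 _ rr0) wc.
have [q [q2 q3 q4]] : exists q : nat, [/\ (2 <= q)%N, tau^-1 < q%:R & 2 * (w * r%:R) / eta < q%:R].
  have [q1 h1] := exists_nat_gt (tau^-1); have [q2 h2] := exists_nat_gt (2 * (w * r%:R) / eta).
  exists (maxn 2 (maxn q1 q2)); split; first exact: leq_maxl.
    by apply: lt_le_trans h1 _; rewrite ler_nat !leq_max leqnn !orbT.
  by apply: lt_le_trans h2 _; rewrite ler_nat !leq_max leqnn !orbT.
have q0 : 0 < q%:R :> rat by rewrite ltr0n; lia.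
pose iq : rat := q%:R^-1.
have iq0 : 0 < iq by rewrite invr_gt0.
have iq1 : iq <= 1 by rewrite invf_le1 // ler1n; lia.
have iqtau : iq <= tau by apply: ltW; rewrite /iq -[tau]invrK ltf_pV2 ?posrE ?invr_gt0.
have iqe : 2 * (w * r%:R) * iq <= eta.
  by move: q4; rewrite ltr_pdivrMr // => /ltW; rewrite /iq ler_pdivrMr // [eta * _]mulrC.
pose delta := eta * iq / 16.
have delta0 : 0 < delta by rewrite divr_gt0 // mulr_gt0.
exists delta => //.
have [n1 H] := Sfree_upper wp delta0.
exists (2 * n1 + 2 * q)%N => V E hn ur sf hE.
rewrite leNgt; apply/negP => big.
set n := #|V| in hn hE big *.
have n0 : (0 < n)%N by clear - hn q2; lia.
have n0' : 0 < n%:R :> rat by rewrite ltr0n.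
pose t := (n %/ q)%N.
have tq : (t * q <= n)%N by exact: leq_trunc_div.
have qN : (0 < q)%N by apply: leq_trans q2.
have t1 : (0 < t)%N by rewrite divn_gt0 //; clear - hn; lia.
have t2 : (2 * t <= n)%N by apply: leq_trans tq; rewrite mulnC leq_mul2l q2 orbT.
have tq2 : (n <= 2 * (t * q))%N.
  have h := ltn_ceil n qN; rewrite -/t mulSn in h.
  by rewrite mul2n -addnn; apply: leq_trans (ltnW h) _; rewrite leq_add2r leq_pmull.
pose theta := dens n 1 t.
have thE : theta = t%:R / n%:R by rewrite /theta /dens expr1.
have th1 : theta <= iq by rewrite thE ler_pdivrMr // mulrC /iq ler_pdivlMr // -natrM ler_nat.
have th2 : iq / 2 <= theta.
  rewrite thE ler_pdivlMr // /iq; move: tq2; rewrite -(ler_nat rat) !natrM => h.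
  rewrite -(ler_pM2r q0); rewrite mulrAC [_ / 2 * _]mulrAC mulVf ?gt_eqF // mul1r.
  by lra.
have th0 : 0 < theta by lra.
have [W WL cW] : exists2 W : {set V}, W \subset low_degree r m eta E & #|W| = t.
  apply: subset_of_card; rewrite leqNgt; apply/negP => lt.
  have := @dens_le n 1 _ _ (ltnW lt); rewrite -/theta; lra.
have := @dens_le n r _ _ (edges_meeting_le E W); rewrite densD -card_restrict.
have -> : dens n r #|restrict W E| = dens (n - t) r #|restrict W E| * (1 - theta) ^+ r.
  have e1 : 1 - theta = (n - t)%:R / n%:R.
    rewrite thE natrB; first by field; rewrite gt_eqF.
    by clear - t2; lia.
  rewrite e1 /dens expr_div_n; field; rewrite !expf_neq0 ?gt_eqF //.
  by rewrite ltr0n subn_gt0; clear - t1 t2; lia.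
have b1 : dens (n - t) r #|restrict W E| <= c + delta.
  have := H _ (restrict W E); rewrite card_restrict_type cW -/n; apply.
  - by clear - hn t2; lia.
  - exact: restrict_unif.
  - exact: restrict_Sfree ur sf.
have b2 : dens n r (\sum_(v in W) #|link E v|) <= theta * (w - eta).
  apply: le_trans (_ : \sum_(v in W) n%:R^-1 * (w - eta) <= _).
    rewrite dens_sum; apply: ler_sum => v vW.
    have := subsetP WL v vW; rewrite inE -/w -/n => /ltW.
    have -> : dens n r #|link E v| = n%:R^-1 * dens n r.-1 #|link E v|.
      have er' : r = r.-1.+1 by rewrite er.
      by rewrite /dens {1}er' exprS invfM mulrCA.
    by move=> h; apply: ler_wpM2l h; rewrite invr_ge0 ler0n.
  by rewrite sumr_const cW -[X in X <= _]mulr_natl mulrA thE.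
have b3 := @expr_1B_le theta r (ltW th0) (le_trans th1 iq1).
have b4 : 0 <= (1 - theta) ^+ r by apply: exprn_ge0; lra.
have b5 : (1 - theta) ^+ r <= 1 by apply: exprn_ile1; lra.
have b6 : c * (1 - theta) ^+ r <= c - theta * w + (w * r%:R * theta) * theta.
  have : c * (1 - theta) ^+ r <= c * (1 - r%:R * theta + r%:R ^+ 2 * theta ^+ 2) by apply: ler_wpM2l => //; exact: ltW.
  by rewrite -wc; set R := r%:R; move=> h; apply: le_trans h _; rewrite le_eqVlt; apply/orP; left; apply/eqP; ring.
have b7 : delta * (1 - theta) ^+ r <= delta by rewrite ger_pMr.
have b8 : dens (n - t) r #|restrict W E| * (1 - theta) ^+ r <= (c + delta) * (1 - theta) ^+ r by apply: ler_wpM2r.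
have b9 : (w * r%:R * theta) * theta <= (eta / 2) * theta.
  apply: ler_wpM2r; first exact: ltW.
  have : w * r%:R * theta <= w * r%:R * iq by apply: ler_wpM2l => //; rewrite mulr_ge0 // ltW.
  have : 2 * (w * r%:R) * iq = 2 * (w * r%:R * iq) by rewrite -mulrA.
  lra.
have b10 : eta * (iq / 2) <= eta * theta by apply: ler_wpM2l => //; exact: ltW.
have e1 : (c + delta) * (1 - theta) ^+ r = c * (1 - theta) ^+ r + delta * (1 - theta) ^+ r by ring.
have e2 : delta * 16 = eta * iq by rewrite /delta; field.
have e3 : theta * (w - eta) = theta * w - eta * theta by ring.
rewrite -/c in hE.
lra.
Qed.

(** * Dense symmetrized graphs are close to balanced blow-ups *)

Definition steiner_family (C : finType) r (S : {set {set C}}) := packing r S /\ uncovered r S = set0.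

Definition balanced (V C : finType) (eps : rat) (phi : V -> C) :=
  forall i, `|dens #|V| 1 #|part phi i| - #|C|%:R^-1| <= eps.

(** E contains nearly all edges of a balanced blow-up of a Steiner system. *)
Definition structured r m eps (V : finType) (E : {set {set V}}) :=
  exists S : {set {set 'I_m}}, exists phi : V -> 'I_m,
  [/\ steiner_family r S, dens #|V| r #|pullback r phi S :\: E| <= eps & balanced eps phi].

Lemma dens_meeting (V : finType) (F : {set {set V}}) k (D : {set V}) : (0 < #|V|)%N -> (0 < k)%N ->
  (forall e, e \in F -> #|e| = k) -> (forall e, e \in F -> ~~ [disjoint e & D]) ->
  dens #|V| k #|F| <= dens #|V| 1 #|D|.
Proof.
move=> n0 k0 hk hD; have := @dens_le #|V| k _ _ (card_meeting hk hD).
by have -> : dens #|V| k (#|D| * #|V| ^ k.-1) = dens #|V| 1 #|D| by rewrite -{1}(prednK k0) -add1n densXpow.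
Qed.

Lemma dens_le_dom a b k x : (0 < a)%N -> (a <= b)%N -> dens b k x <= dens a k x.
Proof.
move=> a0 ab; rewrite /dens ler_wpM2l ?ler0n // lef_pV2 ?posrE ?exprn_gt0 ?ltr0n //; last by apply: leq_trans ab.
by rewrite lerXn2r ?nnegrE ?ler0n // ler_nat.
Qed.

Lemma link_setU_sub (V : finType) (E : {set {set V}}) (U : {set V}) r v : (0 < #|V|)%N -> (1 < r)%N -> unif r E ->
  dens #|V| r.-1 #|link E v| <= dens #|V| r.-1 #|[set I in link E v | I \subset U]| + dens #|V| 1 #|~: U|.
Proof.
move=> n0 r1 ur; apply: le_trans (_ : dens #|V| r.-1 #|[set I in link E v | I \subset U]| + dens #|V| r.-1 #|[set I in link E v | ~~ (I \subset U)]| <= _).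
  rewrite -densD; apply: dens_le; rewrite -(cardsID [set I : {set V} | I \subset U] (link E v)).
  by apply: leq_add; apply: subset_leq_card; apply/subsetP => I; rewrite !inE // andbC.
rewrite lerD2l; apply: dens_meeting => //; first by lia.
  by move=> I /setIdP[/(link_unif ur)].
by move=> I /setIdP[_]; apply: contra; rewrite disjoints_subset setCK.
Qed.

(** Apart from few vertices of low degree, every vertex of a dense symmetrized graph has nearly
    the maximal degree, so the weights of its twin classes are nearly extremal. *)
Lemma symmetrized_structured r m : witt_pair r m -> forall eps : rat, 0 < eps ->
  exists2 delta : rat, 0 < delta & exists n0 : nat, forall (V : finType) (E : {set {set V}}),
    (n0 <= #|V|)%N -> unif r E -> Sfree E -> symmetrized E ->
    witt_density r m - delta <= dens #|V| r #|E| -> structured r m eps E.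
Proof.
move=> wp eps eps0; have [s [er sm]] := witt_pairP wp.
have e30 : 0 < eps / 3 by lra.
have [eta eta0 H] := pullback_near_extremal wp e30.
have [tau [tau0 t1 t2 [t3 _]]] : exists tau : rat, [/\ 0 < tau, tau <= eps / 6, tau <= eta / 2 & tau <= 1 / 2 /\ tau <= 1].
  by apply: exists_min4; lra.
have eta20 : 0 < eta / 2 by lra.
have [delta delta0 [n0 LD]] := few_low_degree wp tau0 eta20.
exists delta => //; exists (maxn 1 n0) => V E; rewrite geq_max => /andP[nV hn] ur sf sy hE.
have low := LD V E hn ur sf hE.
set L := low_degree r m (eta / 2) E in low; pose U := ~: L.
have n0' : 0 < #|V|%:R :> rat by rewrite ltr0n.
have cUL : (#|L| + #|U| = #|V|)%N by rewrite cardsC.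
have dUL : dens #|V| 1 #|L| + dens #|V| 1 #|U| = 1.
  by rewrite -densD cUL -{2}[#|V|]expn1 dens_pow.
have U0 : (0 < #|U|)%N.
  rewrite lt0n; apply/negP => /eqP u0; move: dUL; rewrite u0 [dens _ _ 0]/dens mul0r; lra.
have r2 : (2 <= r)%N by rewrite er.
have pP := symmetrized_packing ur r2 sf sy.
have [k [psi [S [pS surj pE]]]] := relabel (link E) U0 pP.
have eE (e : {set V}) : e \subset U -> (e \in pullback r psi S) = (e \in E) by move=> eU; rewrite pE // -twin_pullback.
have degs v : v \in U -> witt_degree r m - eta <= dens #|U| r.-1 #|[set I in link (pullback r psi S) v | I \subset U]|.
  move=> vU; apply: le_trans (dens_le_dom _ _ U0 (max_card _)).
  have -> : [set I in link (pullback r psi S) v | I \subset U] = [set I in link E v | I \subset U].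
    apply/setP => I; rewrite [LHS]inE [RHS]inE; case: (boolP (I \subset U)) => IU; rewrite ?andbF ?andbT //.
    by rewrite [LHS]inE [RHS]inE eE // subUset sub1set vU.
  have := link_setU_sub U v nV r2 ur; rewrite setCK.
  have : witt_degree r m - eta / 2 <= dens #|V| r.-1 #|link E v| by move: vU; rewrite !inE -leNgt.
  lra.
have [ck cov bal] := H V _ psi U S U0 pS surj degs.
rewrite card_ord in ck; subst k.
exists S, psi; split; first by split.
  apply: le_trans (_ : dens #|V| 1 #|L| <= _); last by lra.
  apply: dens_meeting => //; first by rewrite er.
    by move=> e /setDP[/pullback_unif].
  move=> e /setDP[ep eE']; apply: contra eE'; rewrite disjoints_subset => eU.
  by rewrite -eE.
move=> i; rewrite card_ord.
have := bal i; rewrite /part_weight.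
set x := dens #|U| 1 _; set a : rat := m%:R^-1 => hx.
have c1 : dens #|V| 1 #|U :&: part psi i| <= dens #|V| 1 #|part psi i| by apply: dens_le; rewrite subset_leq_card // subsetIr.
have c2 : dens #|V| 1 #|part psi i| <= dens #|V| 1 #|U :&: part psi i| + dens #|V| 1 #|L|.
  rewrite -densD; apply: dens_le; rewrite -(cardsID U (part psi i)) setIC leq_add2l.
  by apply: subset_leq_card; apply/subsetP => z; rewrite !inE negbK => /andP[].
have c3 : dens #|V| 1 #|U :&: part psi i| = x * dens #|V| 1 #|U|.
  rewrite /x /dens !expr1; field; rewrite !gt_eqF // ltr0n //.
have x0 : 0 <= x by exact: dens_ge0.
have x1 : x <= 1.
  have -> : 1 = dens #|U| 1 #|U| by rewrite -{2}[#|U|]expn1 dens_pow.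
  by apply: dens_le; rewrite subset_leq_card // subsetIl.
have l0 := dens_ge0 #|V| 1 #|L|.
have u1 : dens #|V| 1 #|U| = 1 - dens #|V| 1 #|L| by lra.
rewrite u1 in c3.
have c4 : x - dens #|V| 1 #|L| <= x * (1 - dens #|V| 1 #|L|).
  have : x * dens #|V| 1 #|L| <= dens #|V| 1 #|L| by exact: ler_piMl.
  rewrite mulrBr mulr1; lra.
have c5 : x * (1 - dens #|V| 1 #|L|) <= x.
  by apply: ler_piMr => //; lra.
move: hx; rewrite !ler_distl => /andP[h1 h2]; apply/andP; split; lra.
Qed.

(** Vertices of one part have the same degree, and a part is larger than the set of vertices of
    low degree; so no degree is low and the theorem on weights applies to the sizes of the parts.
    *)
Lemma pullback_balanced r m : witt_pair r m -> forall eps : rat, 0 < eps ->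
  exists2 delta : rat, 0 < delta & exists n0 : nat, forall (V : finType) (phi : V -> 'I_m) (S : {set {set 'I_m}}),
    (n0 <= #|V|)%N -> packing r S -> (forall i, m%:R^-1 / 2 <= dens #|V| 1 #|part phi i|) ->
    witt_density r m - delta <= dens #|V| r #|pullback r phi S| -> balanced eps phi.
Proof.
move=> wp eps eps0; have [s [er sm]] := witt_pairP wp.
have [eta eta0 H] := pullback_near_extremal wp eps0.
have m0 : 0 < m%:R^-1 :> rat by rewrite invr_gt0 ltr0n; lia.
have tau0 : 0 < m%:R^-1 / 4 :> rat by lra.
have [delta delta0 [n0 LD]] := few_low_degree wp tau0 eta0.
exists delta => //; exists (maxn 1 n0) => V phi S; rewrite geq_max => /andP[nV hn] pS large hE.
have r2 : (2 <= r)%N by rewrite er.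
have ur := @pullback_unif V 'I_m r phi S.
have := LD V _ hn ur (pullback_Sfree r2 pS) hE; set L := low_degree _ _ _ _ => low.
have L0 v : v \notin L.
  apply/negP => vL; have : part phi (phi v) \subset L.
    apply/subsetP => x; rewrite in_part => /eqP px; move: vL; rewrite !inE.
    suff -> : link (pullback r phi S) x = link (pullback r phi S) v by [].
    by apply/setP => I; rewrite !(pullback_link _ _ _ pS.1) px.
  move=> /subset_leq_card /(dens_le #|V| 1); have := large (phi v); lra.
have V0 : (0 < #|[set: V]|)%N by rewrite cardsT.
have surj i : exists2 v, v \in [set: V] & phi v = i.
  have : (0 < #|part phi i|)%N.
    rewrite lt0n; apply/negP => /eqP p0; have := large i; rewrite p0 /dens mul0r; lra.
  by case/card_gt0P => v; rewrite in_part => /eqP; exists v.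
have [|_ _ bal] := H V _ phi setT S V0 pS surj.
  move=> v _; rewrite cardsT.
  have -> : [set I in link (pullback r phi S) v | I \subset [set: V]] = link (pullback r phi S) v.
    by apply/setP => I; rewrite [LHS]inE subsetT andbT.
  by have := L0 v; rewrite inE -leNgt.
by move=> i; rewrite card_ord; have := bal i; rewrite /part_weight setTI cardsT.
Qed.

(** * Completion and block counts in Steiner systems *)

Section Extensions.
Variable V : finType.
Implicit Types (F : {set {set V}}) (J : {set V}).

Definition extensions F J := [set x | (x \notin J) && (x |: J \in F)].

Lemma sum_extensions k F : unif k F -> (\sum_J #|extensions F J|)%N = (k * #|F|)%N.
Proof.
move=> uF; rewrite -(sum_link uF).
under eq_bigr do rewrite -sum1_card.
under [RHS]eq_bigr do rewrite -sum1_card.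
rewrite (exchange_big_dep predT) //=; apply: eq_bigr => x _; apply: eq_bigl => J; by rewrite !inE.
Qed.

End Extensions.

Section SteinerFamily.
Variables (C : finType) (r : nat) (S : {set {set C}}).
Hypotheses (r3 : (3 <= r)%N) (rC : (r < #|C|)%N) (stS : steiner_family r S).
Implicit Types (T : {set C}) (i j : C).

(** No set of size r-1 is uncovered. *)
Lemma completion T : #|T| = r.-1 -> exists2 i, i \notin T & i |: T \in S.
Proof.
move=> cT; have := in_set0 T; rewrite -stS.2 inE cT eqxx /= => /negbT.
by rewrite negb_forall => /existsP[i]; rewrite negb_imply negbK => /andP[]; exists i.
Qed.

Lemma completion_uniq T i j : i |: T \in S -> j |: T \in S -> i \notin T -> j \notin T -> i = j.
Proof.
move=> iS jS iT jT; apply/eqP; apply: contraT => ij.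
have ne : i |: T != j |: T.
  by apply/negP => /eqP e; have := setU11 i T; rewrite e in_setU1 (negbTE ij) (negbTE iT).
have := stS.1.2 _ _ iS jS ne; have : (#|T| <= #|(i |: T) :&: (j |: T)|)%N.
  by apply: subset_leq_card; rewrite subsetI !subsetUr.
by have := stS.1.1 _ iS; rewrite cardsU1 iT; lia.
Qed.

Lemma extend_set T k : (#|T| <= k)%N -> (k <= #|C|)%N -> exists2 T' : {set C}, T \subset T' & #|T'| = k.
Proof.
move=> Tk kC; have [] := @subset_of_card _ (~: T) (k - #|T|).
  by have := cardsC T; lia.
move=> W WT cW; exists (T :|: W); first exact: subsetUl.
rewrite cardsU cW; have -> : T :&: W = set0.
  by apply/setP => x; rewrite !inE; apply/negP => /andP[xT /(subsetP WT)]; rewrite inE xT.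
rewrite cards0; lia.
Qed.

Lemma pair_in_block i j : exists2 T, T \in S & (i \in T) && (j \in T).
Proof.
have [|T sT cT] := @extend_set [set i; j] r.-1 _ (ltac:(lia)).
  by rewrite cards2; case: (i != j); lia.
have [k kT kS] := completion cT; exists (k |: T) => //.
by rewrite !in_setU1 !(subsetP sT) ?inE ?eqxx ?orbT.
Qed.

Lemma count_blocks_at i : (#|[set T in S | i \in T]| * r.-1)%N = 'C(#|C|.-1, r - 2).
Proof.
have ul : unif r.-1 (link S i) by move=> T; apply: link_unif => T'; exact: stS.1.1.
have <- : #|link S i| = #|[set T in S | i \in T]| by exact: card_link.
rewrite mulnC -(sum_extensions ul) -(cardsC1 i) -cards_draws -sum1_card big_mkcond [RHS]big_mkcond /=.
apply: eq_bigr => J _; rewrite inE; case: ifP => [/andP[Ji /eqP cJ]|no].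
  have iJ : i \notin J by apply/negP => /(subsetP Ji); rewrite !inE eqxx.
  have [|x xiJ xS] := @completion (i |: J); first by rewrite cardsU1 iJ cJ; lia.
  apply/eqP/cards1P; exists x; apply/setP => z; rewrite !inE negb_or.
  have [->|zx] := eqVneq z x.
    by rewrite setUCA xS; move: xiJ; rewrite !inE negb_or iJ [i == x]eq_sym => /andP[-> ->].
  apply/negP => /and3P[zJ /andP[iz _] zS]; rewrite setUCA in zS; move/eqP: zx; apply.
  by apply: (completion_uniq zS xS) => //; rewrite !inE negb_or eq_sym iz.
apply/eqP; rewrite cards_eq0; apply/eqP/setP => z; rewrite [LHS]inE [RHS]inE; apply/negP => /andP[zJ zL].
move: no; rewrite -(eqn_add2l 1) -[(1 + #|J|)%N]/(true + #|J|)%N -zJ -cardsU1 (ul _ zL).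
have -> : (r.-1 == 1 + (r - 2))%N by apply/eqP; lia.
rewrite andbT => /negP; apply; apply/subsetP => w wJ; rewrite !inE; apply/negP => /eqP wi.
by move: zL; rewrite inE => /andP[]; rewrite !inE -wi wJ orbT.
Qed.

End SteinerFamily.

(** * Edges through a pair of large codegree *)

Local Close Scope ring_scope.

(** Each vertex of I spoils at most n^(r-3) of the edges through a and b. *)
Lemma codeg_avoid (V : finType) r (E : {set {set V}}) a b (I : {set V}) : unif r E -> a != b ->
  (r * #|V| ^ (r - 3) < codeg E a b)%N -> (#|I| <= r)%N -> a \notin I -> b \notin I ->
  exists D, [/\ D \in E, a \in D, b \in D & [disjoint I & D]].
Proof.
move=> uE ab lt cI aI bI; set n := #|V| in lt.
have [F0|[D]] := set_0Vmem [set D in E | [&& a \in D, b \in D & [disjoint I & D]]]; last first.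
  by rewrite inE => /and4P[]; exists D; split.
exfalso; move: lt; rewrite ltnNge => /negP; apply.
apply: leq_trans (_ : (#|I| * n ^ (r - 3) <= _)%N); last by rewrite leq_mul2r cI orbT.
rewrite -sum_nat_const.
apply: leq_trans (_ : (\sum_(x in I) #|[set D in E | [set a; b; x] \subset D]| <= _)%N).
  rewrite /codeg -sum1_card (eq_bigr (fun x => \sum_(D in E | [set a; b; x] \subset D) 1)%N); last first.
    by move=> x _; rewrite -sum1_card; apply: eq_bigl => D; rewrite inE.
  rewrite [X in (_ <= X)%N](exchange_big_dep (mem E)) /=; last by move=> x D _ /andP[].
  rewrite (eq_bigl (fun D => (D \in E) && ((a \in D) && (b \in D)))); last by move=> D; rewrite inE.
  rewrite big_mkcondr /=; apply: leq_sum => D DE; case: ifP => // /andP[aD bD].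
  have : D \notin [set D in E | [&& a \in D, b \in D & [disjoint I & D]]] by rewrite F0 inE.
  rewrite inE DE aD bD /= -setI_eq0 => /set0Pn[x]; rewrite inE => /andP[xI xD].
  by rewrite (bigD1 x) //= xI !subUset !sub1set aD bD xD.
apply: leq_sum => x xI.
have c3 : #|[set a; b; x]| = 3%N.
  rewrite setUC cardsU1 !inE negb_or cards2 ab; have -> : x != a by apply: contraNneq aI => <-.
  by have -> : x != b by apply: contraNneq bI => <-.
rewrite -c3; apply: card_containing => D /setIdP[] // DE _; exact: uE.
Qed.

(** * Exchanging vertices between transversals *)

Section Hybrid.
Variables (V : finType) (m : nat) (phi : V -> 'I_m) (U : {set V}) (T : {set 'I_m}).
Local Notation K := (transversals phi U T).
Implicit Types (A B M N e : {set V}).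

Lemma card_parts e : \sum_i #|e :&: part phi i| = #|e|.
Proof.
rewrite -[RHS]sum1_card (partition_big phi xpredT) //=; apply: eq_bigr => i _.
by rewrite -sum1_card; apply: eq_bigl => x; rewrite !inE.
Qed.

(** A transversal meets the parts of T once and the other parts not at all. *)
Lemma transversalsE e : (e \in K) = (e \subset U) && [forall i, #|e :&: part phi i| == (i \in T)].
Proof.
rewrite inE; congr (_ && _); apply/andP/forallP => [[/eqP ce /eqP pe] i|h].
  have inj : {in e &, injective phi} by apply/imset_injP; rewrite ce pe.
  case: (boolP (i \in T)) => iT.
    have /imsetP[x xe ex] : i \in phi @: e by rewrite pe.
    apply/cards1P; exists x; apply/setP => y; rewrite !inE ex.
    apply/andP/eqP => [[ye /eqP]|->]; last by rewrite xe eqxx.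
    exact: inj.
  rewrite cards_eq0; apply/eqP/setP => y; rewrite !inE; apply/negP => /andP[ye /eqP yi].
  by move: iT; rewrite -pe -yi imset_f.
split.
  rewrite -card_parts (eq_bigr (fun i => (i \in T) : nat)); last by move=> i _; exact/eqP.
  by rewrite -sum1_card [X in _ == X]big_mkcond /=; apply/eqP; apply: eq_bigr => i _; case: (i \in T).
apply/eqP/setP => i; have := h i; case: (i \in T) => /eqP hi.
  have : 0 < #|e :&: part phi i| by rewrite hi.
  by case/card_gt0P => x; rewrite inE in_part => /andP[xe /eqP <-]; rewrite imset_f.
apply/negP => /imsetP[x xe ix]; move/eqP: hi; rewrite cards_eq0 => /eqP/setP/(_ x).
by rewrite inE xe in_part ix eqxx inE.
Qed.

(** The elementary move between transversals: the vertex in part i is changed. *)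
Definition exchange i A B := [set x in A | phi x != i] :|: [set x in B | phi x == i].

(** Going from A to B part by part, in the order of the labels. *)
Definition hybrid (k : nat) A B := [set x in A | k <= phi x] :|: [set x in B | phi x < k].

Lemma hybrid0 A B : hybrid 0 A B = A.
Proof. by apply/setP => x; rewrite !inE ltn0 andbF orbF andbT. Qed.

Lemma hybrid_full A B : hybrid m A B = B.
Proof. by apply/setP => x; rewrite !inE leqNgt ltn_ord andbF andbT. Qed.

(** The pair of opposite hybrids determines A and B; this makes the hybrid map injective. *)
Lemma hybridK k A B : hybrid k (hybrid k A B) (hybrid k B A) = A.
Proof. by apply/setP => x; rewrite !inE; case: leqP; case: (x \in A); case: (x \in B). Qed.

Lemma hybrid_in k A B : A \in K -> B \in K -> hybrid k A B \in K.
Proof.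
rewrite !transversalsE => /andP[AU /forallP hA] /andP[BU /forallP hB]; apply/andP; split.
  apply/subsetP => x; rewrite !inE => /orP[/andP[xA _]|/andP[xB _]].
    exact: (subsetP AU).
  exact: (subsetP BU).
apply/forallP => i; have [ki|ik] := leqP k i.
  rewrite -(eqP (hA i)); apply/eqP; apply: eq_card => x; rewrite !inE.
  by case: eqP => [->|_]; rewrite ?andbF // ltnNge ki !andbT andbF orbF.
rewrite -(eqP (hB i)); apply/eqP; apply: eq_card => x; rewrite !inE.
by case: eqP => [->|_]; rewrite ?andbF // leqNgt ik !andbT andbF.
Qed.

Lemma exchange_hybrid (k : 'I_m) A B : exchange k (hybrid k A B) (hybrid k B A) = hybrid k.+1 A B.
Proof.
apply/setP => x; rewrite !inE ltnS -(inj_eq val_inj) /=.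
by case: ltngtP; case: (x \in A); case: (x \in B).
Qed.

Lemma exchange_outside i A B : A \in K -> B \in K -> i \notin T -> exchange i A B = A.
Proof.
rewrite !transversalsE => /andP[_ /forallP /(_ i) hA] /andP[_ /forallP /(_ i) hB] /negbTE iT.
move: hA hB; rewrite iT !cards_eq0 => /eqP/setP hA /eqP/setP hB.
apply/setP => x; have := hA x; have := hB x; rewrite !inE.
by case: eqP; rewrite ?andbT ?andbF ?orbF // => _ -> ->.
Qed.

(** For A in X and B outside X, the hybrids lead from A to B, so some step leaves X.  The pair of
    opposite hybrids at this step is an element of X together with a transversal whose exchange
    leaves X, and it determines A and B. *)
Lemma hybrid_count (X : {set {set V}}) : X \subset K ->
  #|X| * #|K :\: X| <= \sum_(A in X) \sum_(x in A) #|[set B in K | exchange (phi x) A B \notin X]|.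
Proof.
move=> XK.
pose P (k : 'I_m) := [set p : {set V} * {set V} | [&& p.1 \in X, p.2 \in K :\: X, hybrid k p.1 p.2 \in X & hybrid k.+1 p.1 p.2 \notin X]].
pose H (k : 'I_m) := [set p : {set V} * {set V} | [&& p.1 \in X, p.2 \in K & exchange k p.1 p.2 \notin X]].
have step1 : #|X| * #|K :\: X| <= \sum_k #|P k|.
  rewrite -cardsX.
  apply: leq_trans (_ : #|\bigcup_k P k| <= _); last first.
    elim/big_rec2: _ => [|i x A _ h]; first by rewrite cards0.
    by apply: leq_trans (leq_card_setU _ _) _; rewrite leq_add2l.
  apply: subset_leq_card; apply/subsetP => -[M N] /setXP[/= MX NX].
  have [j [jm j1 j2]] : exists j, [/\ j < m, hybrid j M N \in X & hybrid j.+1 M N \notin X].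
    have hm : exists j, hybrid j M N \notin X by exists m; rewrite hybrid_full; move: NX; rewrite inE => /andP[].
    case: (ex_minnP hm) => -[|j] jX jmin; first by rewrite hybrid0 MX in jX.
    exists j; split=> //.
      rewrite -ltnS; apply: leq_trans (ltnSn _); apply: jmin; rewrite hybrid_full; by move: NX; rewrite inE => /andP[].
    by apply/negPn/negP => /jmin; rewrite ltnn.
  by apply/bigcupP; exists (Ordinal jm); rewrite // inE /= MX NX j1.
have step2 k : #|P k| <= #|H k|.
  rewrite -(@card_in_imset _ _ (fun p : {set V} * {set V} => (hybrid k p.1 p.2, hybrid k p.2 p.1))) => [|[M N] [M' N'] _ _ /= [e1 e2]]; last first.
    by congr (_, _); [rewrite -(hybridK k M N) e1 e2 hybridK | rewrite -(hybridK k N M) e1 e2 hybridK].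
  apply: subset_leq_card; apply/subsetP => p /imsetP[[M N]]; rewrite inE /= => /and4P[MX NX h1 h2] ->.
  rewrite inE /= h1 exchange_hybrid h2 andbT; apply: hybrid_in; last exact: (subsetP XK).
  by move: NX; rewrite inE => /andP[].
apply: leq_trans step1 _; apply: (@leq_trans (\sum_k #|H k|)); first by apply: leq_sum => k _; exact: step2.
rewrite (eq_bigr (fun k => \sum_(A in X) #|[set B in K | exchange k A B \notin X]|)); last first.
  move=> k _; rewrite -sum1_card.
  rewrite (eq_bigl (fun p => (p.1 \in X) && (p.2 \in [set B in K | exchange k p.1 B \notin X]))); last first.
    by move=> p; rewrite !inE.
  rewrite -(pair_big_dep (mem X) (fun A B => B \in [set B in K | exchange k A B \notin X]) (fun _ _ => 1)) /=.
  by apply: eq_bigr => A _; rewrite sum1_card.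
rewrite exchange_big /=; apply: leq_sum => A AX.
have AK := subsetP XK A AX.
have /and3P[_ /eqP cA /eqP pA] : [&& A \subset U, #|A| == #|T| & phi @: A == T] by move: AK; rewrite inE.
have inj : {in A &, injective phi} by apply/imset_injP; rewrite cA pA.
rewrite -(big_imset (fun i => #|[set B in K | exchange i A B \notin X]|) inj) /= pA.
rewrite (bigID (mem T)) /= [X in _ + X <= _]big1 ?addn0 // => i iT.
apply/eqP; rewrite cards_eq0; apply/eqP/setP => B; rewrite [LHS]inE [RHS]inE; apply/negP => /andP[BK].
by rewrite (exchange_outside AK BK iT) AX.
Qed.

End Hybrid.

(** * The local structure near a blow-up *)

Local Open Scope ring_scope.

Lemma ler_expr_min (x : rat) i j : 0 <= x -> x <= 1 -> (i <= j)%N -> x ^+ j <= x ^+ i.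
Proof. by move=> x0 x1 ij; exact: ler_wiXn2l. Qed.

Lemma eq_refl_le (x y : rat) : x = y -> x <= y.
Proof. by move=> ->. Qed.

Section ClassLink.
Variables (V C : finType) (r : nat) (S : {set {set C}}) (phi : V -> C).

(** The common link, in the blow-up of S along phi, of the vertices of part i. *)
Definition class_link i : {set {set V}} :=
  [set I : {set V} | [&& #|I| == r.-1, i \notin phi @: I & i |: phi @: I \in S]].

Lemma link_pullback v : (0 < r)%N -> packing r S -> link (pullback r phi S) v = class_link (phi v).
Proof. by move=> r0 pS; apply/setP => I; rewrite (pullback_link _ _ _ pS.1) inE r0 andbT. Qed.

Lemma transversals_class_link T i (U : {set V}) : unif r S -> T \in S -> i \in T ->
  transversals phi U (T :\ i) \subset class_link i.
Proof.
move=> ur TS iT; apply/subsetP => I; rewrite !inE => /and3P[_ /eqP cI /eqP pI].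
by rewrite pI setD11 setD1K // TS andbT cI -(ur T TS) (cardsD1 i T) iT add1n eqxx.
Qed.

End ClassLink.

Section Local.
Variables (V : finType) (r m : nat) (S : {set {set 'I_m}}) (phi : V -> 'I_m) (E : {set {set V}}) (U : {set V}).
Hypotheses (r3 : (3 <= r)%N) (rm : (r < m)%N) (stS : steiner_family r S).
Hypotheses (uE : unif r E) (tE : Tfree E) (n0 : (0 < #|V|)%N).
Local Notation n := #|V|.
Local Notation K := (pullback r phi S).

(** The sizes of the parts lie between lam n and up n, and U consists of the good vertices, those
    whose link misses at most beta n^(r-1) members of the link of their part. *)
Variables (lam beta up : rat).
Hypotheses (lam0 : 0 < lam) (lam1 : lam <= 1).
Hypothesis low_part : forall i, lam <= dens n 1 #|part phi i|.
Hypothesis up_part : forall i, dens n 1 #|part phi i| <= up.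
Hypothesis few_missing : forall v, v \in U -> dens n r.-1 #|class_link r S phi (phi v) :\: link E v| <= beta.
Hypothesis beta0 : 0 <= beta.
Hypothesis beta_small : beta <= lam ^+ r / 8.
Hypothesis n_large : dens n 1 r <= lam ^+ r / 4.
Local Notation cl := (class_link r S phi).

Let rC : (r < #|'I_m|)%N. Proof. by rewrite card_ord. Qed.
Let uS : unif r S. Proof. exact: stS.1.1. Qed.
Let r23 : (r - 2 = 1 + (r - 3))%N. Proof. by case: (r) r3 => [|[|[|k]]] // _; rewrite !subSS !subn0. Qed.
Let r12 : r.-1 = (r - 2).+1. Proof. by case: (r) r3 => [|[|k]] // _; rewrite !subSS subn0. Qed.
Let r0 : (0 < r)%N. Proof. exact: leq_trans r3. Qed.
Let kap0 : 0 < lam ^+ r. Proof. exact: exprn_gt0. Qed.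

Lemma dens_transversals_ge (T : {set 'I_m}) : lam ^+ #|T| <= dens n #|T| #|transversals phi setT T|.
Proof.
rewrite card_transversals -dens_prod -prodr_const; apply: ler_prod => i _.
by rewrite setTI low_part ltW.
Qed.

Lemma dens_transversals_le (T : {set 'I_m}) : dens n #|T| #|transversals phi setT T| <= up ^+ #|T|.
Proof.
rewrite card_transversals -dens_prod -prodr_const; apply: ler_prod => i _.
by rewrite setTI up_part dens_ge0.
Qed.

Lemma dens_class_link_ge i : lam ^+ r <= dens n r.-1 #|cl i|.
Proof.
have [T TS /andP[iT _]] := pair_in_block r3 rC stS i i.
have cT : #|T :\ i| = r.-1 by rewrite -(uS TS) (cardsD1 i T) iT.
apply: le_trans (dens_le _ _ (subset_leq_card (transversals_class_link phi setT uS TS iT))).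
rewrite -cT; apply: le_trans (dens_transversals_ge _); rewrite cT.
by apply: ler_expr_min => //; [exact: ltW | lia].
Qed.

(** Here and below an edge D is fixed, and only O(n^(r-2)) sets of size r-1 meet it. *)
Lemma dens_meeting_edge (F : {set {set V}}) (D : {set V}) : D \in E -> (forall I, I \in F -> #|I| = r.-1) ->
  (forall I, I \in F -> ~~ [disjoint I & D]) -> dens n r.-1 #|F| <= dens n 1 r.
Proof. move=> DE h1 h2; have := @dens_meeting V F r.-1 D n0 _ h1 h2; rewrite (uE DE); apply; lia. Qed.

(** Nearly all sets in the link of their part are in both links, and all but few of them avoid the
    edge D; such a set and D form a generalized triangle. *)
Lemma same_part_nonadjacent a b (D : {set V}) : a \in U -> b \in U -> a != b -> phi a = phi b ->
  D \in E -> a \in D -> b \in D -> False.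
Proof.
move=> aU bU ab pab DE aD bD.
pose F := [set I in cl (phi a) | ~~ [disjoint I & D]].
have sub : cl (phi a) \subset ((cl (phi a) :\: link E a) :|: (cl (phi b) :\: link E b)) :|: F.
  apply/subsetP => I Ia; rewrite !in_setU !in_setD -pab Ia !andbT [I \in F]inE Ia /=.
  apply/negPn/negP; rewrite !negb_or !negbK => /andP[/andP[Ila Ilb] dis].
  move: Ila Ilb; rewrite !inE => /andP[aI aIE] /andP[bI bIE].
  exact: (tE aIE bIE DE aI bI ab aD bD dis).
have := dens_le n r.-1 (subset_leq_card sub).
have h1 : (#|(cl (phi a) :\: link E a) :|: (cl (phi b) :\: link E b) :|: F| <= #|cl (phi a) :\: link E a| + #|cl (phi b) :\: link E b| + #|F|)%N.
  by apply: leq_trans (leq_card_setU _ _) _; rewrite leq_add2r; exact: leq_card_setU.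
have := dens_le n r.-1 h1; rewrite !densD.
have h2 : dens n r.-1 #|F| <= dens n 1 r.
  apply: (dens_meeting_edge DE) => I /setIdP[] //.
  by rewrite inE => /and3P[/eqP].
have := few_missing aU; have := few_missing bU; have := dens_class_link_ge (phi a).
move: beta_small n_large kap0 h2; set k := lam ^+ r; clear pab => *; lra.
Qed.

(** For b in another part and outside this set, any r vertices other than a and b are avoided by
    some edge through a and b, so a and b cannot both complete the same set of size r-1 to an
    edge. *)
Definition poor a := [set b | (phi b != phi a) && (codeg E a b <= r * n ^ (r - 3))%N].

Lemma rich_avoid a b (I : {set V}) : phi b != phi a -> b \notin poor a -> (#|I| <= r)%N -> a \notin I -> b \notin I ->
  exists D, [/\ D \in E, a \in D, b \in D & [disjoint I & D]].
Proof.
move=> pab; rewrite inE pab /= -ltnNge => lt cI aI bI.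
by apply: (codeg_avoid uE) => //; apply: contraNneq pab => ->.
Qed.

Definition rho : rat := 2 * r%:R * beta / lam ^+ r.

Lemma rho_ge0 : 0 <= rho.
Proof. by rewrite divr_ge0 ?mulr_ge0 // ltW. Qed.

(** For a poor b nearly all of the edges of the blow-up through a and b, of which there are at
    least lam^(r-2) n^(r-2), are missing, while at most beta n^(r-1) edges of the blow-up through
    a are missing. *)
Lemma dens_poor a : a \in U -> dens n 1 #|poor a| <= rho.
Proof.
move=> aU; pose M := K :\: E.
have uK := @pullback_unif V 'I_m r phi S.
have uM : unif r M by move=> e /setDP[/uK].
have lM : link M a = cl (phi a) :\: link E a.
  rewrite -(link_pullback phi a (ltnW (ltnW r3)) stS.1); apply/setP => I; rewrite !inE.
  by case: (a \in I) => //=; rewrite andbC.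
have step b : b \in poor a -> lam ^+ (r - 2) - dens n 1 r <= dens n (r - 2) (codeg M a b).
  rewrite inE => /andP[pab few].
  have [T TS /andP[aT bT]] := pair_in_block r3 rC stS (phi a) (phi b).
  have cT : #|T :\ phi a :\ phi b| = (r - 2)%N.
    have := uS TS; rewrite (cardsD1 (phi a) T) aT (cardsD1 (phi b) (T :\ phi a)) !inE pab bT; lia.
  have inj : (#|transversals phi setT (T :\ phi a :\ phi b)| <= codeg K a b)%N.
    pose g (J : {set V}) := a |: (b |: J).
    have nin J : J \in transversals phi setT (T :\ phi a :\ phi b) -> (a \notin J) * (b \notin J) * (a \notin b |: J).
      rewrite inE => /and3P[_ _ /eqP pJ].
      have aJ : a \notin J.
        apply/negP => h; have : phi a \in phi @: J by exact: imset_f.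
        by rewrite pJ !inE eqxx andbF.
      have bJ : b \notin J.
        apply/negP => h; have : phi b \in phi @: J by exact: imset_f.
        by rewrite pJ !inE eqxx.
      rewrite aJ bJ in_setU1 negb_or aJ andbT; split => //.
      by apply: contraNneq pab => ->.
    rewrite -(@card_in_imset _ _ g) => [|J J' hJ hJ' e]; last first.
      by rewrite -(setU1K (nin J hJ).1.2) -(setU1K (nin J hJ).2) -/(g J) e /g (setU1K (nin J' hJ').2) (setU1K (nin J' hJ').1.2).
    apply: subset_leq_card; apply/subsetP => e /imsetP[J hJ ->].
    rewrite !inE !eqxx orbT /= andbT cardsU1 (nin J hJ).2 cardsU1 (nin J hJ).1.2 !imsetU1.
    move: hJ; rewrite inE cT => /and3P[_ /eqP -> /eqP ->].
    have -> : phi a |: (phi b |: (T :\ phi a) :\ phi b) = T.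
      by rewrite (setD1K (_ : phi b \in T :\ phi a)) ?setD1K // !inE pab.
    rewrite TS andbT; apply/eqP; lia.
  have sub : (codeg K a b <= codeg M a b + codeg E a b)%N.
    apply: leq_trans (leq_card_setU _ _); apply: subset_leq_card; apply/subsetP => D.
    rewrite !inE => /and3P[-> -> ->]; rewrite !andbT; by case: (D \in E).
  have l1 := dens_transversals_ge (T :\ phi a :\ phi b); rewrite cT in l1.
  have l2 := dens_le n (r - 2) inj.
  have l3 := dens_le n (r - 2) sub; rewrite densD in l3.
  have l4 := dens_le n (r - 2) few.
  have l5 : dens n (r - 2) (r * n ^ (r - 3)) = dens n 1 r.
    by rewrite r23 densXpow.
  lra.
have tot : (\sum_(b in poor a) codeg M a b <= r * #|link M a|)%N.
  rewrite mulnC card_link -sum_nat_const.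
  apply: leq_trans (_ : (\sum_(b in poor a) \sum_(D in [set D in M | a \in D] | b \in D) 1 <= _)%N).
    apply: leq_sum => b _; rewrite /codeg -sum1_card; apply: eq_leq; apply: eq_bigl => D.
    by rewrite !inE -!andbA.
  rewrite (exchange_big_dep (mem [set D in M | a \in D])) /=; last by move=> b D _ /andP[].
  apply: leq_sum => D DM; rewrite sum1dep_card; have /setIdP[DM' _] := DM; rewrite -(uM D DM').
  by apply: subset_leq_card; apply/subsetP => b; rewrite !inE => /andP[_ /andP[]].
have t1 := dens_le n r.-1 tot.
have t2 : dens n r.-1 (\sum_(b in poor a) codeg M a b) >= dens n 1 #|poor a| * (lam ^+ (r - 2) - dens n 1 r).
  rewrite dens_sum.
  have -> : dens n 1 #|poor a| * (lam ^+ (r - 2) - dens n 1 r) = \sum_(b in poor a) n%:R^-1 * (lam ^+ (r - 2) - dens n 1 r).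
    by rewrite sumr_const -[RHS]mulr_natl /dens expr1 mulrA.
  apply: ler_sum => b /step h.
  have -> : dens n r.-1 (codeg M a b) = n%:R^-1 * dens n (r - 2) (codeg M a b).
    by rewrite /dens r12 exprS invfM mulrCA.
  by apply: ler_wpM2l => //; rewrite invr_ge0 ler0n.
have t3 : dens n r.-1 (r * #|link M a|) <= r%:R * beta.
  rewrite /dens natrM -mulrA; apply: ler_wpM2l; first exact: ler0n.
  by have := few_missing aU; rewrite -lM.
have l1 : lam ^+ r <= lam ^+ (r - 2) by apply: ler_expr_min; [exact: ltW | | lia].
have t4 : dens n 1 #|poor a| * (lam ^+ r / 2) <= r%:R * beta.
  apply: le_trans (_ : dens n 1 #|poor a| * (lam ^+ (r - 2) - dens n 1 r) <= _); last by lra.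
  apply: ler_wpM2l; first exact: dens_ge0.
  move: n_large kap0 l1; set k := lam ^+ r; lra.
rewrite /rho ler_pdivlMr //.
move: t4; set x := dens n 1 _; set k := lam ^+ r; lra.
Qed.

Lemma edge_part_inj D : D \in E -> D \subset U -> {in D &, injective phi}.
Proof.
move=> DE DU x y xD yD pxy; apply/eqP; apply: contraT => xy; exfalso.
by apply: (same_part_nonadjacent _ _ xy pxy DE) => //; apply: (subsetP DU).
Qed.

Lemma link_part_inj v I : I \in link E v -> I \subset U -> {in I &, injective phi}.
Proof.
rewrite inE => /andP[vI DE] IU x y xI yI pxy; apply/eqP; apply: contraT => xy; exfalso.
apply: (same_part_nonadjacent _ _ xy pxy DE); rewrite ?in_setU1 ?xI ?yI ?orbT //; exact: (subsetP IU).
Qed.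

Lemma link_in_class v I : I \in link E v -> I \subset U -> exists i, I \in cl i.
Proof.
move=> Iv IU; have cI := link_unif uE Iv.
have cp : #|phi @: I| = r.-1 by rewrite card_in_imset //; exact: link_part_inj Iv IU.
have [i ip iS] := completion stS cp; exists i.
by rewrite inE cI eqxx ip iS.
Qed.

Section Vertex.
Variable v : V.
Hypothesis few_outside : dens n 1 #|~: U| <= beta.

(** Part i contains a good vertex that lies in a common edge with v. *)
Definition adjacent i := [exists u in U, (phi u == i) && [exists D in E, [&& u \in D, v \in D & u != v]]].

Lemma adjacentP u D : u \in U -> D \in E -> u \in D -> v \in D -> u != v -> adjacent (phi u).
Proof.
move=> uU DE uD vD uv; apply/existsP; exists u; rewrite uU eqxx /=.
by apply/existsP; exists D; rewrite DE uD vD uv.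
Qed.

(** If u is a vertex of part i in an edge D with v, a set in both links that avoids D would give a
    generalized triangle; so the link of v misses nearly all of the link of u. *)
Lemma adjacent_class i : adjacent i -> dens n r.-1 #|link E v :&: cl i| <= beta + dens n 1 r.
Proof.
case/existsP => u /andP[uU /andP[/eqP pu /existsP[D /and4P[DE uD vD uv]]]].
have sub : link E v :&: cl i \subset (cl (phi u) :\: link E u) :|: [set I in link E v | ~~ [disjoint I & D]].
  apply/subsetP => I /setIP[Iv Ii]; rewrite in_setU in_setD pu Ii andbT [I \in finset _]inE Iv /=.
  apply/negPn/negP; rewrite negb_or !negbK => /andP[Iu dis].
  move: Iv Iu; rewrite !inE => /andP[vI vIE] /andP[uI uIE].
  exact: (tE uIE vIE DE uI vI uv uD vD dis).
apply: le_trans (dens_le _ _ (subset_leq_card sub)) _.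
apply: le_trans (dens_le _ _ (leq_card_setU _ _)) _; rewrite densD; apply: lerD; first exact: few_missing.
apply: (dens_meeting_edge DE) => I /setIdP[] // Iv _; exact: link_unif Iv.
Qed.

Definition err : rat := beta + m%:R * (beta + dens n 1 r).

(** The members of the link of v that are not accounted for by adjacent parts. *)
Definition free_link := [set I in link E v | (I \subset U) && [exists i, ~~ adjacent i && (I \in cl i)]].

Lemma dens_link_free_link : dens n r.-1 #|link E v| <= err + dens n r.-1 #|free_link|.
Proof.
pose F1 := [set I in link E v | ~~ (I \subset U)].
have sub : link E v \subset (F1 :|: \bigcup_(i | adjacent i) (link E v :&: cl i)) :|: free_link.
  apply/subsetP => I Iv; rewrite !in_setU [I \in F1]inE [I \in free_link]inE Iv /=.
  case: (boolP (I \subset U)) => //= IU.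
  have [i Ii] := link_in_class Iv IU; case: (boolP (adjacent i)) => ai.
    by apply/orP; left; apply/bigcupP; exists i => //; rewrite inE Iv.
  by apply/orP; right; apply/existsP; exists i; rewrite ai.
apply: le_trans (dens_le _ _ (subset_leq_card sub)) _.
apply: le_trans (dens_le _ _ (leq_card_setU _ _)) _; rewrite densD lerD2r.
apply: le_trans (dens_le _ _ (leq_card_setU _ _)) _; rewrite densD; apply: lerD.
  apply: le_trans few_outside; apply: dens_meeting => //; first by rewrite r12.
    by move=> I /setIdP[Iv _]; exact: link_unif Iv.
  by move=> I /setIdP[_]; apply: contra; rewrite disjoints_subset setCK.
apply: le_trans (_ : dens n r.-1 (\sum_(i | adjacent i) #|link E v :&: cl i|) <= _).
  apply: dens_le; elim/big_rec2: _ => [|i x A _ h]; first by rewrite cards0.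
  by apply: leq_trans (leq_card_setU _ _) _; rewrite leq_add2l.
rewrite dens_sum; apply: le_trans (_ : \sum_(i : 'I_m) (beta + dens n 1 r) <= _).
  rewrite big_mkcond; apply: ler_sum => i _; case: ifP => [/adjacent_class //|_].
  by rewrite addr_ge0 // dens_ge0.
by rewrite sumr_const card_ord mulr_natl.
Qed.

Lemma free_link_adjacent I x : I \in free_link -> x \in I -> adjacent (phi x).
Proof.
rewrite inE => /andP[Iv /andP[IU _]] xI; move: Iv; rewrite inE => /andP[vI DE].
apply: (adjacentP (subsetP IU x xI) DE); rewrite ?setU11 ?in_setU1 ?xI ?orbT //.
by apply: contraNneq vI => <-.
Qed.

Lemma free_link_nbrs J x y : x |: J \in free_link -> y |: J \in free_link -> x \notin J -> y \notin J ->
  phi y != phi x -> y \in poor x.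
Proof.
move=> xZ yZ xJ yJ pxy; apply: contraT => np.
have /setIdP[xL /andP[xU _]] := xZ; have /setIdP[yL /andP[yU _]] := yZ.
move: (xL) (yL); rewrite !inE => /andP[vxJ xE] /andP[vyJ yE].
have xvJ : x \notin v |: J.
  by move: vxJ; rewrite !in_setU1 !negb_or eq_sym xJ => /andP[-> _].
have yvJ : y \notin v |: J.
  by move: vyJ; rewrite !in_setU1 !negb_or eq_sym yJ => /andP[-> _].
have cJ : (#|v |: J| <= r)%N.
  have := link_unif uE xL; rewrite cardsU1 xJ add1n => cJ.
  by apply: leq_trans (leq_pred r); rewrite -cJ cardsU1; case: (_ \notin _) => //; exact: leqnSn.
have [D [DE xD yD dis]] := rich_avoid pxy np cJ xvJ yvJ.
have xy : x != y by apply: contraNneq pxy => ->.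
exfalso; apply: (tE (I := v |: J) (a := x) (b := y) (D := D)) => //; by rewrite setUCA.
Qed.

(** With two nonadjacent parts, a set J of size r-2 inside a member of the free link is a
    transversal of r-2 of the m-2 other parts, and its extensions in the free link lie in one part
    up to poor vertices.  This is a smaller count than the degree of a vertex in the blow-up. *)
Lemma dens_free_link i j : i != j -> ~~ adjacent i -> ~~ adjacent j ->
  r.-1%:R * dens n r.-1 #|free_link| <= 'C(m - 2, r - 2)%:R * up ^+ (r - 2) * (up + rho).
Proof.
move=> ij ai aj; have uZ : unif r.-1 free_link.
  by move=> I /setIdP[Iv _]; exact: link_unif Iv.
pose X := [set T : {set 'I_m} | (T \subset ~: [set i; j]) && (#|T| == r - 2)%N].
have cX : #|X| = 'C(m - 2, r - 2).
  rewrite cards_draws; congr ('C(_, _)); by have := cardsC [set i; j]; rewrite cards2 ij card_ord => /(congr1 (subn^~ 2)); rewrite addKn.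
pose JJ := \bigcup_(T in X) transversals phi setT T.
have up0 : 0 <= up by apply: le_trans (up_part i); exact: dens_ge0.
have cJJ : dens n (r - 2) #|JJ| <= 'C(m - 2, r - 2)%:R * up ^+ (r - 2).
  apply: le_trans (_ : dens n (r - 2) (\sum_(T in X) #|transversals phi setT T|) <= _).
    apply: dens_le; rewrite /JJ; elim/big_rec2: _ => [|T x A _ h]; first by rewrite cards0.
    by apply: leq_trans (leq_card_setU _ _) _; rewrite leq_add2l.
  rewrite dens_sum -cX mulr_natl -sumr_const; apply: ler_sum => T; rewrite inE => /andP[_ /eqP cT].
  by have := dens_transversals_le T; rewrite cT.
have nbr J : dens n 1 #|extensions free_link J| <= (up + rho) * (J \in JJ)%:R.
  have [->|[x]] := set_0Vmem (extensions free_link J).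
    rewrite cards0 {1}/dens mul0r mulr_ge0 ?ler0n // addr_ge0 // rho_ge0 //.
  rewrite inE => /andP[xJ xZ].
  have -> : J \in JJ.
    have [Iv /andP[IU _]] := setIdP xZ.
    have inj := link_part_inj Iv IU.
    have cI := uZ _ xZ; rewrite cardsU1 xJ add1n r12 in cI; case: cI => cJ.
    have cpJ : #|phi @: J| = (r - 2)%N.
      by rewrite card_in_imset // => z w zJ wJ; apply: inj; rewrite in_setU1 ?zJ ?wJ orbT.
    apply/bigcupP; exists (phi @: J); last by rewrite inE subsetT cJ cpJ !eqxx.
    rewrite inE cpJ eqxx andbT; apply/subsetP => t /imsetP[z zJ ->].
    have az : adjacent (phi z) by apply: (free_link_adjacent xZ); rewrite in_setU1 zJ orbT.
    by rewrite !inE negb_or; apply/andP; split; [apply: contraNneq ai => <- | apply: contraNneq aj => <-].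
  rewrite mulr1.
  have sub : extensions free_link J \subset part phi (phi x) :|: poor x.
    apply/subsetP => y /setIdP[yJ yZ]; rewrite in_setU in_part.
    by case: (boolP (phi y == phi x)) => //= pyx; apply: (free_link_nbrs xZ yZ).
  have xU : x \in U.
    have /setIdP[_ /andP[IU _]] := xZ; by apply: (subsetP IU); rewrite setU11.
  apply: le_trans (dens_le _ _ (subset_leq_card sub)) _.
  apply: le_trans (dens_le _ _ (leq_card_setU _ _)) _; rewrite densD.
  by apply: lerD; [exact: up_part | exact: dens_poor].
have -> : r.-1%:R * dens n r.-1 #|free_link| = dens n (1 + (r - 2)) (\sum_J #|extensions free_link J|).
  by rewrite (sum_extensions uZ) add1n -r12 /dens natrM mulrA.
rewrite dens_sum; apply: le_trans (_ : \sum_(J : {set V}) n%:R ^- (r - 2) * ((up + rho) * (J \in JJ)%:R) <= _).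
  apply: ler_sum => J _.
  have -> : dens n (1 + (r - 2)) #|extensions free_link J| = n%:R ^- (r - 2) * dens n 1 #|extensions free_link J|.
    by rewrite /dens exprD invfM mulrCA [_ ^- _ * _]mulrC mulrCA mulrA.
  by apply: ler_wpM2l (nbr J); rewrite invr_ge0 exprn_ge0 ?ler0n.
rewrite -mulr_sumr -mulr_sumr.
have -> : \sum_(J : {set V}) (J \in JJ)%:R = #|JJ|%:R :> rat.
  by rewrite -sum1_card natr_sum [RHS]big_mkcond /=; apply: eq_bigr => J _; case: (J \in JJ).
rewrite mulrCA [X in X <= _]mulrC [_ ^- _ * _]mulrC.
by apply: ler_wpM2r cJJ; rewrite addr_ge0 // rho_ge0.
Qed.

Variable t : rat.
Hypothesis large_degree : t <= dens n r.-1 #|link E v|.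
Hypothesis t_err : err < t.
Hypothesis t_free : 'C(m - 2, r - 2)%:R * up ^+ (r - 2) * (up + rho) < r.-1%:R * (t - err).

(** A vertex of large degree is adjacent to all parts but one: with no nonadjacent part the free
    link is empty, and with two it is too small by the preceding count.  The part that is left is
    the right one for v. *)
Lemma vertex_class : exists i, dens n r.-1 #|cl i :\: link E v| <= dens n r.-1 #|cl i| - t + err.
Proof.
have base := dens_link_free_link; have te := t_err; have tf := t_free; have ld := large_degree.
have [N0|[i]] := set_0Vmem [set i | ~~ adjacent i].
  have Z0 : free_link = set0.
    apply/setP => I; rewrite [LHS]inE [RHS]inE; apply/negP => /andP[_ /andP[_ /existsP[i /andP[ai _]]]].
    by have := in_set0 i; rewrite -N0 inE ai.
  exfalso; move: base; rewrite Z0 cards0 [dens _ _ 0]/dens mul0r; lra.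
rewrite inE => ai.
have [/existsP[j /andP[ji aj]]|no] := boolP [exists j, (j != i) && ~~ adjacent j].
  exfalso; have := dens_free_link ji aj ai => h.
  have : r.-1%:R * (t - err) <= r.-1%:R * dens n r.-1 #|free_link|.
    by apply: ler_wpM2l; [exact: ler0n | lra].
  lra.
exists i.
have sub : free_link \subset cl i :&: link E v.
  apply/subsetP => I /setIdP[Iv /andP[_ /existsP[j /andP[aj Ij]]]]; rewrite inE Iv andbT.
  have [<- //|ji] := eqVneq j i; move/negP: no; case; apply/existsP; exists j; by rewrite ji aj.
have := dens_le n r.-1 (subset_leq_card sub).
have : dens n r.-1 #|cl i| = dens n r.-1 #|cl i :&: link E v| + dens n r.-1 #|cl i :\: link E v|.
  by rewrite -densD cardsID.
lra.
Qed.

End Vertex.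

Section Exactness.
Variable lo : rat.
Hypotheses (lo0 : 0 < lo) (low_U : forall i, lo <= dens n 1 #|U :&: part phi i|).
Hypothesis up_lo : up + rho <= (1 + (4 * r%:R)^-1) * (lo - rho).
Hypothesis beta_lo : beta + r%:R * rho <= lo ^+ r / 4.

(** Edges within the set U of good vertices. *)
Definition inside (A : {set {set V}}) := [set e in A | e \subset U].
Definition bad := inside E :\: K.
Definition missing := inside K :\: E.

(** The faces of bad edges. *)
Definition bad_traces := [set I | extensions bad I != set0].

Lemma trace_poor (I : {set V}) a b : a |: I \in E -> b |: I \in E -> a \notin I -> b \notin I ->
  phi b != phi a -> b \in poor a.
Proof.
move=> aE bE aI bI pab; apply: contraT => np.
have cI : (#|I| <= r)%N by rewrite -(uE aE) cardsU1 aI leq_addl.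
have [D [DE aD bD dis]] := rich_avoid pab np cI aI bI.
have ab : a != b by apply: contraNneq pab => ->.
exfalso; exact: (tE aE bE DE aI bI ab aD bD dis).
Qed.

Lemma badP a (I : {set V}) : a \notin I -> a |: I \in bad ->
  [/\ a |: I \in E, a \in U, I \subset U, {in a |: I &, injective phi} & phi a |: phi @: I \notin S].
Proof.
move=> aI /setDP[/setIdP[aE aU] nK]; have inj := edge_part_inj aE aU.
move: (aU); rewrite subUset sub1set => /andP[aU' IU]; split=> //.
by move: nK; rewrite inE (uE aE) eqxx imsetU1.
Qed.

(** The bad extensions of I lie in one part up to poor vertices.  The part j that completes phi(I)
    to a block is another one, so up to poor vertices all vertices of part j are missing
    extensions. *)
Lemma bad_extensions (I : {set V}) : I \in bad_traces ->
  #|extensions bad I|%:R <= (1 + (4 * r%:R)^-1) * #|extensions missing I|%:R :> rat.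
Proof.
rewrite inE => /set0Pn[a]; rewrite inE => /andP[aI abad].
have [aE aU IU inj aS] := badP aI abad.
have n0' : 0 < n%:R :> rat by rewrite ltr0n.
have r4 : 0 < 4 * r%:R :> rat by rewrite mulr_gt0 // ltr0n.
have b1 : dens n 1 #|extensions bad I| <= up + rho.
  have sub : extensions bad I \subset part phi (phi a) :|: poor a.
    apply/subsetP => b; rewrite inE => /andP[bI /(badP bI)[bE _ _ _ _]]; rewrite in_setU in_part.
    by case: (boolP (phi b == phi a)) => //= pba; apply: (trace_poor aE bE aI bI pba).
  apply: le_trans (dens_le _ _ (subset_leq_card sub)) _.
  apply: le_trans (dens_le _ _ (leq_card_setU _ _)) _; rewrite densD.
  by apply: lerD; [exact: up_part | exact: dens_poor].
have cI : #|I| = r.-1 by rewrite -(uE aE) cardsU1 aI.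
have cp : #|phi @: I| = r.-1.
  by rewrite card_in_imset // => x y xI yI; apply: inj; rewrite in_setU1 ?xI ?yI orbT.
have [j jI jS] := completion stS cp.
have ja : j != phi a by apply: contraNneq aS => <-.
have b2 : lo - rho <= dens n 1 #|extensions missing I|.
  have sub : U :&: part phi j \subset extensions missing I :|: poor a.
    apply/subsetP => u; rewrite inE in_part => /andP[uU /eqP pu]; rewrite in_setU.
    have uI : u \notin I by apply: contra jI => uI; rewrite -pu imset_f.
    have [uE'|nE] := boolP (u |: I \in E).
      by rewrite (trace_poor aE uE' aI uI) ?orbT // pu.
    apply/orP; left; rewrite inE uI inE nE /= inE subUset sub1set uU IU andbT.
    by rewrite inE cardsU1 uI cI imsetU1 pu jS andbT add1n prednK ?eqxx.
  have := le_trans (low_U j) (dens_le _ _ (subset_leq_card sub)).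
  move=> h; have := le_trans h (dens_le _ _ (leq_card_setU _ _)); rewrite densD.
  have := dens_poor aU; set x := dens _ _ _; set y := dens _ _ _; lra.
have b3 : dens n 1 #|extensions bad I| <= (1 + (4 * r%:R)^-1) * dens n 1 #|extensions missing I|.
  apply: le_trans b1 _; apply: le_trans up_lo _; apply: ler_wpM2l b2.
  by rewrite addr_ge0 // invr_ge0 ltW.
have e (x : nat) : x%:R = n%:R * dens n 1 x :> rat by rewrite /dens expr1 mulrC divfK // gt_eqF.
rewrite (e #|extensions bad I|) (e #|extensions missing I|) [X in _ <= X]mulrCA.
by apply: ler_wpM2l => //; exact: ltW.
Qed.

Lemma missing_unif : unif r missing.
Proof. by move=> e /setDP[/setIdP[/pullback_unif ->]]. Qed.

Lemma bad_unif : unif r bad.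
Proof. by move=> e /setDP[/setIdP[/uE ->]]. Qed.

Lemma dens_missing : dens n r #|missing| <= beta.
Proof.
have le1 : (#|missing| <= \sum_(v in U) #|link missing v|)%N.
  under eq_bigr do rewrite card_link -sum1_card.
  rewrite (exchange_big_dep (mem missing)) /=; last by move=> v e _; rewrite inE => /andP[].
  rewrite -sum1_card; apply: leq_sum => e eM.
  have /card_gt0P[x xe] : (0 < #|e|)%N by rewrite (missing_unif eM).
  have xU : x \in U by have /setDP[/setIdP[_ /subsetP h] _] := eM; exact: h.
  by rewrite (bigD1 x) //= xU inE eM xe.
apply: le_trans (dens_le _ _ le1) _; rewrite dens_sum.
apply: le_trans (_ : \sum_(v in U) n%:R^-1 * beta <= _).
  apply: ler_sum => v vU.
  have -> : dens n r #|link missing v| = n%:R^-1 * dens n r.-1 #|link missing v|.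
    have r1 : r = r.-1.+1 by rewrite prednK.
    by rewrite /dens {1}r1 exprS invfM mulrCA.
  apply: ler_wpM2l; first by rewrite invr_ge0 ler0n.
  apply: le_trans (few_missing vU); apply: dens_le; apply: subset_leq_card; apply/subsetP => I.
  rewrite -(link_pullback phi v (ltnW (ltnW r3)) stS.1) => /setIdP[vI /setDP[/setIdP[hK _] hE]].
  by rewrite inE inE vI (negbTE hE) /= inE vI.
rewrite sumr_const -[X in X <= _]mulr_natl mulrA; apply: ler_piMl => //.
rewrite ler_pdivrMr ?ltr0n // mul1r ler_nat; exact: max_card.
Qed.

(** The number of faces of A that are in no bad edge. *)
Definition good_faces (A : {set V}) := #|[set x in A | A :\ x \notin bad_traces]|.

Lemma sum_good_faces :
  (\sum_(I in bad_traces) #|extensions missing I| + \sum_(A in missing) good_faces A = r * #|missing|)%N.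
Proof.
rewrite -(sum_extensions missing_unif) [RHS](bigID (mem bad_traces)) /=; congr (_ + _)%N.
have rE : r = r.-1.+1 by rewrite prednK.
pose F (T : {set V}) x : nat := (T \in missing) && (T :\ x \notin bad_traces).
have h : (\sum_(D : {set V} | (D \subset setT) && (#|D| == r.-1)) \sum_(i in setT :\: D) F (i |: D) i =
  \sum_(T : {set V} | (T \subset setT) && (#|T| == r.-1.+1)) \sum_(i in T) F T i)%N.
  exact: (@sum_flags V nat setT r.-1 F).
transitivity (\sum_(T : {set V} | (T \subset setT) && (#|T| == r.-1.+1)) \sum_(i in T) F T i)%N.
  rewrite [RHS](bigID (mem missing)) /= [X in (_ + X)%N]big1 ?addn0; last first.
    by move=> T /andP[_ /negbTE hT]; rewrite big1 // => x _; rewrite /F hT.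
  apply: eq_big => [T|T TM].
    by rewrite subsetT -rE /=; case: (boolP (T \in missing)) => [/missing_unif ->|]; rewrite ?eqxx ?andbF.
  rewrite /good_faces -sum1_card big_mkcond [RHS]big_mkcond /=; apply: eq_bigr => x _.
  by rewrite inE /F TM /=; case: (x \in T); case: (_ \notin _).
rewrite -h [RHS](bigID (fun J : {set V} => #|J| == r.-1)) /= [X in (_ + X)%N]big1 ?addn0; last first.
  move=> J /andP[_ cJ]; apply/eqP; rewrite cards_eq0; apply/eqP/setP => x; rewrite [LHS]inE [RHS]inE.
  apply/negP => /andP[xJ /missing_unif]; rewrite cardsU1 xJ add1n => e.
  by move: cJ; rewrite -e eqxx.
rewrite [LHS](bigID (fun J => J \notin bad_traces)) /= [X in (_ + X)%N]big1 ?addn0; last first.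
  move=> J /andP[_ /negPn hJ]; apply: big1 => x; rewrite inE => /andP[xJ _].
  by rewrite /F setU1K // hJ andbF.
apply: eq_big => [J|J /andP[_ hJ]]; first by rewrite subsetT andbC.
rewrite -sum1_card big_mkcond [RHS]big_mkcond /=; apply: eq_bigr => x _.
rewrite in_setD in_setT andbT [x \in extensions _ _]in_set.
by case: (boolP (x \in J)) => //= xJ; rewrite /F setU1K // hJ andbT; case: (_ \in missing).
Qed.

Lemma transversals_inside (T : {set 'I_m}) : T \in S -> transversals phi U T \subset inside K.
Proof.
move=> TS; apply/subsetP => e; rewrite inE => /and3P[eU /eqP ce /eqP pe].
by rewrite inE eU andbT inE ce pe TS (uS TS) eqxx.
Qed.

(** Let A minus x be a face of a bad edge through a.  If B does not contain a poor neighbour of a,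
    the exchange puts in A a vertex u that is not joined to a as an extension, so the result is
    again missing. *)
Lemma bad_exchange (T : {set 'I_m}) (A : {set V}) x : T \in S -> A \in transversals phi U T :\: E -> x \in A -> A :\ x \in bad_traces ->
  dens n r #|[set B in transversals phi U T | exchange phi (phi x) A B \notin transversals phi U T :\: E]| <= rho.
Proof.
move=> TS /setDP[AK AE] xA; rewrite inE => /set0Pn[a]; rewrite inE => /andP[aI abad].
have [aE aU IU inja aS] := badP aI abad.
have /and3P[AU /eqP cA /eqP pA] : [&& A \subset U, #|A| == #|T| & phi @: A == T] by move: AK; rewrite inE.
have inj : {in A &, injective phi} by apply/imset_injP; rewrite cA pA.
have pax : phi x != phi a.
  by apply: contraNneq aS => <-; rewrite -imsetU1 setD1K // pA.
apply: le_trans (dens_poor aU); apply: dens_meeting => //.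
  by move=> B /setIdP[]; rewrite inE => /and3P[_ /eqP -> _]; rewrite (uS TS).
move=> B /setIdP[BK nX].
have /imsetP[u uB pu] : phi x \in phi @: B.
  by move: BK; rewrite inE => /and3P[_ _ /eqP ->]; rewrite -pA imset_f.
have /and3P[BU /eqP cB /eqP pB] : [&& B \subset U, #|B| == #|T| & phi @: B == T] by move: BK; rewrite inE.
have injB : {in B &, injective phi} by apply/imset_injP; rewrite cB pB.
have ex : exchange phi (phi x) A B = u |: (A :\ x).
  apply/setP => z; rewrite !inE orbC; congr (_ || _).
    apply/andP/eqP => [[zB /eqP pz]|->]; last by rewrite uB pu.
    by apply: injB => //; rewrite pz.
  have [->|zx] := eqVneq z x; first by rewrite eqxx andbF.
  by case: (boolP (z \in A)) => //= zA; apply: contra zx => /eqP /inj ->.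
have uI : u \notin A :\ x.
  apply/negP => /setD1P[ux uA]; move: ux; rewrite (inj u x) ?eqxx //.
have uK : u |: (A :\ x) \in transversals phi U T.
  rewrite inE subUset sub1set (subsetP BU) // IU cardsU1 uI -cA (cardsD1 x A) xA eqxx /=.
  by rewrite imsetU1 -pu -imsetU1 setD1K // pA.
move: nX; rewrite ex in_setD uK andbT negbK => uE'.
have := trace_poor aE uE' aI uI; rewrite -pu => /(_ pax) up'.
by rewrite -setI_eq0; apply/set0Pn; exists u; rewrite inE uB.
Qed.

(** The exchange count bounds |X| |K - X| for the missing edges X over one block by the exchanges
    that leave X; the faces of bad edges contribute only |X| r rho, so most faces of a missing
    edge are good on average. *)
Lemma good_faces_block (T : {set 'I_m}) : T \in S ->
  3 / 4 * dens n r #|transversals phi U T :\: E| <=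
  dens n r (\sum_(A in transversals phi U T :\: E) good_faces A).
Proof.
move=> TS; set X := transversals phi U T :\: E; set KT := transversals phi U T in X *.
have XK : X \subset KT by exact: subsetDl.
have := dens_le n (r + r) (hybrid_count XK).
rewrite densX // dens_sum.
have sXM : X \subset missing by apply: setSD; exact: transversals_inside.
have xb : dens n r #|X| <= beta by apply: le_trans dens_missing; apply: dens_le; exact: subset_leq_card.
have kb : lo ^+ r <= dens n r #|KT|.
  rewrite -(uS TS) /KT card_transversals -dens_prod -prodr_const; apply: ler_prod => i _.
  by rewrite ltW //= low_U.
have kd : dens n r #|KT :\: X| = dens n r #|KT| - dens n r #|X|.
  by rewrite -(cardsID X KT) (setIidPr XK) densD addrAC subrr add0r.
rewrite kd.
have term A : A \in X -> dens n (r + r) (\sum_(x in A) #|[set B in KT | exchange phi (phi x) A B \notin X]|) <=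
    n%:R ^- r * ((good_faces A)%:R * dens n r #|KT| + r%:R * rho).
  move=> AX; have -> : dens n (r + r) (\sum_(x in A) #|[set B in KT | exchange phi (phi x) A B \notin X]|) =
     n%:R ^- r * dens n r (\sum_(x in A) #|[set B in KT | exchange phi (phi x) A B \notin X]|).
    by rewrite /dens exprD invfM mulrCA mulrA.
  apply: ler_wpM2l; first by rewrite invr_ge0 exprn_ge0 ?ler0n.
  rewrite dens_sum (bigID (fun x => A :\ x \notin bad_traces)) /=; apply: lerD.
    apply: le_trans (_ : \sum_(x in A | A :\ x \notin bad_traces) dens n r #|KT| <= _).
      by apply: ler_sum => x _; apply: dens_le; apply: subset_leq_card; apply/subsetP => B /setIdP[].
    rewrite sumr_const mulr_natl /good_faces; apply: eq_refl_le; congr (_ *+ _); apply: eq_card => x.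
    by rewrite [RHS]inE.
  apply: le_trans (_ : \sum_(x in A) rho <= _).
    rewrite big_mkcondr /=; apply: ler_sum => x xA; case: ifP => [/negPn hx|_]; last exact: rho_ge0.
    exact: (bad_exchange TS AX xA hx).
  have cA : #|A| = r.
    by have := subsetP XK A AX; rewrite inE => /and3P[_ /eqP -> _]; rewrite (uS TS).
  by rewrite sumr_const cA mulr_natl.
have sum_term : \sum_(A in X) dens n (r + r) (\sum_(x in A) #|[set B in KT | exchange phi (phi x) A B \notin X]|) <=
   dens n r (\sum_(A in X) good_faces A) * dens n r #|KT| + dens n r #|X| * (r%:R * rho).
  apply: le_trans (ler_sum _ term) _.
  rewrite -mulr_sumr big_split /= -mulr_suml sumr_const -natr_sum mulrDr.
  rewrite -[r%:R * rho *+ _]mulr_natl; apply: eq_refl_le.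
  rewrite /dens; set z := (n%:R ^+ r)^-1; ring.
move=> h; have {h sum_term} := le_trans h sum_term.
have lo1 : 0 < lo ^+ r by exact: exprn_gt0.
set x := dens n r #|X| in xb *; set k := dens n r #|KT| in kb *; set g := dens n r (\sum_(A in X) _).
have x0 : 0 <= x by exact: dens_ge0.
have k0 : 0 < k by lra.
move=> h; rewrite -(ler_pM2r k0).
have : x * (3 / 4 * k) <= x * (k - x - r%:R * rho).
  apply: ler_wpM2l => //; have := beta_lo; lra.
have -> : x * (k - x - r%:R * rho) = x * (k - x) - x * (r%:R * rho) by ring.
have -> : x * (3 / 4 * k) = 3 / 4 * x * k by ring.
lra.
Qed.

Lemma good_faces_many : 3 / 4 * dens n r #|missing| <= dens n r (\sum_(A in missing) good_faces A).
Proof.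
have blocks (f : {set V} -> nat) : (\sum_(A in missing) f A = \sum_(T in S) \sum_(A in transversals phi U T :\: E) f A)%N.
  rewrite (partition_big (fun A : {set V} => phi @: A) (mem S)) /=; last first.
    by move=> A /setDP[/setIdP[]]; rewrite inE => /andP[].
  apply: eq_bigr => T TS; apply: eq_bigl => A; rewrite !inE.
  have [->|_] := eqVneq (phi @: A) T; last by rewrite !andbF.
  by rewrite TS (uS TS) !andbT; case: (A \in E) => //=; rewrite andbC.
rewrite -sum1_card !blocks !dens_sum mulr_sumr; apply: ler_sum => T TS.
by rewrite sum1_card; exact: good_faces_block.
Qed.

(** Counting faces, r |bad| is at most (1 + 1/(4r)) times the number of pairs of a missing edge
    and one of its bad faces.  Since a missing edge has on average at least 3/4 good faces, this
    number is at most (r - 3/4) |missing|, and the product is below (r - 1/2) |missing|. *)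
Lemma exactness : dens n r #|inside E| + (2 * r%:R)^-1 * dens n r #|missing| <= dens n r #|inside K|.
Proof.
have rr0 : 0 < r%:R :> rat by rewrite ltr0n.
have hb : r%:R * dens n r #|bad| <= (1 + (4 * r%:R)^-1) * dens n r (\sum_(I in bad_traces) #|extensions missing I|).
  have -> : r%:R * dens n r #|bad| = dens n r (\sum_(I in bad_traces) #|extensions bad I|).
    have -> : (\sum_(I in bad_traces) #|extensions bad I| = r * #|bad|)%N.
      rewrite -(sum_extensions bad_unif) [RHS](bigID (mem bad_traces)) /= [X in (_ + X)%N]big1 ?addn0 // => I.
      by rewrite inE negbK => /eqP ->; rewrite cards0.
    by rewrite /dens natrM mulrA.
  rewrite !dens_sum mulr_sumr; apply: ler_sum => I IB.
  rewrite /dens mulrA; apply: ler_wpM2r; first by rewrite invr_ge0 exprn_ge0 ?ler0n.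
  exact: bad_extensions.
have hs : dens n r (\sum_(I in bad_traces) #|extensions missing I|) + dens n r (\sum_(A in missing) good_faces A) = r%:R * dens n r #|missing|.
  by rewrite -densD sum_good_faces /dens natrM mulrA.
have hg := good_faces_many.
have e1 : dens n r #|inside E| = dens n r #|inside E :&: K| + dens n r #|bad| by rewrite -densD cardsID.
have e2 : dens n r #|inside K| = dens n r #|inside E :&: K| + dens n r #|missing|.
  rewrite -densD -(cardsID E (inside K)) /missing; congr (dens _ _ (_ + _)); apply: eq_card => e.
  by rewrite !inE; case: (e \subset U); rewrite ?andbF ?andbT // andbC.
set x := dens n r #|missing| in hs hg e2 *; set s := dens n r (\sum_(I in _) _) in hb hs.
set g := dens n r (\sum_(A in _) _) in hs hg.
have x0 : 0 <= x by exact: dens_ge0.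
have s1 : s <= (r%:R - 3 / 4) * x by rewrite mulrBl -hs; lra.
have : r%:R * dens n r #|bad| <= (r%:R - 1 / 2) * x.
  apply: le_trans hb _; apply: le_trans (_ : (1 + (4 * r%:R)^-1) * ((r%:R - 3 / 4) * x) <= _).
    by apply: ler_wpM2l => //; rewrite addr_ge0 // invr_ge0 mulr_ge0 // ltW.
  rewrite mulrA; apply: ler_wpM2r => //.
  rewrite mulrDl mul1r invfM -mulrA mulrBr mulVf ?gt_eqF //.
  have : 0 < r%:R^-1 :> rat by rewrite invr_gt0.
  set q := r%:R^-1; lra.
have -> : (r%:R - 1 / 2) * x = r%:R * ((1 - (2 * r%:R)^-1) * x).
  by field; rewrite gt_eqF.
rewrite ler_pM2l // mulrBl mul1r; lra.
Qed.

End Exactness.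

End Local.

(** * Small constants and degrees in a blow-up *)

(** Finitely many smallness conditions, linear in the parameter, can be met together. *)
Lemma exists_small (l : seq (rat * rat)) : all (fun p => (0 <= p.1) && (0 < p.2)) l ->
  exists2 b : rat, 0 < b & all (fun p => p.1 * b <= p.2) l.
Proof.
elim: l => [|[c d] l IH] /=; first by exists 1.
case/andP => /andP[c0 d0] hl; have [b b0 hb] := IH hl.
have c1 : 0 < c + 1 by rewrite ltr_wpDl.
exists (Num.min b (d / (c + 1))); first by rewrite lt_min b0 divr_gt0.
apply/andP; split.
  apply: le_trans (_ : c * (d / (c + 1)) <= _); first by rewrite ler_wpM2l // ge_min lexx orbT.
  by rewrite mulrA ler_pdivrMr // [c * d]mulrC mulrDr mulr1 lerDl ltW.
apply/allP => p pl; have /= h := allP hb p pl; have /= /andP[p0 _] := allP hl p pl.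
by apply: le_trans h; rewrite ler_wpM2l // ge_min lexx.
Qed.

Lemma expr_add_le (x h : rat) k : 0 <= x -> 0 <= h -> x + h <= 1 -> (x + h) ^+ k <= x ^+ k + k%:R * h.
Proof.
move=> x0 h0 xh; elim: k => [|k IH]; first by rewrite !expr0 mul0r addr0.
rewrite !exprS -natr1; have xk : x ^+ k <= 1 by apply: exprn_ile1 => //; lra.
have k0 : 0 <= k%:R :> rat by rewrite ler0n.
apply: le_trans (_ : (x + h) * (x ^+ k + k%:R * h) <= _).
  by apply: ler_wpM2l => //; exact: addr_ge0.
have : (x + h) * (k%:R * h) <= k%:R * h by apply: ler_piMl => //; exact: mulr_ge0.
have : h * x ^+ k <= h by apply: ler_piMr.
lra.
Qed.

Lemma expr_sub_ge (x h : rat) k : 0 <= h -> h <= x -> x <= 1 -> x ^+ k - k%:R * h <= (x - h) ^+ k.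
Proof.
move=> h0 hx x1; rewrite lerBlDr; have -> : x ^+ k = (x - h + h) ^+ k by rewrite subrK.
by apply: expr_add_le => //; lra.
Qed.

Section Degrees.
Variables (V : finType) (r m : nat) (S : {set {set 'I_m}}) (phi : V -> 'I_m) (U : {set V}).
Hypotheses (r3 : (3 <= r)%N) (rm : (r < m)%N) (stS : steiner_family r S).

(** The number of blocks through a point. *)
Definition blocks_at : rat := 'C(m.-1, r - 2)%:R / r.-1%:R.

Lemma blocks_at_degree : blocks_at * m%:R^-1 ^+ r.-1 = witt_degree r m.
Proof.
have m0 : m%:R != 0 :> rat by rewrite pnatr_eq0; lia.
have r0 : r.-1%:R != 0 :> rat by rewrite pnatr_eq0; lia.
have h : m%:R * 'C(m.-1, r - 2)%:R = r.-1%:R * 'C(m, r.-1)%:R :> rat.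
  rewrite -!natrM; congr (_%:R); have -> : r.-1 = (r - 2).+1 by lia.
  exact: mul_bin_diag.
have -> : witt_degree r m = 'C(m, r.-1)%:R / (m%:R * m%:R ^+ r.-1).
  by rewrite /witt_degree -exprS prednK //; lia.
have -> : 'C(m, r.-1)%:R = m%:R * 'C(m.-1, r - 2)%:R / r.-1%:R :> rat.
  by rewrite h mulrC mulKf.
rewrite /blocks_at exprVn; set x := m%:R ^+ r.-1.
have x0 : x != 0 by rewrite expf_neq0.
by field; rewrite x0 m0 r0.
Qed.

Lemma card_blocks_at i : #|[set T in S | i \in T]|%:R = blocks_at.
Proof.
have rC : (r < #|'I_m|)%N by rewrite card_ord.
have r0 : r.-1%:R != 0 :> rat by rewrite pnatr_eq0; lia.
have := count_blocks_at r3 rC stS i; rewrite card_ord /blocks_at => <-.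
by rewrite natrM mulfK.
Qed.

Lemma dens_class_link_inside i : (exists v, phi v = i) ->
  dens #|V| r.-1 #|[set I in class_link r S phi i | I \subset U]| =
  \sum_(T in S | i \in T) \prod_(j in T :\ i) dens #|V| 1 #|U :&: part phi j|.
Proof.
case=> v <-; rewrite -(link_pullback phi v (ltnW (ltnW r3)) stS.1).
rewrite (card_pullback_link phi v U stS.1.1 (ltnW (ltnW r3))) dens_sum.
apply: eq_bigr => T /andP[TS vT]; rewrite dens_prod; congr (dens _ _ _).
by rewrite -(stS.1.1 T TS) (cardsD1 (phi v) T) vT.
Qed.

Lemma dens_class_link_inside_le i up : (exists v, phi v = i) ->
  (forall j, dens #|V| 1 #|U :&: part phi j| <= up) ->
  dens #|V| r.-1 #|[set I in class_link r S phi i | I \subset U]| <= blocks_at * up ^+ r.-1.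
Proof.
move=> hi hup; rewrite dens_class_link_inside // -(card_blocks_at i) mulr_natl -sumr_const.
rewrite [X in _ <= X](eq_bigl (fun T => (T \in S) && (i \in T))); last by move=> T; rewrite inE.
apply: ler_sum => T /andP[TS iT].
have -> : r.-1 = #|T :\ i| by rewrite -(stS.1.1 T TS) (cardsD1 i T) iT.
by rewrite -prodr_const; apply: ler_prod => j _; rewrite dens_ge0 hup.
Qed.

Lemma dens_class_link_inside_ge i lo : 0 <= lo -> (exists v, phi v = i) ->
  (forall j, lo <= dens #|V| 1 #|U :&: part phi j|) ->
  blocks_at * lo ^+ r.-1 <= dens #|V| r.-1 #|[set I in class_link r S phi i | I \subset U]|.
Proof.
move=> lo0 hi hlo; rewrite dens_class_link_inside // -(card_blocks_at i) mulr_natl -sumr_const.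
rewrite [X in X <= _](eq_bigl (fun T => (T \in S) && (i \in T))); last by move=> T; rewrite inE.
apply: ler_sum => T /andP[TS iT].
have -> : r.-1 = #|T :\ i| by rewrite -(stS.1.1 T TS) (cardsD1 i T) iT.
by rewrite -prodr_const; apply: ler_prod => j _; rewrite lo0 hlo.
Qed.

End Degrees.

(** * Vertices of low degree *)

(** The sum counts the edges of K with exactly one vertex in W. *)
Lemma edges_meeting_ge (V : finType) (K : {set {set V}}) (W : {set V}) :
  (#|inside (~: W) K| + \sum_(v in W) #|[set I in link K v | I \subset ~: W]| <= #|K|)%N.
Proof.
have hv v : (#|[set I in link K v | I \subset ~: W]| <=
    \sum_(e in K | [&& v \in e & e :\ v \subset ~: W]) 1)%N.
  have inj : {in [set I in link K v | I \subset ~: W] &, injective (fun I => v |: I)}.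
    move=> I J /setIdP[/setIdP[vI _] _] /setIdP[/setIdP[vJ _] _] e.
    by rewrite -(setU1K vI) e setU1K.
  rewrite -(card_in_imset inj) sum1dep_card; apply: subset_leq_card; apply/subsetP => e /imsetP[I].
  by case/setIdP => /setIdP[vI eK] IW ->; rewrite inE eK setU11 setU1K.
apply: leq_trans (_ : (#|inside (~: W) K| + \sum_(v in W) \sum_(e in K | (v \in e) && (e :\ v \subset ~: W)) 1 <= _)%N).
  by rewrite leq_add2l; apply: leq_sum.
rewrite (exchange_big_dep (mem K)) /=; last by move=> v e _ /andP[].
rewrite -[#|inside _ _|]sum1_card [X in (X + _ <= _)%N](eq_bigl (fun e : {set V} => (e \in K) && (e \subset ~: W))); last by move=> e; rewrite /= in_set.
rewrite big_mkcondr -big_split /= -sum1_card; apply: leq_sum => e eK.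
case: ifP => eW.
  rewrite big1 // => v /and3P[vW _ /andP[ve _]].
  by have := subsetP eW v ve; rewrite inE vW.
rewrite add0n sum1dep_card leqNgt; apply/negP => /card_gt1P[x [y []]].
case/setIdP => xW /and3P[_ xe ex]; case/setIdP => yW /and3P[_ ye _] xy.
have : y \in e :\ x by rewrite !inE eq_sym xy ye.
by move/(subsetP ex); rewrite inE yW.
Qed.

(** The vertices of W have degree at most low in E, but their degree in the blow-up is larger by
    gam; so each of them, wherever it is put, costs E at least gam n^(r-1) edges.  On the rest the
    exactness inequality applies. *)
Lemma local_gain (V : finType) (E : {set {set V}}) r m (S : {set {set 'I_m}}) (phi : V -> 'I_m)
    (W : {set V}) (lam up lo beta low gam : rat) :
  (3 <= r)%N -> (r < m)%N -> steiner_family r S -> unif r E -> Tfree E -> (0 < #|V|)%N ->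
  0 < lam -> lam <= 1 -> (forall i, lam <= dens #|V| 1 #|part phi i|) ->
  (forall i, dens #|V| 1 #|part phi i| <= up) ->
  (forall v, v \notin W -> dens #|V| r.-1 #|class_link r S phi (phi v) :\: link E v| <= beta) ->
  0 <= beta -> beta <= lam ^+ r / 8 -> dens #|V| 1 r <= lam ^+ r / 4 ->
  0 < lo -> (forall i, lo <= dens #|V| 1 #|~: W :&: part phi i|) ->
  up + rho r lam beta <= (1 + (4 * r%:R)^-1) * (lo - rho r lam beta) ->
  beta + r%:R * rho r lam beta <= lo ^+ r / 4 ->
  (forall v, v \in W -> dens #|V| r.-1 #|link E v| <= low) ->
  low + gam <= blocks_at r m * lo ^+ r.-1 -> gam <= (2 * r%:R)^-1 -> 0 <= gam ->
  dens #|V| r #|E| + gam * dens #|V| r #|pullback r phi S :\: E| <= dens #|V| r #|pullback r phi S|.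
Proof.
move=> r3 rm stS uE tE nV lam0 lam1 low_part up_part few beta0 beta_small n_large lo0 low_U up_lo beta_lo poorW gainW gam1 gam0.
set K := pullback r phi S; set n := #|V| in nV *.
have r1 : r.-1.+1 = r by rewrite prednK // ltnW // ltnW.
have r0 : (0 < r)%N by rewrite -r1.
have few' v : v \in ~: W -> dens #|V| r.-1 #|class_link r S phi (phi v) :\: link E v| <= beta.
  by rewrite inE => /few.
have ex := exactness r3 rm stS uE tE nV lam0 lam1 low_part up_part few' beta0 beta_small n_large lo0 low_U up_lo beta_lo.
pose th := dens n 1 #|W|.
have link_sum (c : V -> nat) : dens n r (\sum_(v in W) c v) = n%:R^-1 * \sum_(v in W) dens n r.-1 (c v).
  by rewrite dens_sum mulr_sumr; apply: eq_bigr => v _; rewrite /dens -{1}r1 exprS invfM mulrCA.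
have const_sum (c : rat) : n%:R^-1 * \sum_(v in W) c = th * c.
  by rewrite sumr_const -(mulr_natl c) mulrA /th /dens expr1 [n%:R^-1 * _]mulrC.
have n0 : 0 <= n%:R^-1 :> rat by rewrite invr_ge0 ler0n.
have hE : dens n r #|E| <= dens n r #|inside (~: W) E| + th * low.
  apply: le_trans (dens_le n r (edges_meeting_le E W)) _; rewrite densD; apply: lerD.
    by apply: dens_le; apply: subset_leq_card; apply/subsetP => e; rewrite !inE disjoints_subset.
  by rewrite link_sum -const_sum; apply: ler_wpM2l => //; apply: ler_sum.
have hK : dens n r #|inside (~: W) K| + th * (low + gam) <= dens n r #|K|.
  apply: le_trans (dens_le n r (edges_meeting_ge K W)); rewrite densD lerD2l link_sum -const_sum.
  apply: ler_wpM2l => //; apply: ler_sum => v vW; apply: le_trans gainW _.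
  rewrite (link_pullback phi v r0 stS.1); apply: dens_class_link_inside_ge => //; first exact: ltW.
  by exists v.
have hM : dens n r #|K :\: E| <= dens n r #|missing r S phi E (~: W)| + th.
  have sM : K :\: E \subset missing r S phi E (~: W) :|: [set e in K | ~~ [disjoint e & W]].
    apply/subsetP => e /setDP[eK eE]; rewrite in_setU.
    have [dj|dj] := boolP [disjoint e & W]; apply/orP; [left | right]; last by apply/setIdP.
    by rewrite in_setD eE; apply/setIdP; rewrite -disjoints_subset.
  have := dens_le n r (leq_trans (subset_leq_card sM) (leq_card_setU _ _)); rewrite densD.
  have : dens n r #|[set e in K | ~~ [disjoint e & W]]| <= th.
    apply: dens_meeting => // e /setIdP[//] /pullback_unif; exact.
  lra.
have h1 : gam * dens n r #|K :\: E| <= gam * dens n r #|missing r S phi E (~: W)| + gam * th.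
  by rewrite -mulrDr; apply: ler_wpM2l.
have h2 : gam * dens n r #|missing r S phi E (~: W)| <= (2 * r%:R)^-1 * dens n r #|missing r S phi E (~: W)|.
  by apply: ler_wpM2r => //; exact: dens_ge0.
rewrite mulrDr in hK.
rewrite -/n -/K in ex hE hK h1 h2 *.
have h3 : gam * th = th * gam by rewrite mulrC.
move: ex hE hK h1 h2; rewrite h3; set x := _^-1 * _; set y := gam * dens n r #|missing _ _ _ _ _|; set z := gam * dens _ _ _.
set t1 := th * low; set t2 := th * gam.
clear; lra.
Qed.

(** * Local stability *)

(** Few vertices (B) miss much of the link of their part.  Those of large degree among them are
    moved to the part given by [vertex_class]; the others (W) have low degree and only need to be
    counted. *)
Theorem local_stability r m : witt_pair r m ->
  exists eps gam : rat, [/\ 0 < eps, 0 < gam & exists n0 : nat,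
    forall (V : finType) (E : {set {set V}}) (S : {set {set 'I_m}}) (phi : V -> 'I_m),
    (n0 <= #|V|)%N -> unif r E -> Tfree E -> steiner_family r S ->
    dens #|V| r #|pullback r phi S :\: E| <= eps -> balanced eps phi ->
    exists phi' : V -> 'I_m, (forall i, m%:R^-1 / 2 <= dens #|V| 1 #|part phi' i|) /\
      dens #|V| r #|E| + gam * dens #|V| r #|pullback r phi' S :\: E| <= dens #|V| r #|pullback r phi' S|].
Proof.
move=> wp; have [s0 [er sm]] := witt_pairP wp.
have r3 : (3 <= r)%N by rewrite er.
have r1 : r.-1.+1 = r by rewrite er.
have r2 : r.-1 = (r - 2).+1 by rewrite er /= !subSS subn0.
have rm : (r < m)%N by rewrite er.
clear s0 er sm.
pose a : rat := m%:R^-1; pose lam := a / 2; pose kap := lam ^+ r.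
pose w := witt_degree r m; pose bq := blocks_at r m.
pose RR : rat := r%:R; pose R1 : rat := r.-1%:R; pose mm : rat := m%:R; pose C0 : rat := 'C(m - 2, r - 2)%:R.
have w0 : 0 < w by exact: witt_degree_gt0.
have mm0 : 0 < mm by rewrite ltr0n; apply: leq_trans rm.
have mm2 : 2 <= mm by rewrite (ler_nat _ 2); apply: leq_trans (ltnW rm); apply: leq_trans r3.
have a0 : 0 < a by rewrite invr_gt0.
have a2 : a <= 1 / 2 by rewrite /a ler_pdivlMr // mulrC ler_pdivrMr // mul1r.
have lam0 : 0 < lam by rewrite /lam; lra.
have lam1 : lam <= 1 by rewrite /lam; lra.
have kap0 : 0 < kap by exact: exprn_gt0.
have RR0 : 1 <= RR by rewrite ler1n; apply: leq_trans r3.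
have R10 : 0 <= R1 by exact: ler0n.
have C00 : 0 <= C0 by exact: ler0n.
have bq0 : 0 <= bq by rewrite divr_ge0 ?ler0n.
have wE : bq * a ^+ r.-1 = w by exact: blocks_at_degree.
have ar0 : 0 < a ^+ r.-1 by exact: exprn_gt0.
(* The degree of a vertex of the blow-up strictly exceeds the bound for two nonadjacent parts,
   since binom(m-1, r-2) > binom(m-2, r-2). *)
have w1 : R1 * w >= (C0 + 1) * a ^+ r.-1.
  rewrite -wE /bq /blocks_at mulrA [R1 * _]mulrC divfK; last by rewrite pnatr_eq0 r2.
  rewrite ler_pM2r // /C0 natr1 ler_nat.
  have -> : m.-1 = (m - 2).+1 by clear -r3 rm; lia.
  have -> : (r - 2 = (r - 3).+1)%N by clear -r3; lia.
  rewrite binS -[X in (X < _)%N]addn0 ltn_add2l bin_gt0; clear -r3 rm; lia.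
have RRp : 0 < RR by lra.
have half (x : rat) : 0 < x -> 0 < x / 2 by move=> h; lra.
have aR0 : 0 < a / (24 * RR) by apply: divr_gt0; [exact: a0 | apply: mulr_gt0; [rewrite ltr0n | exact: RRp]].
have bR0 : 0 <= bq * R1 by exact: mulr_ge0.
have kap8 : 0 < kap / 8 by lra.
pose rr : rat := 2 * RR / kap.
have rr0 : 0 <= rr by rewrite divr_ge0 ?mulr_ge0 ?ltW.
(* The constants are chosen in the order b2, eta, s, b, eps: b2 bounds what links miss once the
   vertices have been moved, w - eta is the degree below which a vertex is put in W, s bounds the
   imbalance of the new parts, and b bounds both the size of B and what the links of the other
   vertices miss. *)
have [b2 b20 /= /and5P[b2a b2b b2c b2d /andP[b2e _]]] := @exists_small
  [:: (1, kap / 8); (rr, a / (24 * RR)); (RR * rr, kap / 8); (1, w); (R1, a ^+ r.-1)]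
  (ltac:(by rewrite /= ?ler01 R10 ar0 w0 kap8 aR0 rr0 mulr_ge0 // ltW)).
pose eta := b2 / 4.
have eta0 : 0 < eta by rewrite /eta; lra.
have [s sp /= /and4P[sa sb sc _]] := @exists_small [:: (1, a / (24 * RR)); (1, a / 2); (bq * R1, eta / 2)]
  (ltac:(by rewrite /= ?ler01 aR0 bR0 !half)).
pose E1 : rat := 2 * mm + 1.
have E10 : 0 <= E1 by rewrite /E1; lra.
have CR0 : 0 <= C0 * R1 * (1 + rr) + R1 * E1 by rewrite addr_ge0 ?mulr_ge0 //; lra.
have [b b0 /= /and5P[ba bb bc bd /and4P[be bf bg _]]] := @exists_small
  [:: (1, kap / 8); (3, s); (bq * R1 + E1 + 1, b2 / 2); (E1, w / 2); (C0 * R1 * (1 + rr) + R1 * E1, a ^+ r.-1 / 2); (1 + rr, 1 / 2); (2, b2)]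
  (ltac:(rewrite /= ?ler01 E10 CR0 sp !half // b20; apply/and5P; split => //; try lra)).
have [eps eps0 /= /and4P[ea eb ec _]] := @exists_small [:: (1, b); (RR, b ^+ 2); (1, a / 2)]
  (ltac:(rewrite /= ?ler01 b0 half // exprn_gt0 // !andbT /=; lra)).
have [gam gam0 /= /and3P[ga gb _]] := @exists_small [:: (1, (2 * RR)^-1); (1, eta / 2)]
  (ltac:(rewrite /= ?ler01 half // invr_gt0 mulr_gt0 //; lra)).
rewrite !mul1r in b2a b2d sa sb ba ea ec ga gb.
have [n0 [n00 hn0]] := dens_small r b0.
exists eps, gam; split => //; exists n0 => V E S phi hn uE tE stS hmiss hbal.
have nV : (0 < #|V|)%N by apply: leq_trans hn.
set n := #|V| in hmiss *.
have nV' : 0 < n%:R :> rat by rewrite ltr0n.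
have o_b : dens n 1 r <= b by exact: hn0.
have o_kap : dens n 1 r <= kap / 4 by lra.
have rhoE x : rho r lam x = rr * x by rewrite /rho /rr -/kap mulrAC.
have partP i : a - eps <= dens n 1 #|part phi i| /\ dens n 1 #|part phi i| <= a + eps.
  have := hbal i; rewrite card_ord ler_distl => /andP[]; rewrite -/a; by split.
pose cl := class_link r S phi.
pose B := [set v | b < dens n r.-1 #|cl (phi v) :\: link E v|].
(* A vertex of B lies in at least b n^(r-1) missing edges. *)
have hB : dens n 1 #|B| <= b.
  have h1 : (\sum_(v in B) #|cl (phi v) :\: link E v| <= r * #|pullback r phi S :\: E|)%N.
    have uM : unif r (pullback r phi S :\: E) by move=> e /setDP[/pullback_unif].
    rewrite -(sum_link uM) [X in (X <= _)%N]big_mkcond /=; apply: leq_sum => v _; case: ifP => // _.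
    apply: subset_leq_card; apply/subsetP => I; rewrite /cl -(link_pullback phi v (ltnW (ltnW r3)) stS.1) => /setDP[].
    by rewrite !inE => /andP[-> ->]; rewrite /= andbT.
  have := dens_le n r h1; rewrite dens_sum => h2.
  have h3 : \sum_(v in B) n%:R^-1 * b <= \sum_(v in B) dens n r #|cl (phi v) :\: link E v|.
    apply: ler_sum => v; rewrite inE => /ltW hv.
    have -> : dens n r #|cl (phi v) :\: link E v| = n%:R^-1 * dens n r.-1 #|cl (phi v) :\: link E v|.
      by rewrite /dens -{1}r1 exprS invfM mulrCA.
    by apply: ler_wpM2l => //; rewrite invr_ge0 ler0n.
  have h4 : dens n r (r * #|pullback r phi S :\: E|) = RR * dens n r #|pullback r phi S :\: E| by rewrite /dens natrM mulrA.
  have h5 : RR * dens n r #|pullback r phi S :\: E| <= RR * eps by apply: ler_wpM2l => //; exact: ltW.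
  have h6 : \sum_(v in B) n%:R^-1 * b = dens n 1 #|B| * b by rewrite sumr_const -[LHS]mulr_natl mulrA /dens expr1.
  have : dens n 1 #|B| * b <= b * b by rewrite -expr2 -h6; apply: le_trans h3 _; apply: le_trans h2 _; rewrite h4; exact: le_trans h5 eb.
  by rewrite ler_pM2r.
have low_part i : lam <= dens n 1 #|part phi i| by have [] := partP i; rewrite /lam; lra.
have up_part i : dens n 1 #|part phi i| <= a + b by have [_] := partP i; lra.
have ex_part i : exists v, phi v = i.
  have : (0 < #|part phi i|)%N.
    rewrite lt0n; apply/negP => /eqP p0; have := low_part i; rewrite p0 /dens mul0r; lra.
  by case/card_gt0P => v; rewrite in_part => /eqP; exists v.
have few0 v : v \in ~: B -> dens n r.-1 #|cl (phi v) :\: link E v| <= b by rewrite !inE -leNgt.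
have few_out : dens n 1 #|~: ~: B| <= b by rewrite setCK.
have errb : err V r m b <= E1 * b.
  rewrite /err -/mm -/n /E1; have : mm * (b + dens n 1 r) <= mm * (2 * b) by apply: ler_wpM2l; [exact: ltW | lra].
  lra.
have err_w : err V r m b < w - eta by rewrite /eta; lra.
have free_w : C0 * (a + b) ^+ (r - 2) * (a + b + rho r lam b) < R1 * (w - eta - err V r m b).
  rewrite rhoE.
  have rb0 : 0 <= rr * b by rewrite mulr_ge0 // ltW.
  have h1 : (a + b) ^+ (r - 2) * (a + b + rr * b) <= a ^+ r.-1 + R1 * ((1 + rr) * b).
    apply: le_trans (_ : (a + (1 + rr) * b) ^+ r.-1 <= _).
      have ab0 : 0 <= a + b by rewrite addr_ge0 // ltW.
      have e1 : a + (1 + rr) * b = a + b + rr * b by ring.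
      rewrite r2 exprSr e1; apply: ler_pM; [exact: exprn_ge0 | exact: addr_ge0 | | exact: lexx].
      by apply: lerXn2r; rewrite ?nnegrE; [exact: ab0 | exact: addr_ge0 | rewrite lerDl].
    by apply: expr_add_le; [exact: ltW | apply: mulr_ge0; lra | lra].
  have h2 : C0 * ((a + b) ^+ (r - 2) * (a + b + rr * b)) <= C0 * (a ^+ r.-1 + R1 * ((1 + rr) * b)) by apply: ler_wpM2l.
  have h3 : R1 * err V r m b <= R1 * (E1 * b) by apply: ler_wpM2l.
  have h4 : (C0 * R1 * (1 + rr) + R1 * E1) * b = C0 * (R1 * ((1 + rr) * b)) + R1 * (E1 * b) by ring.
  rewrite -mulrA; apply: le_lt_trans h2 _.
  have -> : R1 * (w - eta - err V r m b) = R1 * w - R1 * b2 / 4 - R1 * err V r m b by rewrite /eta; ring.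
  have h5 : (C0 + 1) * a ^+ r.-1 = C0 * a ^+ r.-1 + a ^+ r.-1 by ring.
  have h6 : C0 * (a ^+ r.-1 + R1 * ((1 + rr) * b)) = C0 * a ^+ r.-1 + C0 * (R1 * ((1 + rr) * b)) by ring.
  move: be w1 b2e h3 ar0; rewrite h4 h5 h6.
  set x := C0 * a ^+ _; set y := C0 * (R1 * _); set z := R1 * (E1 * b); set u := R1 * err _ _ _ _; set v := R1 * b2; set q := R1 * w; set p := a ^+ r.-1.
  lra.
pose bound := bq * (a + b) ^+ r.-1 - (w - eta) + err V r m b.
have bound_b2 : bound + b <= b2.
  have h1 : bq * (a + b) ^+ r.-1 <= bq * (a ^+ r.-1 + R1 * b).
    by apply: ler_wpM2l => //; apply: expr_add_le; [exact: ltW | exact: ltW | lra].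
  have h2 : bq * (a ^+ r.-1 + R1 * b) = w + bq * R1 * b by rewrite -wE; ring.
  have h3 : (bq * R1 + E1 + 1) * b = bq * R1 * b + E1 * b + b by ring.
  rewrite /bound /eta; move: bc h1 errb; rewrite h2 h3; lra.
have classP v : w - eta <= dens n r.-1 #|link E v| -> exists i, dens n r.-1 #|cl i :\: link E v| <= bound.
  move=> hv; have [i hi] := vertex_class r3 rm stS uE tE nV lam0 lam1 low_part up_part few0 (ltW b0) ba o_kap few_out hv err_w free_w.
  exists i; apply: le_trans hi _; rewrite /bound lerD2r lerD2r.
  have -> : class_link r S phi i = [set I in class_link r S phi i | I \subset setT].
    by apply/setP => I; rewrite [RHS]inE subsetT andbT.
  by apply: dens_class_link_inside_le => // j; rewrite setTI.
pose W := [set v in B | dens n r.-1 #|link E v| < w - eta].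
pose psi v := if v \in B :\: W then odflt (phi v) [pick i | dens n r.-1 #|cl i :\: link E v| <= bound] else phi v.
have psi_out v : v \notin B -> psi v = phi v by move=> vB; rewrite /psi in_setD (negbTE vB) andbF.
have psi_in v : v \in B -> v \notin W -> dens n r.-1 #|cl (psi v) :\: link E v| <= bound.
  move=> vB vW; rewrite /psi in_setD vB vW /=; case: pickP => [i //|no]; exfalso.
  have [|i hi] := classP v; last by have := no i; rewrite hi.
  by move: vW; rewrite inE vB /= -leNgt.
have sWB : W \subset B by apply/subsetP => v /setIdP[].
have densU (A C : {set V}) : dens n 1 #|A :|: C| <= dens n 1 #|A| + dens n 1 #|C|.
  by rewrite -densD; apply: dens_le; exact: leq_card_setU.
have dens_sub (A C : {set V}) : A \subset C -> dens n 1 #|A| <= dens n 1 #|C|.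
  by move=> /subset_leq_card; exact: dens_le.
have lowU i : a - s <= dens n 1 #|~: W :&: part psi i|.
  have sub : part phi i \subset (~: W :&: part psi i) :|: B.
    apply/subsetP => v; rewrite in_part in_setU in_setI in_setC in_part => /eqP pv.
    have [vB|vB] := boolP (v \in B); first by rewrite orbT.
    by rewrite psi_out // pv eqxx andbT orbF; apply: contra vB => /(subsetP sWB).
  have [h _] := partP i; have := le_trans (dens_sub _ _ sub) (densU _ _); move: h hB bb ea b0; clear; lra.
have upP i : dens n 1 #|part psi i| <= a + s.
  have sub : part psi i \subset part phi i :|: B.
    apply/subsetP => v; rewrite in_setU !in_part => /eqP pv.
    have [vB|vB] := boolP (v \in B); first by rewrite orbT.
    by rewrite -(psi_out v vB) pv eqxx.
  have [_ h] := partP i; have := le_trans (dens_sub _ _ sub) (densU _ _); move: h hB bb ea b0; clear; lra.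
have lowP i : lam <= dens n 1 #|part psi i|.
  apply: le_trans (_ : a - s <= _); first by rewrite /lam; move: sb; clear; lra.
  by apply: le_trans (lowU i) _; apply: dens_sub; exact: subsetIr.
exists psi; split => //.
have fewP v : v \notin W -> dens n r.-1 #|class_link r S psi (psi v) :\: link E v| <= b2.
  move=> vW.
  have sub : class_link r S psi (psi v) :\: link E v \subset
     (cl (psi v) :\: link E v) :|: [set I in class_link r S psi (psi v) | ~~ [disjoint I & B]].
    apply/subsetP => I /setDP[Ic IE]; rewrite in_setU in_setD IE /=.
    have [dj|dj] := boolP [disjoint I & B]; apply/orP; [left | right]; last by apply/setIdP.
    have eI : psi @: I = phi @: I.
      by apply: eq_in_imset => x xI; apply: psi_out; rewrite (disjointFr dj).
    by move: Ic; rewrite /cl /class_link !in_set eI.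
  have h1 := dens_le n r.-1 (leq_trans (subset_leq_card sub) (leq_card_setU _ _)).
  rewrite densD in h1.
  have h2 : dens n r.-1 #|[set I in class_link r S psi (psi v) | ~~ [disjoint I & B]]| <= dens n 1 #|B|.
    apply: dens_meeting => //; first by rewrite r2.
      by move=> I /setIdP[]; rewrite /class_link in_set => /and3P[/eqP].
    by move=> I /setIdP[].
  have h3 : dens n r.-1 #|cl (psi v) :\: link E v| + b <= b2.
    have [vB|vB] := boolP (v \in B).
      by have := psi_in v vB vW; move: bound_b2; set p := dens _ _ _; clear; lra.
    have := few0 v; rewrite in_setC vB psi_out // => /(_ isT).
    by move: bg; set p := dens _ _ _; clear; lra.
  by move: h1 h2 h3 hB; clear; lra.
have rb2 : 0 <= rr * b2 by rewrite mulr_ge0 // ltW.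
have as0 : 0 < a - s by move: sb a0; clear; lra.
apply: (@local_gain V E r m S psi W lam (a + s) (a - s) b2 (w - eta) gam) => //; first exact: ltW.
- rewrite rhoE; pose q : rat := (4 * RR)^-1.
  have q0 : 0 < q by rewrite invr_gt0 mulr_gt0.
  have q1 : q <= 1 by rewrite invf_le1 ?mulr_gt0 //; move: RR0; clear; lra.
  have zE : a / (24 * RR) = a * q / 6 by rewrite /q; field; rewrite gt_eqF.
  have h : (1 + q) * (a - 2 * (a * q / 6)) <= (1 + q) * (a - s - rr * b2).
    apply: ler_wpM2l; first by move: q0; clear; lra.
    by move: sa b2b; rewrite zE; set x := a * q / 6; clear; lra.
  apply: le_trans h; have : 0 <= (a * q) * (1 - q) by rewrite !mulr_ge0 ?subr_ge0 // ltW.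
  have e1 : (1 + q) * (a - 2 * (a * q / 6)) = a + 2 * (a * q / 6) + (a * q) * (1 - q) / 3 by field.
  rewrite e1; move: sa b2b; rewrite zE; set x := a * q / 6; set y := a * q * (1 - q); clear; lra.
- rewrite rhoE; have h : kap <= (a - s) ^+ r.
    by apply: lerXn2r; rewrite ?nnegrE; [exact: ltW | exact: ltW | rewrite /lam; move: sb; clear; lra].
  have e1 : r%:R * (rr * b2) = RR * rr * b2 by rewrite mulrA.
  by move: h b2a b2c; rewrite e1; set x := RR * rr * b2; clear; lra.
- by move=> v /setIdP[_ /ltW].
- have h : bq * (a ^+ r.-1 - R1 * s) <= bq * (a - s) ^+ r.-1.
    apply: ler_wpM2l => //; apply: expr_sub_ge; [exact: ltW | | move: a2; clear; lra].
    by move: as0; clear; lra.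
  have e1 : bq * (a ^+ r.-1 - R1 * s) = w - bq * R1 * s by rewrite -wE; ring.
  by move: h sc gb; rewrite e1 -/bq; set x := bq * R1 * s; clear; lra.
- exact: ltW.
Qed.

(** * Stability for graphs free of Sigma *)

Lemma structured_le r m (e1 e2 : rat) (V : finType) (E : {set {set V}}) :
  e1 <= e2 -> structured r m e1 E -> structured r m e2 E.
Proof.
move=> e12 [S [phi [stS miss bal]]]; exists S, phi; split => //; first exact: le_trans e12.
by move=> i; apply: le_trans (bal i) e12.
Qed.

(** A counterexample of maximal potential cannot be symmetrized.  A symmetrisation step E' of it
    is structured; by local stability and the upper bound on the density the number of missing
    edges of E' is at most a constant times delta, which leaves room for the edges through the
    changed vertex v. *)
Theorem stability r m : witt_pair r m -> forall eps : rat, 0 < eps ->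
  exists2 delta : rat, 0 < delta & exists n0 : nat, forall (V : finType) (E : {set {set V}}),
    (n0 <= #|V|)%N -> unif r E -> Sfree E ->
    witt_density r m - delta <= dens #|V| r #|E| -> structured r m eps E.
Proof.
move=> wp eps eps0; have [s0 [er sm]] := witt_pairP wp.
have r2 : (1 < r)%N by rewrite er.
have r0 : (0 < r)%N by rewrite er.
have [e1 [gam [e10 gam0 [n1 local]]]] := local_stability wp.
pose e := Num.min eps e1; have e0 : 0 < e by rewrite lt_min eps0 e10.
have eeps : e <= eps by rewrite ge_min lexx.
have ee1 : e <= e1 by rewrite ge_min lexx orbT.
have [d1 d10 [n2 bal]] := pullback_balanced wp e0.
have [d2 d20 [n3 sym]] := symmetrized_structured wp e0.
have [delta delta0 /= /and4P[da db dc _]] := @exists_small [:: (1, d1); (1, d2); (2, gam * (e / 2))]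
  (ltac:(by rewrite /= ?ler01 d10 d20 !mulr_gt0)).
rewrite mul1r in da; rewrite mul1r in db.
have [n4 upper] := Sfree_upper wp delta0.
have e20 : 0 < e / 2 by rewrite divr_gt0.
have [n5 [n50 small]] := dens_small 1 e20.
exists delta => //; exists (n1 + n2 + n3 + n4 + n5)%N => V E0 hn uE0 fE0 dE0.
have [h1 h2 h3 h4 h5] : [/\ (n1 <= #|V|)%N, (n2 <= #|V|)%N, (n3 <= #|V|)%N, (n4 <= #|V|)%N & (n5 <= #|V|)%N].
  by move: hn; move: #|V| => k; clear; split; lia.
apply: structured_le eeps _; apply: contrapT => nst.
pose X (E : {set {set V}}) := [/\ unif r E, Sfree E, witt_density r m - delta <= dens #|V| r #|E| & ~ structured r m e E].
have [|E [uE fE dE nE] max] := @exists_max_potential V X E0; first by split.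
have [sE|] := pselect (symmetrized E).
  by apply: nE; apply: sym => //; move: db dE; set x := dens _ _ _; clear; lra.
case/not_symmetrized => u [v [uv cz pz]].
pose E' := zykov u v E.
have uE' : unif r E' by exact: zykov_unif.
have fE' : Sfree E' by exact: zykov_Sfree uE fE.
have dE' : witt_density r m - delta <= dens #|V| r #|E'| by apply: le_trans dE _; exact: dens_le.
have : structured r m e E'.
  by apply: contrapT => nE'; have := max E' (And4 uE' fE' dE' nE'); rewrite leqNgt pz.
case=> S [phi [stS miss bphi]]; apply: nE.
have [|i|psi [low gain]] := local V E' S phi h1 uE' (Sfree_Tfree fE') stS.
- exact: le_trans miss ee1.
- exact: le_trans (bphi i) ee1.
exists S, psi; split => //.
  have up := upper V _ h4 (@pullback_unif _ _ r psi S) (pullback_Sfree (phi := psi) r2 stS.1).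
  have m1 : dens #|V| r #|pullback r psi S :\: E'| <= e / 2.
    rewrite -(ler_pM2l gam0); apply: le_trans dc; move: up gain dE'.
    by set x := gam * _; set y := dens _ _ _; set z := dens _ _ _; clear; lra.
  have m2 : dens #|V| r #|[set x in pullback r psi S | ~~ [disjoint x & [set v]]]| <= dens #|V| 1 #|[set v]|.
    apply: dens_meeting; [by apply: leq_trans h5 | by [] | |]; last by move=> x /setIdP[].
    by move=> x /setIdP[/pullback_unif].
  rewrite cards1 in m2; have := small _ h5.
  have sub : pullback r psi S :\: E \subset (pullback r psi S :\: E') :|: [set x in pullback r psi S | ~~ [disjoint x & [set v]]].
    apply/subsetP => x /setDP[xK xE]; rewrite in_setU in_setD xK andbT.
    have [dj|dj] := boolP [disjoint x & [set v]]; apply/orP; [left | right]; last by apply/setIdP.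
    have vx : v \notin x by rewrite disjoint_sym disjoints1 in dj.
    by rewrite !inE (negbTE xE) (negbTE vx).
  have := dens_le #|V| r (leq_trans (subset_leq_card sub) (leq_card_setU _ _)); rewrite densD.
  by move: m1 m2; clear; lra.
apply: (bal V psi S h2 stS.1 low); apply: le_trans (_ : dens #|V| r #|E'| <= _).
  by move: da dE'; set x := dens _ _ _; clear; lra.
apply: le_trans gain; rewrite lerDl; apply: mulr_ge0; [exact: ltW | exact: dens_ge0].
Qed.

(** * Exact structure of extremal graphs *)

Section RichPairs.
Variables (V : finType) (r : nat) (E : {set {set V}}).
Hypotheses (r3 : (3 <= r)%N) (uE : unif r E).

(** An edge through any other pair can be chosen to avoid r given vertices outside the pair. *)
Definition thin_pairs := [set p : V * V | (p.1 != p.2) && (codeg E p.1 p.2 <= r * #|V| ^ (r - 3))%N].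
Definition rich_edges := [set e in E | [forall p in thin_pairs, ~~ ((p.1 \in e) && (p.2 \in e))]].

Lemma rich_edges_sub : rich_edges \subset E.
Proof. by apply/subsetP => e /setIdP[]. Qed.

(** A member of Sigma_r among the rich edges can be turned into a generalized triangle, as its
    third edge may be replaced by one that avoids the common part of the first two. *)
Lemma rich_edges_Sfree : Tfree E -> Sfree rich_edges.
Proof.
move=> tE I a b D /setIdP[aI _] /setIdP[bI _] /setIdP[DE /forallP rD] aI0 bI0 ab aD bD.
have := rD (a, b); rewrite !inE /= ab aD bD /= implybF -ltnNge => rich.
have cI : (#|I| <= r)%N by rewrite -(uE aI) cardsU1 aI0 leqnSn.
have [D' [D'E aD' bD' dis]] := codeg_avoid uE ab rich cI aI0 bI0.
exact: (tE I a b D').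
Qed.

Lemma dens_thin_edges : (0 < #|V|)%N -> dens #|V| r #|E :\: rich_edges| <= dens #|V| 1 r.
Proof.
move=> n0; have h : (#|E :\: rich_edges| <= r * #|V| ^ r.-1)%N.
  apply: leq_trans (_ : (\sum_(p in thin_pairs) codeg E p.1 p.2 <= _)%N).
    rewrite (eq_bigr (fun p : V * V => \sum_(e in E | (p.1 \in e) && (p.2 \in e)) 1)%N); last first.
      by move=> p _; rewrite /codeg -sum1_card; apply: eq_bigl => e; rewrite inE.
    rewrite (exchange_big_dep (mem E)) /=; last by move=> p e _ /andP[].
    rewrite -sum1_card [X in (X <= _)%N](eq_bigl (fun e : {set V} => (e \in E) && (e \notin rich_edges))); last first.
      by move=> e; rewrite in_setD andbC.
    rewrite [X in (X <= _)%N]big_mkcondr; apply: leq_sum => e eE; case: ifP => // er.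
    have : ~~ [forall p in thin_pairs, ~~ ((p.1 \in e) && (p.2 \in e))].
      by apply: contra er => h; apply/setIdP.
    rewrite negb_forall => /existsP[p]; rewrite negb_imply negbK => /and3P[pt p1 p2].
    by rewrite (bigD1 p) ?pt ?eE ?p1 ?p2.
  apply: leq_trans (_ : (\sum_(p in thin_pairs) r * #|V| ^ (r - 3) <= _)%N).
    by apply: leq_sum => p; rewrite inE => /andP[].
  rewrite sum_nat_const mulnCA leq_mul2l; apply/orP; right.
  have -> : r.-1 = (2 + (r - 3))%N by lia.
  by rewrite expnD leq_mul2r -mulnn -card_prod max_card orbT.
apply: le_trans (dens_le _ _ h) _.
have {1}-> : r = (1 + r.-1)%N by lia.
by rewrite densXpow.
Qed.

End RichPairs.

(** The parts are the residue classes modulo m of the rank. *)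
Lemma even_map (V : finType) m : (0 < m)%N -> exists phi : V -> 'I_m,
  forall i, (#|V| %/ m <= #|part phi i|)%N.
Proof.
move=> m0; pose phi (v : V) := Ordinal (ltn_pmod (enum_rank v : nat) m0); exists phi => i.
have lt (j : 'I_(divn #|V| m)) : (j * m + i < #|V|)%N.
  apply: leq_trans (leq_divM #|V| m); apply: leq_trans (_ : (j.+1 * m <= _)%N).
    by rewrite mulSn addnC ltn_add2r.
  by rewrite leq_mul2r ltn_ord orbT.
have inj : injective (fun j => enum_val (Ordinal (lt j))).
  move=> j k /enum_val_inj [] /eqP; rewrite eqn_add2r eqn_pmul2r // => /eqP; exact: val_inj.
rewrite -[X in (X <= _)%N]card_ord -(card_imset _ inj); apply: subset_leq_card.
apply/subsetP => v /imsetP[j _ ->]; rewrite in_part; apply/eqP/val_inj => /=.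
by rewrite enum_valK /= modnMDl modn_small.
Qed.

Lemma even_pullback r m (S : {set {set 'I_m}}) : witt_pair r m -> steiner_family r S ->
  forall delta : rat, 0 < delta -> exists n0 : nat, forall V : finType, (n0 <= #|V|)%N ->
  exists phi : V -> 'I_m, witt_density r m - delta <= dens #|V| r #|pullback r phi S|.
Proof.
move=> wp stS delta d0; have [s0 [er sm]] := witt_pairP wp.
have r3 : (3 <= r)%N by rewrite er.
have r0 : (0 < r)%N by rewrite er.
have rm : (r < m)%N by rewrite er.
have m0 : (0 < m)%N by apply: leq_trans rm.
have r1 : r.-1.+1 = r by rewrite er.
clear s0 er sm; pose a : rat := m%:R^-1.
have a0 : 0 < a by rewrite invr_gt0 ltr0n.
have a1 : a <= 1 by rewrite invf_le1 ?ltr0n // ler1n.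
have bq0 : 0 <= blocks_at r m by rewrite divr_ge0 ?ler0n.
have [t t0 /= /and3P[ta tb _]] := @exists_small [:: (1, a / 2); (blocks_at r m * r.-1%:R, r%:R * delta)]
  (ltac:(by rewrite /= ?ler01 divr_gt0 // mulr_ge0 ?ler0n // mulr_gt0 // ltr0n)).
rewrite mul1r in ta.
have [n0 [n00 small]] := dens_small 1 t0.
exists n0 => V hn; have [phi hphi] := even_map V m0; exists phi.
have nV : 0 < #|V|%:R :> rat by rewrite ltr0n; apply: leq_trans hn.
have low i : a - t <= dens #|V| 1 #|part phi i|.
  apply: le_trans (dens_le _ _ (hphi i)); have := small _ hn; rewrite /dens expr1.
  have h : #|V|%:R * a <= (#|V| %/ m)%:R + 1 :> rat.
    rewrite /a ler_pdivrMr ?ltr0n // natr1 -natrM ler_nat.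
    by have := ltn_ceil #|V| m0; move=> /ltnW.
  rewrite ler_pdivrMr // ler_pdivlMr // mulrBl [a * _]mulrC; move: h.
  set y := #|V|%:R * a; set z := #|V|%:R * t; set x := (_ %/ _)%:R; clear; lra.
have at0 : 0 <= a - t by move: ta a0; clear; lra.
have ex i : exists v, phi v = i.
  have : (0 < #|part phi i|)%N.
    rewrite lt0n; apply/negP => /eqP p0; have := low i; rewrite p0 /dens mul0r; move: ta a0; clear; lra.
  by case/card_gt0P => v; rewrite in_part => /eqP; exists v.
have deg v : blocks_at r m * (a - t) ^+ r.-1 <= dens #|V| r.-1 #|link (pullback r phi S) v|.
  rewrite (link_pullback phi v r0 stS.1).
  have -> : class_link r S phi (phi v) = [set I in class_link r S phi (phi v) | I \subset setT].
    by apply/setP => I; rewrite [RHS]inE subsetT andbT.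
  by apply: dens_class_link_inside_ge => // j; rewrite setTI.
have tot : r%:R * dens #|V| r #|pullback r phi S| = #|V|%:R^-1 * \sum_v dens #|V| r.-1 #|link (pullback r phi S) v|.
  have := sum_link (@pullback_unif _ _ r phi S) => /(congr1 (dens #|V| r)).
  have -> : dens #|V| r (r * #|pullback r phi S|) = r%:R * dens #|V| r #|pullback r phi S|.
    by rewrite /dens natrM mulrA.
  rewrite dens_sum => <-.
  by rewrite mulr_sumr; apply: eq_bigr => v _; move: #|link _ _| => x; rewrite /dens -{1}r1 exprS invfM mulrCA.
have : #|V|%:R^-1 * \sum_(v : V) (blocks_at r m * (a - t) ^+ r.-1) <= r%:R * dens #|V| r #|pullback r phi S|.
  rewrite tot; apply: ler_wpM2l; first by rewrite invr_ge0 ler0n.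
  by apply: ler_sum.
have avg (c : rat) : #|V|%:R^-1 * \sum_(v : V) c = c.
  by rewrite sumr_const -(mulr_natl c) mulrA mulVf ?mul1r // gt_eqF.
rewrite avg.
have : blocks_at r m * (a ^+ r.-1 - r.-1%:R * t) <= blocks_at r m * (a - t) ^+ r.-1.
  by apply: ler_wpM2l => //; apply: expr_sub_ge => //; [exact: ltW | move: at0; clear; lra].
rewrite mulrBr mulrA (blocks_at_degree r3 rm) -(witt_density_unfold wp) => h1 h2.
have := le_trans h1 h2; move: tb; set x := _ * t => tb h3.
have : r%:R * (witt_density r m - delta) <= r%:R * dens #|V| r #|pullback r phi S|.
  by rewrite mulrBr; apply: le_trans h3; rewrite lerD2l lerN2.
by rewrite ler_pM2l // ltr0n.
Qed.

(** E is as dense as the balanced blow-up of S0, so after the deletion of its few thin edges it is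
    structured by the stability theorem.  Then local stability gives a blow-up with at least |E|
    edges, and strictly more if any of its edges is missing from E. *)
Theorem exact_structure r m (S0 : {set {set 'I_m}}) : witt_pair r m -> steiner_family r S0 ->
  exists n0 : nat, forall (V : finType) (E : {set {set V}}), (n0 <= #|V|)%N ->
  unif r E -> Tfree E ->
  (forall (phi : V -> 'I_m) S, steiner_family r S -> (#|pullback r phi S| <= #|E|)%N) ->
  exists (S : {set {set 'I_m}}) (phi : V -> 'I_m),
    [/\ steiner_family r S, forall i, exists v, phi v = i & E = pullback r phi S].
Proof.
move=> wp stS0; have [s0 [er sm]] := witt_pairP wp.
have r3 : (3 <= r)%N by rewrite er.
have m0 : (0 < m)%N by apply: leq_trans sm.
have [e1 [gam [e10 gam0 [n1 local]]]] := local_stability wp.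
have e12 : 0 < e1 / 2 by rewrite divr_gt0.
have [d d0 [n2 stab]] := stability wp e12.
have d2 : 0 < d / 2 by rewrite divr_gt0.
have [n3 even] := even_pullback wp stS0 d2.
have [n4 [n40 small]] := dens_small r d2.
exists (n1 + n2 + n3 + n4)%N => V E hn uE tE big.
have [h1 h2 h3 h4] : [/\ (n1 <= #|V|)%N, (n2 <= #|V|)%N, (n3 <= #|V|)%N & (n4 <= #|V|)%N].
  by move: hn; move: #|V| => k; clear; split; lia.
have nV : (0 < #|V|)%N by apply: leq_trans h4.
pose E' := rich_edges r E.
have sE' : E' \subset E by exact: rich_edges_sub.
have uE' : unif r E' by move=> e /(subsetP sE')/uE.
have [phi0 hphi0] := even V h3.
have lowE : witt_density r m - d / 2 <= dens #|V| r #|E| by apply: le_trans hphi0 (dens_le _ _ (big _ _ stS0)).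
have thin := le_trans (dens_thin_edges E r3 nV) (small _ h4).
have cE : dens #|V| r #|E| = dens #|V| r #|E'| + dens #|V| r #|E :\: E'|.
  by rewrite -densD -(cardsID E' E) (setIidPr sE').
have [|S [phi [stS miss bal]]] := stab V E' h2 uE' (rich_edges_Sfree uE tE).
  by move: lowE thin; rewrite cE -/E'; set x := dens _ _ _; set y := dens _ _ _; clear; lra.
have [||psi [low gain]] := local V E S phi h1 uE tE stS.
- apply: le_trans (_ : dens #|V| r #|pullback r phi S :\: E'| <= _).
    by apply: dens_le; apply: subset_leq_card; exact: setDS.
  by apply: le_trans miss _; move: e10; clear; lra.
- by move=> i; apply: le_trans (bal i) _; move: e10; clear; lra.
exists S, psi; split => //.
  move=> i; have : (0 < #|part psi i|)%N.
    rewrite lt0n; apply/negP => /eqP p0; have := low i; rewrite p0 /dens mul0r leNgt divr_gt0 // invr_gt0 ltr0n //.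
  by case/card_gt0P => v; rewrite in_part => /eqP; exists v.
apply/eqP; rewrite eq_sym eqEcard; apply/andP; split.
  rewrite -setD_eq0 -cards_eq0; apply/negPn/negP => miss0.
  have : 0 < gam * dens #|V| r #|pullback r psi S :\: E|.
    apply: mulr_gt0 => //; apply: divr_gt0; first by rewrite ltr0n lt0n.
    by apply: exprn_gt0; rewrite ltr0n.
  have := dens_le #|V| r (big psi S stS); move: gain.
  by set x := gam * _; set y := dens _ _ _; set z := dens _ _ _; clear; lra.
have : dens #|V| r #|E| <= dens #|V| r #|pullback r psi S|.
  apply: le_trans gain; rewrite lerDl; apply: mulr_ge0; [exact: ltW | exact: dens_ge0].
by rewrite /dens ler_pM2r ?invr_gt0 ?exprn_gt0 ?ltr0n // ler_nat.
Qed.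

(** * A checked search for embeddings of a Steiner system *)

Local Close Scope ring_scope.

Section Masks.
Variable n : nat.

(** Sets of points are represented by lists of n booleans, which makes intersections cheap to
    compute. *)
Definition mask_of (l : seq nat) : seq bool := [seq i \in l | i <- iota 0 n].
Definition bset (b : seq bool) : {set 'I_n} := [set i : 'I_n | nth false b i].

Fixpoint meet (b c : seq bool) : nat :=
  match b, c with
  | x :: b', y :: c' => if x && y then (meet b' c').+1 else meet b' c'
  | _, _ => 0
  end.

Lemma size_mask_of l : size (mask_of l) = n.
Proof. by rewrite size_map size_iota. Qed.

Lemma in_bset b i : (i \in bset b) = nth false b i.
Proof. by rewrite inE. Qed.

Lemma in_bset_mask l (i : 'I_n) : (i \in bset (mask_of l)) = (val i \in l).
Proof. by rewrite inE (nth_map 0) ?size_iota // nth_iota. Qed.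

Lemma bset_mask_of_cons (x : 'I_n) l : bset (mask_of (val x :: l)) = x |: bset (mask_of l).
Proof. by apply/setP => i; rewrite in_setU1 !in_bset_mask inE. Qed.

Lemma card_bset_mask l : uniq l -> all (fun x => x < n) l -> #|bset (mask_of l)| = size l.
Proof.
elim: l => [_ _|x l IH /andP[xl ul] /andP[xn ln]].
  by apply/eqP; rewrite cards_eq0; apply/eqP/setP => i; rewrite in_bset_mask inE.
by rewrite (bset_mask_of_cons (Ordinal xn)) cardsU1 in_bset_mask xl IH.
Qed.

End Masks.

Lemma card_bset_meet n b c : size b <= n -> #|bset n b :&: bset n c| = meet b c.
Proof.
rewrite -sum1_card; have -> : \sum_(i | i \in bset n b :&: bset n c) 1 = \sum_(i < n) (nth false b i && nth false c i).
  by rewrite big_mkcond; apply: eq_bigr => i _; rewrite in_setI !in_bset; case: ifP.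
elim: b c n => [|x b IH] [|y c] [|n] //= hs.
- by rewrite big_ord0.
- by rewrite big1 // => i _; rewrite nth_nil.
- by rewrite big_ord0.
- by rewrite big1 // => i _; rewrite nth_nil.
- by rewrite big1 // => i _; rewrite nth_nil andbF.
rewrite big_ord_recl /= (eq_bigr (fun i : 'I_n => nat_of_bool (nth false b i && nth false c i))) //.
by rewrite IH //; case: (x && y).
Qed.

Section Search.
Variables (n r : nat) (std : seq (seq bool)).

(** [Split A ts] branches over the point x that completes the set A of size r-1 to a block, with a
    subtree for the values x listed in ts; at [Leaf tau] the relabelling tau maps the blocks found
    so far onto the standard ones. *)
Inductive tree := Leaf of seq nat | Split of seq nat & seq (nat * tree).

(** Points in no known block are interchangeable. *)
Definition fresh (K : seq (seq bool)) (A : seq nat) x :=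
  (x \notin A) && all (fun b => ~~ nth false b x) K.

Definition conflict (K : seq (seq bool)) (B : seq bool) := has (fun b => meet b B == r.-1) K.

(** The value x needs no subtree of its own if it belongs to A, if the new block would meet a
    known block in r-1 points, or if it is fresh and another fresh value has a subtree. *)
Definition handled K A (xs : seq nat) x :=
  [|| x \in A, x \in xs, conflict K (mask_of n (x :: A)) | fresh K A x && has (fresh K A) xs].

Definition permute_mask (tau : seq nat) (b : seq bool) := [seq nth false b i | i <- tau].

Fixpoint check (K : seq (seq bool)) (t : tree) : bool :=
  match t with
  | Leaf tau => [&& size tau == n, uniq tau, all (fun i => i < n) tau
                  & all (fun b => permute_mask tau b \in K) std]
  | Split A ts => [&& size A == r.-1, uniq A, all (fun i => i < n) A,
                  all (fun p => (p.1 < n) && check (mask_of n (p.1 :: A) :: K) p.2) ts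
                & all (handled K A (unzip1 ts)) (iota 0 n)]
  end.

(** The hypothesis under which a node of the search is explored: S contains the blocks in K. *)
Definition known (S : {set {set 'I_n}}) (K : seq (seq bool)) :=
  forall b, b \in K -> size b = n /\ bset n b \in S.

Definition contains_std (S : {set {set 'I_n}}) := exists2 f : 'I_n -> 'I_n, injective f &
  forall b, b \in std -> f @^-1: bset n b \in S.

Lemma steiner_transport (C D : finType) (g : C -> D) (S : {set {set D}}) : bijective g ->
  steiner_family r S -> steiner_family r [set e : {set C} | g @: e \in S].
Proof.
move=> bg [[uS pS] cov]; have ig := bij_inj bg; case: (bg) => h gK hK.
split; [split|].
- by move=> e; rewrite inE => /uS; rewrite card_imset.
- move=> e f; rewrite !inE => eS fS ef; have := pS _ _ eS fS; rewrite (inj_eq (imset_inj ig)) => /(_ ef).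
  by rewrite -imsetI; [rewrite card_imset | move=> x y _ _; exact: ig].
apply/eqP; rewrite -subset0; apply/subsetP => A; rewrite inE => /andP[cA /forallP nA].
have := in_set0 (g @: A); rewrite -cov inE card_imset // cA /= => /negbT /negP[].
apply/forallP => i; apply/implyP => iA; have := nA (h i).
rewrite inE imsetU1 hK; move/implyP; apply; apply: contra iA => hA.
by rewrite -(hK i); apply: imset_f.
Qed.

(** Induction on the tree.  For a fresh completion y without subtree, S is replaced by its image
    under the transposition of y and the fresh value x that has one, which fixes the known blocks.
    *)
Lemma check_sound t K S : 0 < r -> check K t -> steiner_family r S -> known S K -> contains_std S.
Proof.
move=> r0; move: t K S; fix IH 1 => -[tau|A ts] K S.
  move=> /and4P[/eqP st ut /allP lt /allP hK] _ kn.
  have hn (i : 'I_n) : nth 0 tau i < n by apply: lt; apply: mem_nth; rewrite st.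
  exists (fun i => Ordinal (hn i)).
    move=> i j [] /eqP; rewrite nth_uniq ?st // => /eqP; exact: val_inj.
  move=> b /hK /kn[_]; congr (_ \in S); apply/setP => i; rewrite !inE (nth_map 0) ?st //.
case/and5P => /eqP sA uA lA cts /allP hA stS kn.
have cA : #|bset n (mask_of n A)| = r.-1 by rewrite card_bset_mask.
have child x (S' : {set {set 'I_n}}) : x \in unzip1 ts -> steiner_family r S' -> known S' K ->
    bset n (mask_of n (x :: A)) \in S' -> contains_std S'.
  move: cts; clear -IH; move=> cts xts stS' kn' xS; elim: ts cts xts => // -[y t] ts IHts /= /andP[/andP[_ ct] cts].
  rewrite inE => /orP[/eqP exy|]; last exact: IHts.
  apply: (IH t _ _ ct stS'); move=> b; rewrite inE => /orP[/eqP ->|]; last exact: kn'.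
  by rewrite size_mask_of -exy.
have [x xA xS] := completion stS cA.
have := hA (val x); rewrite mem_iota ltn_ord => /(_ isT) /or4P[].
- by rewrite -in_bset_mask (negbTE xA).
- by move=> xts; apply: (child (val x)) => //; rewrite bset_mask_of_cons.
- case/hasP => b bK /eqP mb; have [sb bS] := kn b bK.
  have cm := card_bset_meet (mask_of n (val x :: A)) (eq_leq sb).
  rewrite bset_mask_of_cons mb in cm.
  have ne : bset n b != x |: bset n (mask_of n A).
    apply/eqP => e; move: cm; rewrite e setIid (stS.1.1 _ xS).
    by case: (r) r0 => // k _ /= /esym/n_Sn.
  by have := stS.1.2 _ _ bS xS ne; rewrite cm; case: (r) r0 => // k _ /=; rewrite addn2 ltnn.
case/andP => /andP[xA' xK] /hasP[y yts /andP[yA yK]].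
have /allP/(_ y yts) yn : all (fun x => x < n) (unzip1 ts) by rewrite all_map; apply: sub_all cts => p /andP[].
pose y' := Ordinal yn; pose g := tperm x y'.
have gfix b : ~~ nth false b x -> ~~ nth false b y -> g @: bset n b = bset n b.
  move=> hx hy; rewrite -[RHS](imset_id (bset n b)); apply: eq_in_imset => i ib.
  by apply: tpermD; apply: contraTneq ib => <-; rewrite in_bset.
have xm : ~~ nth false (mask_of n A) x by rewrite -in_bset in_bset_mask.
have ym : ~~ nth false (mask_of n A) y by rewrite -[y]/(val y') -in_bset in_bset_mask.
pose S' := [set e : {set 'I_n} | g @: e \in S].
have stS' : steiner_family r S'.
  by apply: steiner_transport stS; exists g => i; rewrite tpermK.
have [||f inf hf] := child y S' yts stS'.
- move=> b bK; have [sb bS] := kn b bK; split => //.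
  by rewrite inE gfix //; [apply: (allP xK) | apply: (allP yK)].
- by rewrite (bset_mask_of_cons y') inE imsetU1 tpermR gfix.
exists (fun i => f (g i)); first by move=> i j /inf /perm_inj.
move=> b /hf; rewrite inE; congr (_ \in S); apply/setP => i; rewrite !inE.
rewrite -{1}[i](tpermK x y') mem_imset ?inE //; exact: perm_inj.
Qed.

End Search.

(** * The search trees for S(4,5,11) and S(5,6,12) *)

(** A sequence of sets that have only one possible completion. *)
Definition forced (As : seq (seq nat * nat)) (t : tree) := foldr (fun p t => Split p.1 [:: (p.2, t)]) t As.

(** The six base blocks are developed modulo 11. *)
Definition blocks11 : seq (seq nat) :=
  [seq [seq (x + t) %% 11 | x <- b] | b <- [:: [:: 0; 1; 2; 3; 5]; [:: 0; 1; 2; 6; 9]; [:: 0; 1; 2; 7; 8]; [:: 0; 1; 3; 4; 7]; [:: 0; 1; 3; 6; 8]; [:: 0; 1; 5; 7; 9]], t <- iota 0 11].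

(** The extension of S(4,5,11) by one point: its blocks with the new point, and their complements.
    *)
Definition blocks12 : seq (seq nat) :=
  [seq rcons b 11 | b <- blocks11] ++ [seq [seq i <- iota 0 11 | i \notin b] | b <- blocks11].

(** The automorphism group of S(4,5,11) is sharply transitive on ordered quadruples, so the choice
    of 0, 1, 2, 3 is free, and the six leaves correspond to the choices of the point 5 off the
    block of 0, 1, 2, 3. *)
Definition search11 : tree :=
  (forced [:: ([:: 0; 1; 2; 3], 4); ([:: 0; 1; 2; 5], 6); ([:: 0; 1; 3; 5], 7); ([:: 0; 1; 2; 7], 8)]
    (Split [:: 0; 1; 3; 6] [::
   (8, (forced [:: ([:: 0; 1; 2; 9], 10)]
      (Split [:: 0; 1; 3; 9] [::])));
   (9, (forced [:: ([:: 0; 1; 2; 9], 10); ([:: 0; 1; 3; 8], 10); ([:: 0; 1; 5; 10], 4); ([:: 0; 1; 5; 8], 9); 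
       ([:: 0; 1; 4; 8], 6); ([:: 0; 1; 4; 7], 9); ([:: 0; 1; 6; 7], 10)]
      (Split [:: 0; 2; 3; 5] [::
     (8, (forced [:: ([:: 0; 2; 3; 9], 7); ([:: 0; 2; 3; 6], 10); ([:: 0; 2; 5; 9], 4); ([:: 0; 2; 4; 6], 7); ([:: 0; 2; 4; 8], 10); 
         ([:: 0; 2; 5; 7], 10); ([:: 0; 2; 6; 8], 9); ([:: 0; 3; 4; 5], 6); ([:: 0; 3; 5; 9], 10); ([:: 0; 3; 4; 9], 8); 
         ([:: 0; 3; 4; 7], 10); ([:: 0; 3; 6; 7], 8); ([:: 0; 4; 5; 7], 8); ([:: 0; 4; 6; 9], 10); ([:: 0; 5; 6; 7], 9); 
         ([:: 0; 5; 6; 8], 10); ([:: 0; 7; 8; 9], 10)]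
        (Split [:: 1; 2; 3; 5] [::
       (9, (forced [:: ([:: 1; 2; 3; 8], 6); ([:: 1; 2; 3; 7], 10); ([:: 1; 2; 4; 7], 5); ([:: 1; 2; 4; 8], 9); ([:: 1; 2; 4; 6], 10); 
           ([:: 1; 2; 5; 8], 10); ([:: 1; 2; 6; 7], 9); ([:: 1; 3; 4; 5], 8); ([:: 1; 3; 4; 6], 7); ([:: 1; 3; 4; 9], 10); 
           ([:: 1; 3; 5; 6], 10); ([:: 1; 3; 7; 8], 9); ([:: 1; 4; 5; 6], 9); ([:: 1; 4; 7; 8], 10); ([:: 1; 5; 6; 7], 8); 
           ([:: 1; 5; 7; 9], 10); ([:: 1; 6; 8; 9], 10); ([:: 2; 3; 4; 5], 10); ([:: 2; 3; 4; 6], 9); 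
           ([:: 2; 3; 4; 7], 8); ([:: 2; 3; 5; 6], 7); ([:: 2; 3; 8; 9], 10); ([:: 2; 4; 5; 6], 8); ([:: 2; 4; 7; 9], 10); 
           ([:: 2; 5; 6; 9], 10); ([:: 2; 5; 7; 8], 9); ([:: 2; 6; 7; 8], 10); ([:: 3; 4; 5; 7], 9); 
           ([:: 3; 4; 6; 8], 10); ([:: 3; 5; 6; 8], 9); ([:: 3; 5; 7; 8], 10); ([:: 3; 6; 7; 9], 10); 
           ([:: 4; 5; 6; 7], 10); ([:: 4; 5; 8; 9], 10); ([:: 4; 6; 7; 8], 9)]
          (Leaf [:: 0; 1; 2; 3; 5; 10; 4; 9; 6; 7; 8])));
       (10, (forced [:: ([:: 1; 2; 3; 7], 6); ([:: 1; 2; 3; 8], 9); ([:: 1; 2; 4; 8], 5); ([:: 1; 2; 4; 7], 10); ([:: 1; 2; 4; 6], 9); 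
           ([:: 1; 2; 5; 7], 9); ([:: 1; 2; 6; 8], 10); ([:: 1; 3; 4; 5], 9); ([:: 1; 3; 4; 6], 10); ([:: 1; 3; 4; 7], 8); 
           ([:: 1; 3; 5; 6], 8); ([:: 1; 3; 7; 9], 10); ([:: 1; 4; 5; 6], 7); ([:: 1; 4; 8; 9], 10); 
           ([:: 1; 5; 6; 9], 10); ([:: 1; 5; 7; 8], 10); ([:: 1; 6; 7; 8], 9); ([:: 2; 3; 4; 5], 7); ([:: 2; 3; 4; 6], 8); 
           ([:: 2; 3; 4; 9], 10); ([:: 2; 3; 5; 6], 9); ([:: 2; 3; 7; 8], 10); ([:: 2; 4; 5; 6], 10); 
           ([:: 2; 4; 7; 8], 9); ([:: 2; 5; 6; 7], 8); ([:: 2; 5; 8; 9], 10); ([:: 2; 6; 7; 9], 10); 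
           ([:: 3; 4; 5; 8], 10); ([:: 3; 4; 6; 7], 9); ([:: 3; 5; 6; 7], 10); ([:: 3; 5; 7; 8], 9); 
           ([:: 3; 6; 8; 9], 10); ([:: 4; 5; 6; 8], 9); ([:: 4; 5; 7; 9], 10); ([:: 4; 6; 7; 8], 10)]
          (Leaf [:: 0; 1; 2; 3; 5; 4; 10; 7; 8; 9; 6])))])));
     (9, (forced [:: ([:: 0; 2; 3; 8], 6); ([:: 0; 2; 3; 7], 10); ([:: 0; 2; 5; 7], 4); ([:: 0; 2; 5; 8], 10); ([:: 0; 2; 4; 8], 9); 
         ([:: 0; 2; 4; 6], 10); ([:: 0; 2; 6; 7], 9); ([:: 0; 3; 4; 9], 10); ([:: 0; 3; 5; 8], 4); ([:: 0; 3; 4; 6], 7); 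
         ([:: 0; 3; 5; 6], 10); ([:: 0; 3; 7; 8], 9); ([:: 0; 4; 5; 6], 9); ([:: 0; 4; 7; 8], 10); ([:: 0; 5; 6; 7], 8); 
         ([:: 0; 5; 7; 9], 10); ([:: 0; 6; 8; 9], 10)]
        (Split [:: 1; 2; 3; 5] [::
       (8, (forced [:: ([:: 1; 2; 3; 9], 7); ([:: 1; 2; 3; 6], 10); ([:: 1; 2; 4; 5], 9); ([:: 1; 2; 4; 6], 7); ([:: 1; 2; 4; 8], 10); 
           ([:: 1; 2; 5; 7], 10); ([:: 1; 2; 6; 8], 9); ([:: 1; 3; 4; 5], 6); ([:: 1; 3; 4; 9], 8); ([:: 1; 3; 4; 7], 10); 
           ([:: 1; 3; 5; 9], 10); ([:: 1; 3; 6; 7], 8); ([:: 1; 4; 5; 7], 8); ([:: 1; 4; 6; 9], 10); ([:: 1; 5; 6; 7], 9); 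
           ([:: 1; 5; 6; 8], 10); ([:: 1; 7; 8; 9], 10); ([:: 2; 3; 4; 5], 10); ([:: 2; 3; 4; 6], 9); 
           ([:: 2; 3; 4; 7], 8); ([:: 2; 3; 5; 6], 7); ([:: 2; 3; 8; 9], 10); ([:: 2; 4; 5; 6], 8); ([:: 2; 4; 7; 9], 10); 
           ([:: 2; 5; 6; 9], 10); ([:: 2; 5; 7; 8], 9); ([:: 2; 6; 7; 8], 10); ([:: 3; 4; 5; 7], 9); 
           ([:: 3; 4; 6; 8], 10); ([:: 3; 5; 6; 8], 9); ([:: 3; 5; 7; 8], 10); ([:: 3; 6; 7; 9], 10); 
           ([:: 4; 5; 6; 7], 10); ([:: 4; 5; 8; 9], 10); ([:: 4; 6; 7; 8], 9)]
          (Leaf [:: 0; 1; 2; 3; 5; 8; 7; 6; 9; 4; 10])));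
       (10, (forced [:: ([:: 1; 2; 3; 6], 7); ([:: 1; 2; 3; 8], 9); ([:: 1; 2; 4; 6], 9); ([:: 1; 2; 4; 5], 8); ([:: 1; 2; 4; 7], 10); 
           ([:: 1; 2; 5; 7], 9); ([:: 1; 2; 6; 8], 10); ([:: 1; 3; 4; 7], 8); ([:: 1; 3; 4; 9], 5); ([:: 1; 3; 4; 6], 10); 
           ([:: 1; 3; 5; 6], 8); ([:: 1; 3; 7; 9], 10); ([:: 1; 4; 5; 6], 7); ([:: 1; 4; 8; 9], 10); 
           ([:: 1; 5; 6; 9], 10); ([:: 1; 5; 7; 8], 10); ([:: 1; 6; 7; 8], 9); ([:: 2; 3; 4; 5], 6); ([:: 2; 3; 4; 7], 9); 
           ([:: 2; 3; 4; 8], 10); ([:: 2; 3; 5; 7], 8); ([:: 2; 3; 6; 9], 10); ([:: 2; 4; 5; 9], 10); 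
           ([:: 2; 4; 6; 7], 8); ([:: 2; 5; 6; 7], 10); ([:: 2; 5; 6; 8], 9); ([:: 2; 7; 8; 9], 10); 
           ([:: 3; 4; 5; 7], 10); ([:: 3; 4; 6; 8], 9); ([:: 3; 5; 6; 7], 9); ([:: 3; 5; 8; 9], 10); 
           ([:: 3; 6; 7; 8], 10); ([:: 4; 5; 6; 8], 10); ([:: 4; 5; 7; 8], 9); ([:: 4; 6; 7; 9], 10)]
          (Leaf [:: 0; 1; 2; 3; 5; 6; 9; 8; 7; 10; 4])))])));
     (10, (forced [:: ([:: 0; 2; 5; 8], 4); ([:: 0; 2; 4; 9], 6); ([:: 0; 2; 4; 7], 10); ([:: 0; 2; 5; 7], 9); ([:: 0; 2; 3; 7], 6); 
         ([:: 0; 2; 3; 8], 9); ([:: 0; 2; 6; 8], 10); ([:: 0; 3; 4; 7], 8); ([:: 0; 3; 5; 8], 6); ([:: 0; 3; 4; 5], 9); 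
         ([:: 0; 3; 4; 6], 10); ([:: 0; 3; 7; 9], 10); ([:: 0; 4; 5; 6], 7); ([:: 0; 4; 8; 9], 10); 
         ([:: 0; 5; 6; 9], 10); ([:: 0; 5; 7; 8], 10); ([:: 0; 6; 7; 8], 9)]
        (Split [:: 1; 2; 3; 5] [::
       (8, (forced [:: ([:: 1; 2; 3; 6], 10); ([:: 1; 2; 3; 7], 9); ([:: 1; 2; 4; 6], 7); ([:: 1; 2; 4; 5], 9); ([:: 1; 2; 4; 8], 10); 
           ([:: 1; 2; 5; 7], 10); ([:: 1; 2; 6; 8], 9); ([:: 1; 3; 4; 5], 6); ([:: 1; 3; 4; 7], 10); ([:: 1; 3; 4; 8], 9); 
           ([:: 1; 3; 5; 9], 10); ([:: 1; 3; 6; 7], 8); ([:: 1; 4; 5; 7], 8); ([:: 1; 4; 6; 9], 10); ([:: 1; 5; 6; 7], 9); 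
           ([:: 1; 5; 6; 8], 10); ([:: 1; 7; 8; 9], 10); ([:: 2; 3; 4; 5], 7); ([:: 2; 3; 4; 6], 8); 
           ([:: 2; 3; 4; 9], 10); ([:: 2; 3; 5; 6], 9); ([:: 2; 3; 7; 8], 10); ([:: 2; 4; 5; 6], 10); 
           ([:: 2; 4; 7; 8], 9); ([:: 2; 5; 6; 7], 8); ([:: 2; 5; 8; 9], 10); ([:: 2; 6; 7; 9], 10); 
           ([:: 3; 4; 5; 8], 10); ([:: 3; 4; 6; 7], 9); ([:: 3; 5; 6; 7], 10); ([:: 3; 5; 7; 8], 9); 
           ([:: 3; 6; 8; 9], 10); ([:: 4; 5; 6; 8], 9); ([:: 4; 5; 7; 9], 10); ([:: 4; 6; 7; 8], 10)]
          (Leaf [:: 0; 1; 2; 3; 5; 7; 8; 4; 10; 6; 9])));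
       (9, (forced [:: ([:: 1; 2; 3; 7], 10); ([:: 1; 2; 3; 6], 8); ([:: 1; 2; 4; 5], 7); ([:: 1; 2; 4; 6], 10); ([:: 1; 2; 4; 8], 9); 
           ([:: 1; 2; 5; 8], 10); ([:: 1; 2; 6; 7], 9); ([:: 1; 3; 4; 7], 6); ([:: 1; 3; 4; 5], 8); ([:: 1; 3; 4; 9], 10); 
           ([:: 1; 3; 5; 6], 10); ([:: 1; 3; 7; 8], 9); ([:: 1; 4; 5; 6], 9); ([:: 1; 4; 7; 8], 10); ([:: 1; 5; 6; 7], 8); 
           ([:: 1; 5; 7; 9], 10); ([:: 1; 6; 8; 9], 10); ([:: 2; 3; 4; 5], 6); ([:: 2; 3; 4; 7], 9); 
           ([:: 2; 3; 4; 8], 10); ([:: 2; 3; 5; 7], 8); ([:: 2; 3; 6; 9], 10); ([:: 2; 4; 5; 9], 10); 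
           ([:: 2; 4; 6; 7], 8); ([:: 2; 5; 6; 7], 10); ([:: 2; 5; 6; 8], 9); ([:: 2; 7; 8; 9], 10); 
           ([:: 3; 4; 5; 7], 10); ([:: 3; 4; 6; 8], 9); ([:: 3; 5; 6; 7], 9); ([:: 3; 5; 8; 9], 10); 
           ([:: 3; 6; 7; 8], 10); ([:: 4; 5; 6; 8], 10); ([:: 4; 5; 7; 8], 9); ([:: 4; 6; 7; 9], 10)]
          (Leaf [:: 0; 1; 2; 3; 5; 9; 6; 10; 4; 8; 7])))])))])))])).

(** Once the blocks through the new point are known, all others are forced. *)
Definition search12 : tree :=
  forced [seq (behead b, head 0 b) | b <- drop 66 blocks12] (Leaf (iota 0 12)).

Lemma search11_ok : check 11 5 [seq mask_of 11 b | b <- blocks11] [::] search11.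
Proof. by vm_compute. Qed.

Lemma search12_ok : check 12 6 [seq mask_of 12 b | b <- blocks12] [seq mask_of 12 (rcons b 11) | b <- blocks11] search12.
Proof. by vm_compute. Qed.

(** * Existence and uniqueness of S(4,5,11) and S(5,6,12) *)

Definition family_of n (bs : seq (seq nat)) : {set {set 'I_n}} :=
  [set e | e \in [seq bset n (mask_of n b) | b <- bs]].

Definition steiner_check n r (bs : seq (seq nat)) : bool :=
  [&& all (fun b => [&& size b == r, uniq b & all (fun x => x < n) b]) bs,
      pairwise (fun b c => meet (mask_of n b) (mask_of n c) + 2 <= r) bs
    & r * size bs == 'C(n, r.-1)].

(** A packing with binom(n, r-1) / r members covers every set of size r-1. *)
Lemma steiner_checkP n r bs : 0 < r -> steiner_check n r bs -> steiner_family r (family_of n bs).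
Proof.
move=> r0 /and3P[/allP wf pw /eqP cnt].
have cb b : b \in bs -> #|bset n (mask_of n b)| = r.
  by move/wf => /and3P[/eqP <- ub lb]; exact: card_bset_mask.
have m2 b c : b \in bs -> c \in bs -> bset n (mask_of n b) != bset n (mask_of n c) ->
    meet (mask_of n b) (mask_of n c) + 2 <= r.
  move=> bbs cbs ne.
  have sym : meet (mask_of n b) (mask_of n c) = meet (mask_of n c) (mask_of n b).
    by rewrite -!(@card_bset_meet n) ?size_mask_of // setIC.
  have /(pairwiseP [::]) pw' := pw.
  have bc : index b bs != index c bs.
    by apply: contraNneq ne => e; rewrite -(nth_index [::] bbs) e nth_index.
  case: (ltngtP (index b bs) (index c bs)) bc => // lt _.
    by have := pw' _ _ _ _ lt; rewrite !inE !index_mem !nth_index // => /(_ bbs cbs).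
  by rewrite sym; have := pw' _ _ _ _ lt; rewrite !inE !index_mem !nth_index // => /(_ cbs bbs).
have pF : packing r (family_of n bs).
  split=> [e|e f]; rewrite !inE => /mapP[b bbs ->]; first exact: cb.
  case/mapP=> c cbs -> ne; rewrite card_bset_meet ?size_mask_of //; exact: m2.
have cF : #|family_of n bs| = size bs.
  rewrite cardsE; have /card_uniqP -> : uniq [seq bset n (mask_of n b) | b <- bs]; last by rewrite size_map.
  rewrite uniq_pairwise pairwise_map; apply: sub_in_pairwise pw; last exact/allss.
  move=> b c bbs _ /= h; apply/eqP => e; move: h; rewrite -(@card_bset_meet n) ?size_mask_of // -e setIid cb //.
  by rewrite addn2 ltnNge leqnSn.
split=> //; apply/eqP; rewrite -cards_eq0.
by have := card_uncovered r0 pF; rewrite cF card_ord cnt -[RHS]add0n => /addIn ->.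
Qed.

Definition isomorphic_families (C D : finType) (F : {set {set C}}) (S : {set {set D}}) :=
  exists2 g : C -> D, bijective g & forall e : {set C}, (g @: e \in S) = (e \in F).

(** A block of S contains a set of size r-1, whose block in F is also in S, hence the same block.
    *)
Lemma steiner_family_sub_eq (C : finType) r (F S : {set {set C}}) : 3 <= r -> r < #|C| ->
  steiner_family r F -> steiner_family r S -> F \subset S -> F = S.
Proof.
move=> r3 rC stF stS FS; apply/eqP; rewrite eqEsubset FS; apply/subsetP => e eS.
have /card_gt0P[x xe] : 0 < #|e| by rewrite (stS.1.1 e eS); apply: leq_trans r3.
have cA : #|e :\ x| = r.-1 by rewrite -(stS.1.1 e eS) (cardsD1 x e) xe.
have [y yA yF] := completion stF cA; have xA : x \notin e :\ x by rewrite !inE eqxx.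
have eS' : x |: (e :\ x) \in S by rewrite setD1K.
have xy := completion_uniq r3 rC stS eS' (subsetP FS _ yF) xA yA.
by rewrite -(setD1K xe) {1}xy.
Qed.

Lemma isomorphic_of_contains n r bs (S : {set {set 'I_n}}) : 3 <= r -> r < n -> steiner_check n r bs ->
  steiner_family r S -> contains_std [seq mask_of n b | b <- bs] S ->
  isomorphic_families (family_of n bs) S.
Proof.
move=> r3 rn ck stS [f inf hf]; have stF := steiner_checkP (ltnW (ltnW r3)) ck.
have [g fK gK] : bijective f by exact: injF_bij.
have pre (e : {set _}) : g @: e = f @^-1: e by exact: can2_imset_pre gK fK.
exists g; first by exists f.
have stS' := @steiner_transport _ _ _ g _ (Bijective gK fK) stS.
have -> : family_of n bs = [set e : {set 'I_n} | g @: e \in S].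
  apply: (steiner_family_sub_eq r3 _ stF stS'); first by rewrite card_ord.
  by apply/subsetP => e'; rewrite inE => /mapP[b bbs ->]; rewrite inE pre; apply: hf; exact: map_f.
by move=> e; rewrite inE.
Qed.

Lemma isomorphic_trans (C D D' : finType) (F : {set {set C}}) (S : {set {set D}}) (S' : {set {set D'}}) :
  isomorphic_families F S -> isomorphic_families S S' -> isomorphic_families F S'.
Proof.
move=> [g bg hg] [h bh hh]; exists (h \o g); first exact: bij_comp.
by move=> e; rewrite imset_comp hh hg.
Qed.

Lemma isomorphic_of_ord n r (F : {set {set 'I_n}}) :
  (forall S : {set {set 'I_n}}, steiner_family r S -> isomorphic_families F S) ->
  forall (C : finType) (S : {set {set C}}), #|C| = n -> steiner_family r S -> isomorphic_families F S.
Proof.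
move=> H C S cC stS; subst n; have bg : bijective (@enum_val C predT) by exact: enum_val_bij.
apply: isomorphic_trans (H _ (steiner_transport bg stS)) _.
by exists (@enum_val C predT) => // e; rewrite inE.
Qed.

Lemma steiner_check11 : steiner_check 11 5 blocks11.
Proof. by vm_compute. Qed.

Lemma steiner_check12 : steiner_check 12 6 blocks12.
Proof. by vm_compute. Qed.

Lemma small_witt_unique (S : {set {set 'I_11}}) : steiner_family 5 S ->
  contains_std [seq mask_of 11 b | b <- blocks11] S.
Proof. by move=> stS; apply: check_sound search11_ok stS _. Qed.

Section Derived.
Variables (n r : nat) (S : {set {set 'I_n.+1}}).
Hypotheses (r2 : 2 <= r) (stS : steiner_family r.+1 S).

(** A block of the derived system together with the point at which the system is derived. *)
Definition cone (e : {set 'I_n}) : {set 'I_n.+1} := ord_max |: (lift ord_max @: e).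

Lemma card_cone e : #|cone e| = #|e|.+1.
Proof.
rewrite cardsU1 card_imset; last exact: lift_inj.
by case: imsetP => // -[x _] /eqP; rewrite (negbTE (neq_lift _ _)).
Qed.

Lemma in_cone (e : {set 'I_n}) x : (lift ord_max x \in cone e) = (x \in e).
Proof.
by rewrite in_setU1 eq_sym (negbTE (neq_lift _ _)) mem_imset //; exact: lift_inj.
Qed.

Lemma cone_inj : injective cone.
Proof. by move=> e f h; apply/setP => x; rewrite -!in_cone h. Qed.

Lemma coneI e f : cone e :&: cone f = cone (e :&: f).
Proof.
apply/setP => x; rewrite in_setI; case: (unliftP ord_max x) => [y ->|->]; last by rewrite !setU11.
by rewrite !in_cone in_setI.
Qed.

Lemma steiner_derived : steiner_family r [set e | cone e \in S].
Proof.
split; [split|].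
- by move=> e; rewrite inE => /stS.1.1; rewrite card_cone => -[].
- move=> e f; rewrite !inE => eS fS ef; have := stS.1.2 _ _ eS fS; rewrite (inj_eq cone_inj) => /(_ ef).
  by rewrite coneI card_cone addSn ltnS.
apply/eqP; rewrite -subset0; apply/subsetP => A; rewrite inE => /andP[/eqP cA /forallP nA].
have cA' : #|cone A| = r.+1.-1 by rewrite card_cone cA prednK // ltnW.
have [x xA xS] := completion stS cA'.
case: (unliftP ord_max x) xA xS => [y ->|->]; last by rewrite setU11.
rewrite in_cone => yA; have := nA y; rewrite yA inE => /negP H yS; case: H.
by rewrite /cone imsetU1 setUCA.
Qed.

End Derived.

Lemma bset_rcons n b : bset n.+1 (mask_of n.+1 (rcons b n)) = cone (bset n (mask_of n b)).
Proof.
apply/setP => x; rewrite in_bset_mask mem_rcons inE.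
case: (unliftP ord_max x) => [y ->|->]; last by rewrite /= eqxx setU11.
have -> : val (lift ord_max y) = y by exact: lift_max.
by rewrite in_cone in_bset_mask ltn_eqF.
Qed.

(** The derived system at the last point is an S(4,5,11), so up to a relabelling that fixes this
    point the blocks through it are the standard ones, and the search finds the rest. *)
Lemma large_witt_unique (S : {set {set 'I_12}}) : steiner_family 6 S ->
  contains_std [seq mask_of 12 b | b <- blocks12] S.
Proof.
move=> stS; have [f inf hf] := small_witt_unique (@steiner_derived 11 5 S isT stS).
pose h (x : 'I_12) : 'I_12 := if unlift ord_max x is Some y then lift ord_max (f y) else ord_max.
have hl y : h (lift ord_max y) = lift ord_max (f y) by rewrite /h liftK.
have hm : h ord_max = ord_max by rewrite /h unlift_none.
have inh : injective h.
  move=> x y; case: (unliftP ord_max x) => [x' ->|->]; case: (unliftP ord_max y) => [y' ->|->]; rewrite ?hl ?hm //.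
  - by move/lift_inj/inf ->.
  - by move/eqP; rewrite eq_sym (negbTE (neq_lift _ _)).
  - by move/eqP; rewrite (negbTE (neq_lift _ _)).
have [g hK gK] : bijective h by exact: injF_bij.
have pre (e : {set _}) : g @: e = h @^-1: e by exact: can2_imset_pre gK hK.
have stS' := @steiner_transport _ _ _ g _ (Bijective gK hK) stS.
have [b /mapP[b0 b0b ->]|f' inf' hf'] := check_sound (isT : 0 < 6) search12_ok stS' _.
  split; first exact: size_mask_of.
  rewrite inE pre bset_rcons; have := hf _ (map_f _ b0b); rewrite inE; congr (_ \in S).
  apply/setP => x; rewrite [RHS]inE; case: (unliftP ord_max x) => [y ->|->]; last by rewrite hm !setU11.
  by rewrite hl !in_cone inE.
exists (f' \o h); first exact: inj_comp.
by move=> b /hf'; rewrite inE pre; congr (_ \in S); apply/setP => x; rewrite !inE.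
Qed.

(** * Blow-ups by cloning *)

Section Clone.
Variables (C : finType) (r : nat) (F : {set {set C}}) (G : hypergraph) (psi : vertex G -> C).
Variables (v : vertex G) (U : finType).
Hypotheses (uF : unif r F) (eG : edges G = pullback r psi F).

Definition clone_map (x : vertex G + U) : C := if x is inl y then psi y else psi v.

Lemma inl_imset_inj : injective (@inl (vertex G) U).
Proof. by move=> x y []. Qed.

Lemma clone_map_inl (e : {set vertex G}) : clone_map @: (inl @: e) = psi @: e.
Proof. by rewrite -imset_comp; apply: eq_imset. Qed.

Lemma clone_map_new x : x \in clone_set v U -> clone_map x = psi v.
Proof. by rewrite in_setU1 => /orP[/eqP -> //|/imsetP[u _ ->]]. Qed.

(** An edge of the blow-up contains at most one vertex of the cloned set, since all these vertices
    have the same image. *)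
Lemma edges_clone : edges (clone v U) = pullback r clone_map F.
Proof.
apply/setP => e; rewrite in_setU inE; apply/idP/idP.
  case/orP => [/imsetP[e0]|/imset2P[w I wW]].
    rewrite inE eG inE => /andP[/andP[c0 F0] _] ->.
    by rewrite clone_map_inl F0 card_imset ?c0 //; exact: inl_imset_inj.
    rewrite inE eG => /andP[vI]; rewrite inE => /andP[/eqP cI FI] ->.
  have wI : w \notin inl @: I.
    apply/imsetP => -[x xI ew]; move: wW; rewrite ew in_setU1 => /orP[/eqP[exv]|/imsetP[//]].
    by rewrite -exv xI in vI.
  rewrite cardsU1 wI card_imset; last exact: inl_imset_inj.
  by rewrite imsetU1 (clone_map_new wW) clone_map_inl -imsetU1 FI -cI cardsU1 vI eqxx.
case/andP => /eqP ce Fe.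
have inj : {in e &, injective clone_map} by apply/imset_injP; rewrite ce (uF Fe).
have back (e' : {set vertex G + U}) : (forall x, x \in e' -> exists y, x = inl y) -> inl @: (inl @^-1: e') = e'.
  move=> h; apply/setP => x; apply/imsetP/idP => [[y]|xe]; first by rewrite inE => ye ->.
  by have [y ey] := h x xe; exists y => //; rewrite inE -ey.
have new x : (exists y, x = inl y) \/ x \in clone_set v U.
  case: x => [y|u]; [by left; exists y | right]; rewrite in_setU1; apply/orP; right; exact: imset_f.
have [/existsP[w /andP[we wW]]|none] := boolP [exists w, (w \in e) && (w \in clone_set v U)].
  have old x : x \in e -> x != w -> x \notin clone_set v U.
    move=> xe; apply: contraNN => xW; apply/eqP/(inj _ _ xe we); by rewrite !clone_map_new.
  have eI : inl @: (inl @^-1: (e :\ w)) = e :\ w.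
    apply: back => x; rewrite !inE => /andP[xw xe]; case: (new x) => // xW.
    by have := old x xe xw; rewrite xW.
  apply/orP; right; apply/imset2P; exists w (inl @^-1: (e :\ w)) => //; last by rewrite eI setD1K.
  have vI : v \notin inl @^-1: (e :\ w).
    rewrite inE in_setD1; apply/negP => /andP[vw ve].
    by have := old _ ve vw; rewrite setU11.
  rewrite inE vI eG inE cardsU1 vI -(card_imset _ inl_imset_inj) eI imsetU1 -clone_map_inl eI.
  by rewrite -(clone_map_new wW) -imsetU1 setD1K // Fe andbT -ce (cardsD1 w e) we eqxx.
have e0 : inl @: (inl @^-1: e) = e.
  apply: back => x xe; case: (new x) => // xW; case/negP: none; by apply/existsP; exists x; rewrite xe.
apply/orP; left; apply/imsetP; exists (inl @^-1: e) => //.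
rewrite inE eG inE -(card_imset _ inl_imset_inj) e0 ce eqxx -clone_map_inl e0 Fe inE.
apply/negP => ve; case/negP: none; apply/existsP; exists (inl v).
by rewrite ve setU11.
Qed.

Lemma card_part_clone i : #|part clone_map i| = #|part psi i| + (if psi v == i then #|U| else 0).
Proof.
have inr_inj : injective (@inr (vertex G) U) by move=> x y [].
have -> : part clone_map i = inl @: part psi i :|: inr @: [set u : U | psi v == i].
  apply/setP => -[y|u]; rewrite in_part in_setU.
    rewrite mem_imset; last exact: inl_imset_inj.
    rewrite in_part; case: imsetP => [[//]|]; by rewrite orbF.
  case: imsetP => [[//]|_] /=; by rewrite mem_imset ?inE.
rewrite cardsU [X in _ - X]eq_card0 ?subn0; last first.
  by move=> x; rewrite in_setI; apply/negP => /andP[/imsetP[y _ ->] /imsetP[]].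
rewrite card_imset; last exact: inl_imset_inj.
rewrite card_imset //; congr (_ + _).
by case: ifP => _; [rewrite -cardsT | rewrite -(cards0 U)]; apply: eq_card => u; rewrite !inE.
Qed.

End Clone.

(** The points are cloned one after the other; F itself is its blow-up along the identity. *)
Lemma clone_to_sizes m r (F : {set {set 'I_m}}) (k : 'I_m -> nat) : unif r F ->
  exists H (psi : vertex H -> 'I_m), [/\ clone_delete (Hypergraph F) H,
    edges H = pullback r psi F & forall i, #|part psi i| = (k i).+1].
Proof.
move=> uF; suff [H [psi [cH eH hH]]] : exists H (psi : vertex H -> 'I_m),
    [/\ clone_delete (Hypergraph F) H, edges H = pullback r psi F &
        forall i, #|part psi i| = (if i \in enum 'I_m then k i else 0).+1].
  by exists H, psi; split => // i; rewrite hH mem_enum.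
have := enum_uniq 'I_m; elim: (enum 'I_m) => [_|j s IH /andP[js us]].
  exists (Hypergraph F), id; split; first exact: clone_delete_refl.
    by apply/setP => e; rewrite inE imset_id /=; case: (boolP (e \in F)) => [/uF ->|]; rewrite ?eqxx ?andbF.
  move=> i; have -> : part (@id (vertex (Hypergraph F))) i = [set i] by apply/setP => x; rewrite in_part inE.
  by rewrite cards1.
have [H [psi [cH eH hH]]] := IH us.
have /card_gt0P[v] : 0 < #|part psi j| by rewrite hH.
rewrite in_part => /eqP vj.
exists (clone v 'I_(k j)), (@clone_map _ _ psi v _); split.
- exact: clone_delete_clone.
- exact: edges_clone.
move=> i; rewrite card_part_clone hH vj inE; case: eqVneq => [<-|_]; last by rewrite addn0.
by rewrite (negbTE js) card_ord add1n.
Qed.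

(** Vertices correspond by their positions in the enumerations of the fibres. *)
Lemma fibre_bijection (A B C : finType) (psi : A -> C) (phi : B -> C) (b0 : B) :
  (forall i, #|part psi i| = #|part phi i|) -> exists2 f : A -> B, bijective f & forall x, phi (f x) = psi x.
Proof.
move=> h; pose f x := nth b0 (enum (part phi (psi x))) (index x (enum (part psi (psi x)))).
have lt x : index x (enum (part psi (psi x))) < size (enum (part phi (psi x))).
  by rewrite -cardE -h cardE index_mem mem_enum in_part.
have hf x : phi (f x) = psi x.
  by have := mem_nth b0 (lt x); rewrite mem_enum in_part => /eqP.
exists f => //; have total (D : finType) (g : D -> C) : #|D| = \sum_i #|part g i|.
  rewrite -sum1_card (partition_big g predT) //; apply: eq_bigr => i _.
  by rewrite -sum1_card; apply: eq_bigl => x; rewrite in_part.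
apply: inj_card_bij; last by rewrite !(total _ psi, total _ phi); apply: leq_sum => i _; rewrite h.
move=> x y exy; have pxy : psi x = psi y by rewrite -!hf exy.
move: exy; rewrite /f pxy => /eqP; rewrite nth_uniq ?enum_uniq ?lt -?pxy ?lt // => /eqP {}exy.
have mem z : psi x = psi z -> z \in enum (part psi (psi x)) by move=> ez; rewrite mem_enum in_part ez.
exact: index_inj (mem x (erefl _)) (mem y pxy) exy.
Qed.

Lemma blowup_pullback m r (F : {set {set 'I_m}}) (V : finType) (phi : V -> 'I_m) : unif r F -> 0 < m ->
  (forall i, exists v, phi v = i) -> blowup (Hypergraph F) (Hypergraph (pullback r phi F)).
Proof.
move=> uF m0 sphi; have [v0 _] := sphi (Ordinal m0).
have pos i : 0 < #|part phi i| by have [v <-] := sphi i; apply/card_gt0P; exists v; rewrite in_part.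
have [H [psi [cH eH hH]]] := clone_to_sizes (fun i => #|part phi i|.-1) uF.
have [i|f bf hf] := @fibre_bijection _ _ _ psi phi v0; first by rewrite hH prednK.
exists H => //; exists f => // e; rewrite eH !inE card_imset; last exact: bij_inj.
by rewrite -imset_comp (eq_imset _ hf).
Qed.

(** * Generalized triangles and the family Sigma *)

Lemma card_ord_pred n (P : pred nat) : #|[set i : 'I_n | P i]| = count P (iota 0 n).
Proof. by rewrite -sum1dep_card -(big_mkord P (fun=> 1)) sum1_count /index_iota subn0. Qed.

(** The vertices of the triangle are labelled in the order: the common part I, then a and b, then
    the rest of D. *)
Lemma Tfree_of_free r (V : finType) (E : {set {set V}}) : 2 <= r -> unif r E ->
  free (family1 (generalized_triangle r)) (Hypergraph E) -> Tfree E.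
Proof.
move=> r2 uE fE I a b D aIE bIE DE aI bI ab aD bD dis.
have cI : #|I| = r.-1 by rewrite -(uE _ aIE) cardsU1 aI.
have cD : #|D :\ a :\ b| = r - 2.
  have := uE _ DE; rewrite (cardsD1 a D) aD (cardsD1 b (D :\ a)) !inE eq_sym ab bD.
  by move=> <-; rewrite !add1n !subSS subn0.
have aDI : a \notin D :\ a :\ b by rewrite !inE eqxx andbF.
have bDI : b \notin D :\ a :\ b by rewrite !inE eqxx.
pose s := enum I ++ a :: b :: enum (D :\ a :\ b).
have ss : size s = 2 * r - 1.
  by rewrite size_cat /= -!cardE cI cD; clear -r2; lia.
have ID x : x \in I -> x \in D = false by move=> xI; rewrite (disjointFr dis).
have us : uniq s.
  rewrite cat_uniq enum_uniq cons_uniq cons_uniq enum_uniq inE negb_or ab !mem_enum aDI bDI !andbT /=.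
  rewrite !negb_or !mem_enum aI bI /=; apply/hasPn => x; rewrite mem_enum !inE => /and3P[_ _ xD].
  by rewrite mem_enum; apply/negP => xI; rewrite ID in xD.
pose f (i : 'I_(2 * r - 1)) := nth a s i.
have lt x : x \in s -> index x s < 2 * r - 1 by rewrite -ss index_mem.
apply: (fE _ (erefl _)); exists f.
  by move=> i j /eqP; rewrite nth_uniq ?ss // => /eqP; exact: val_inj.
have img (P : pred nat) x : (x \in f @: [set i : 'I_(2 * r - 1) | P i]) = (x \in s) && P (index x s).
  apply/imsetP/andP => [[i]|[xs Px]].
    by rewrite inE => Pi ->; rewrite /f mem_nth ?ss // index_uniq ?ss.
  by exists (Ordinal (lt x xs)); rewrite ?inE // /f nth_index.
have idx x : index x s = if x \in I then index x (enum I) else if x == a then r.-1 else if x == b then r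
     else (r.+1 + index x (enum (D :\ a :\ b)))%N.
  rewrite index_cat mem_enum; case: ifP => // _; rewrite -cardE cI /= eq_sym; case: ifP => _; first by rewrite addn0.
  rewrite eq_sym; case: ifP => _; first by rewrite addn1 prednK // ltnW.
  by rewrite !addnS -!addSn prednK // ltnW.
have ltI x : x \in I -> index x (enum I) < r.-1 by move=> xI; rewrite -cI cardE index_mem mem_enum.
have memD x : (x \in D) = [|| x == a, x == b | x \in D :\ a :\ b].
  by rewrite !inE; case: eqVneq => [->|_] //=; case: eqVneq => [->|_].
have mems x : x \in s = [|| x \in I, x == a, x == b | x \in D :\ a :\ b].
  by rewrite mem_cat mem_enum inE inE mem_enum.
have r1 : r.-1.+1 = r by rewrite prednK // ltnW.
move=> e; rewrite !inE => /orP[/orP[]|] /eqP ->.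
- rewrite (_ : f @: _ = a |: I) //; apply/setP => x; rewrite (img (fun i => i.+1 <= r)) mems idx in_setU1.
  case: ifP => [/ltI xi|_]; first by rewrite orbT (leq_trans xi) // leq_pred.
  case: eqP => _ /=; first by rewrite r1 leqnn.
  by case: eqP => _; rewrite ?ltnn ?andbF // -ltnS ltnNge -addSn ltnW ?andbF // addSn ltnS addSn ltnS leq_addr.
- rewrite (_ : f @: _ = b |: I) //; apply/setP => x.
  rewrite (img (fun i => (i.+1 <= r.-1) || (i.+1 == r.+1))) mems idx in_setU1.
  case: ifP => [/ltI xi|xI]; first by rewrite orbT xi.
  case: (eqVneq x a) => [->|xa] /=; first by rewrite (negbTE ab) ?orbF; clear -r2; lia.
  case: eqP => _ /=; first by rewrite eqxx orbT.
  by apply/negP => /andP[_]; move: (index _ _) => k; clear -r2; lia.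
- rewrite (_ : f @: _ = D) //; apply/setP => x; rewrite (img (fun i => r <= i.+1)) mems idx memD.
  case: ifP => [xI|xI].
    have := ID x xI; rewrite memD => -> /=; have := ltI x xI; move: (index _ _) => k; clear -r2; lia.
  case: eqP => _ /=; first by rewrite r1 leqnn.
  case: eqP => _ /=; first by rewrite leqnSn.
  by move: (x \in _) (index _ _) => c k; case: c => //; clear -r2; lia.
Qed.

Lemma free_of_Sfree r (V : finType) (E : {set {set V}}) : 0 < r -> unif r E -> Sfree E ->
  free (Sigma r) (Hypergraph E).
Proof.
move=> r0 uE fE F [uF _ [D1 [D2 [D3 [eF c12 sub]]]]] [f inf hf].
have [m1 m2 m3] : [/\ D1 \in edges F, D2 \in edges F & D3 \in edges F] by rewrite eF !inE !eqxx !orbT.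
have cF D : D \in edges F -> #|D| = r by move=> h; apply/eqP; move/forall_inP: uF; apply.
have one (A B : {set vertex F}) : #|A| = r -> #|A :&: B| = r.-1 -> exists x, A :\: B = [set x].
  move=> cA cAB; apply/cards1P; rewrite -(eqn_add2l #|A :&: B|) cardsID cA cAB addn1 prednK //.
have [x ex] := one D1 D2 (cF _ m1) c12.
have [y ey] : exists y, D2 :\: D1 = [set y] by apply: one; [exact: cF | rewrite setIC].
have [xD1 xD2] : x \in D1 /\ x \notin D2 by have := set11 x; rewrite -ex inE => /andP[].
have [yD2 yD1] : y \in D2 /\ y \notin D1 by have := set11 y; rewrite -ey inE => /andP[].
have e1 : D1 = x |: (D1 :&: D2) by rewrite -ex setUC setID.
have e2 : D2 = y |: (D1 :&: D2) by rewrite -ey setUC [D1 :&: D2]setIC setID.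
have [xD3 yD3] : x \in D3 /\ y \in D3.
  by split; apply: (subsetP sub); rewrite ex ey !inE eqxx ?orbT.
apply: (fE (f @: (D1 :&: D2)) (f x) (f y) (f @: D3)); rewrite -?imsetU1 -?e1 -?e2; try exact: hf.
- by rewrite mem_imset // inE (negbTE xD2) andbF.
- by rewrite mem_imset // inE (negbTE yD1).
- by rewrite (inj_eq inf); apply: contraNneq xD2 => ->.
- exact: imset_f.
- exact: imset_f.
Qed.

(** The required cardinalities are counts over the labels below 2r-1, which are computed. *)
Lemma triangle_Sigma r : r = 5 \/ r = 6 -> Sigma r (generalized_triangle r).
Proof.
pose N := 2 * r - 1; pose set_of (P : pred nat) := [set i : 'I_N | P i].
have main (P1 P2 P3 : pred nat) : edges (generalized_triangle r) = [set set_of P1; set_of P2; set_of P3] ->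
   [&& count P1 (iota 0 N) == r, count P2 (iota 0 N) == r, count P3 (iota 0 N) == r,
    count (predI P1 P2) (iota 0 N) == r.-1, ~~ all (fun i => P1 i == P2 i) (iota 0 N), ~~ all (fun i => P1 i == P3 i) (iota 0 N),
    ~~ all (fun i => P2 i == P3 i) (iota 0 N) & all (fun i => (P1 i (+) P2 i) ==> P3 i) (iota 0 N)] ->
   Sigma r (generalized_triangle r).
  move=> eE /and5P[/eqP c1 /eqP c2 /eqP c3 /eqP c12 /and4P[n12 n13 n23 /allP sub]].
  have ne P Q : ~~ all (fun i => P i == Q i) (iota 0 N) -> set_of P != set_of Q.
    apply: contraNneq => /setP e; apply/allP => i; rewrite mem_iota => /= iN.
    by have := e (Ordinal iN); rewrite !inE => ->.
  split.
  - by apply/forall_inP => e; rewrite eE !inE => /orP[/orP[]|] /eqP ->; rewrite card_ord_pred ?c1 ?c2 ?c3.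
  - by rewrite eE setUC cardsU1 !inE negb_or eq_sym ne //= eq_sym ne // cards2 ne.
  exists (set_of P1), (set_of P2), (set_of P3); split => //.
    by rewrite -c12 -card_ord_pred; apply: eq_card => i; rewrite !inE.
  apply/subsetP => i; rewrite !inE => h; have := sub i; rewrite mem_iota ltn_ord => /(_ isT) /implyP; apply.
  by move: h; case: (P1 i); case: (P2 i).
move=> hr; apply: (main (fun i => i.+1 <= r) (fun i => (i.+1 <= r.-1) || (i.+1 == r.+1)) (fun i => r <= i.+1) (erefl _)).
by rewrite /N; case: hr => ->; vm_compute.
Qed.

(** * Extremal numbers *)

Lemma uniformP r (V : finType) (E : {set {set V}}) : reflect (unif r E) (uniform r (Hypergraph E)).
Proof.
apply: (iffP forall_inP) => [h e eE|h e eE]; [by apply/eqP; exact: h | by apply/eqP; exact: h].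
Qed.

Lemma edges_le_ex r n Fs (V : finType) (E : {set {set V}}) : #|V| = n -> unif r E ->
  free Fs (Hypergraph E) -> #|E| <= ex r n Fs.
Proof.
move=> cV uE fE; subst n; pose g := @enum_rank V; have ig : injective g := enum_rank_inj.
pose E' := [set g @: e | e : {set V} in E].
have -> : #|E| = #|E'| by rewrite card_imset //; exact: imset_inj.
have ok : uniform r (Hypergraph E') && `[< free Fs (Hypergraph E') >].
  apply/andP; split.
    by apply/uniformP => e /imsetP[e0 /uE <- ->]; rewrite card_imset.
  apply/asboolP => F FF [f inf hf]; apply: (fE F FF); exists (enum_val \o f).
    by apply: inj_comp inf; exact: enum_val_inj.
  move=> e /hf /imsetP[e0 e0E ee]; rewrite imset_comp ee -imset_comp.
  by rewrite (eq_imset _ (g := id)) ?imset_id // => x; exact: enum_rankK.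
exact: (@leq_bigmax_cond _ _ (fun E0 : {set {set 'I_#|V|}} => #|E0|) E' ok).
Qed.

Lemma free_triangle_of_Sigma r G : r = 5 \/ r = 6 -> free (Sigma r) G -> free (family1 (generalized_triangle r)) G.
Proof. by move=> hr fG F ->; apply: fG; exact: triangle_Sigma. Qed.

Lemma steiner_of_family r m (S : {set {set 'I_m}}) : 3 <= r -> r < m -> steiner_family r S ->
  steiner m r (Hypergraph S).
Proof.
move=> r3 rm stS; split; [exact: card_ord | exact/uniformP/stS.1.1 |] => /= A cA.
have [x xA xS] := completion stS cA; apply/eqP/cards1P; exists (x |: A).
apply/setP => e; rewrite !inE; apply/andP/eqP => [[eS Ae]|->]; last by rewrite subsetUr.
have /cards1P[y ey] : #|e :\: A| == 1.
  rewrite -(eqn_add2l #|e :&: A|) cardsID (stS.1.1 _ eS) (setIidPr Ae) cA addn1 prednK //.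
  exact: leq_trans r3.
have yA : y \notin A by have := set11 y; rewrite -ey inE => /andP[].
have e1 : e = y |: A by rewrite -ey setUC -{1}(setIidPr Ae) setID.
rewrite e1 in eS *; rewrite -(completion_uniq r3 _ stS xS eS xA yA) //; by rewrite card_ord.
Qed.

Lemma family_of_steiner r m S : 3 <= r -> steiner m r S -> steiner_family r (edges S).
Proof.
case: S => V S r3 [_ /uniformP uS hS]; split; [split => // e f eS fS ef|].
  rewrite leqNgt; apply/negP => lt.
  have [A sA cA] : exists2 A : {set V}, A \subset e :&: f & #|A| = r.-1 by apply: subset_of_card; case: (r) r3 lt => // k _; rewrite addn2 !ltnS.
  have /eqP/cards1P[g hg] := hS A cA; move/setP: hg => hg.
  have := hg e; have := hg f; rewrite !inE.
  have -> : A \subset e by apply: subset_trans sA (subsetIl _ _).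
  have -> : A \subset f by apply: subset_trans sA (subsetIr _ _).
  rewrite /= in eS fS; rewrite eS fS => /esym/eqP e1 /esym/eqP e2.
  by rewrite e1 e2 eqxx in ef.
apply/eqP; rewrite -subset0; apply/subsetP => A; rewrite inE => /andP[/eqP cA /forallP nA].
have /eqP/cards1P[e he] := hS A cA; move/setP/(_ e): he; rewrite !inE eqxx => /andP[eS Ae].
have /cards1P[y ey] : #|e :\: A| == 1.
  rewrite -(eqn_add2l #|e :&: A|) cardsID (uS _ eS) (setIidPr Ae) cA addn1 prednK //.
  exact: leq_trans r3.
have yA : y \notin A by have := set11 y; rewrite -ey inE => /andP[].
by have := nA y; rewrite yA -ey setUC -{1}(setIidPr Ae) setID eS.
Qed.

Lemma pullback_isomorphic (V C D : finType) r (F : {set {set C}}) (S : {set {set D}}) (phi : V -> D) :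
  isomorphic_families F S -> (forall i, exists v, phi v = i) ->
  exists2 psi : V -> C, (forall i, exists v, psi v = i) & pullback r phi S = pullback r psi F.
Proof.
move=> [g [h gK hK] hg] sphi; exists (h \o phi).
  by move=> i; have [v ev] := sphi (g i); exists v; rewrite /= ev gK.
apply/setP => e; rewrite !inE -hg -imset_comp.
by rewrite (eq_imset (g := phi) _ (fun x => hK (phi x))).
Qed.

(** Blow-ups are free of Sigma_r and thus of T_r, so an extremal T_r-free graph has at least as
    many edges as any blow-up on its vertex set and is itself a blow-up.  In particular it is free
    of Sigma_r, which makes the two extremal numbers equal. *)
Theorem extremal_structure r m (F : {set {set 'I_m}}) : witt_pair r m -> steiner_family r F ->
  (forall S : {set {set 'I_m}}, steiner_family r S -> isomorphic_families F S) ->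
  exists n0 : nat, forall n : nat, n0 <= n ->
    ex r n (family1 (generalized_triangle r)) = ex r n (Sigma r) /\
    forall G, extremal r n (family1 (generalized_triangle r)) G -> blowup (Hypergraph F) G.
Proof.
move=> wp stF uniqF; have [s [er sm]] := witt_pairP wp.
have hr : r = 5 \/ r = 6 by case: wp => -[-> _]; [left | right].
have r2 : 2 <= r by rewrite er.
have m0 : 0 < m by apply: leq_trans sm.
have [n0 H] := exact_structure wp stF.
exists n0 => n hn.
have freeK (V : finType) (phi : V -> 'I_m) S : steiner_family r S -> free (Sigma r) (Hypergraph (pullback r phi S)).
  by move=> stS; apply: free_of_Sfree; [exact: ltnW | exact: pullback_unif | exact: pullback_Sfree stS.1].
have key (V : finType) (E : {set {set V}}) : #|V| = n -> unif r E ->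
    free (family1 (generalized_triangle r)) (Hypergraph E) ->
    #|E| = ex r n (family1 (generalized_triangle r)) ->
    exists (S : {set {set 'I_m}}) (phi : V -> 'I_m),
      [/\ steiner_family r S, forall i, exists v, phi v = i & E = pullback r phi S].
  move=> cV uE fE mE; apply: H => //; [by rewrite cV | exact: Tfree_of_free fE |].
  move=> phi S stS; rewrite mE; apply: edges_le_ex => //; first exact: pullback_unif.
  by apply: free_triangle_of_Sigma => //; exact: freeK.
split; last first.
  case=> V E [cV /uniformP uE fE mE]; have [S [phi [stS sphi eE]]] := key V E cV uE fE mE.
  have [psi spsi eK] := pullback_isomorphic r (uniqF S stS) sphi.
  by rewrite eE eK; apply: blowup_pullback => //; exact: stF.1.1.
apply/eqP; rewrite eqn_leq; apply/andP; split; last first.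
  apply/bigmax_leqP => E /andP[/uniformP uE /asboolP fE].
  by apply: edges_le_ex => //; [exact: card_ord | exact: free_triangle_of_Sigma].
pose phi0 (v : 'I_n) := Ordinal m0.
have K0 : uniform r (Hypergraph (pullback r phi0 F)) && `[< free (family1 (generalized_triangle r)) (Hypergraph (pullback r phi0 F)) >].
  apply/andP; split; first exact/uniformP/pullback_unif.
  by apply/asboolP; apply: free_triangle_of_Sigma => //; exact: freeK.
have [|E /andP[/uniformP uE /asboolP fE] mE] := @eq_bigmax_cond _
  [pred E : {set {set 'I_n}} | uniform r (Hypergraph E) && `[< free (family1 (generalized_triangle r)) (Hypergraph E) >]]
  (fun E => #|E|).
  by apply/card_gt0P; exists (pullback r phi0 F).
rewrite {1}/ex [X in X <= _]mE.
have [S [phi [stS _ eE]]] := key _ E (card_ord n) uE fE (esym mE).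
by rewrite eE; apply: edges_le_ex; [exact: card_ord | exact: pullback_unif | exact: freeK].
Qed.

Theorem unique_steiner_ord r m (F : {set {set 'I_m}}) : 3 <= r -> r < m -> steiner_family r F ->
  (forall S : {set {set 'I_m}}, steiner_family r S -> isomorphic_families F S) ->
  unique_steiner m r (Hypergraph F).
Proof.
move=> r3 rm stF uniqF; split; first exact: steiner_of_family.
move=> S stS; have [cS _ _] := stS.
exact: (isomorphic_of_ord uniqF cS (family_of_steiner r3 stS)).
Qed.

Theorem theorem1p1 (r : nat) (hr : r = 5 \/ r = 6) :
  exists n0 : nat, forall n : nat, n0 <= n ->
    ex r n (family1 (generalized_triangle r)) = ex r n (Sigma r) /\
    (forall G : hypergraph,
       extremal r n (family1 (generalized_triangle r)) G ->
       (r = 5 -> exists S : hypergraph, unique_steiner 11 5 S /\ blowup S G) /\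
       (r = 6 -> exists S : hypergraph, unique_steiner 12 6 S /\ blowup S G)).
Proof.
case: hr => ->.
- have st := steiner_checkP (isT : 0 < 5) steiner_check11.
  have un (S : {set {set 'I_11}}) (stS : steiner_family 5 S) :=
    @isomorphic_of_contains 11 5 blocks11 S isT isT steiner_check11 stS (small_witt_unique stS).
  have [|n0 H] := @extremal_structure 5 11 _ _ st un; first by left.
  exists n0 => n /H[e h]; split => // G /h bG; split => // _.
  by exists (Hypergraph (family_of 11 blocks11)); split => //; exact: unique_steiner_ord.
- have st := steiner_checkP (isT : 0 < 6) steiner_check12.
  have un (S : {set {set 'I_12}}) (stS : steiner_family 6 S) :=
    @isomorphic_of_contains 12 6 blocks12 S isT isT steiner_check12 stS (large_witt_unique stS).
  have [|n0 H] := @extremal_structure 6 12 _ _ st un; first by right.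
  exists n0 => n /H[e h]; split => // G /h bG; split => // _.
  by exists (Hypergraph (family_of 12 blocks12)); split => //; exact: unique_steiner_ord.
Qed.
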